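(* Let $k\in L^1(0,1)$ with $k(t)=t^rf(t)$, where $r>-1$, $f(0)\neq0$ and the (one-sided) derivative $f'(0)$ exists. Put $\mu=f'(0)/f(0)$ and $h(t)=f(0)t^re^{\mu t}$. Then for every $p\in[1,\infty]$: (i) $V_k^n\sim V_h^n$ on $L^p(0,1)$ as $n\to\infty$; (ii) consequently $$V_k^n\sim\frac{f(0)^n\Gamma(r+1)^n e^{-((r+1)n-1)}}{\Gamma((r+1)n)}S_{(r+1)n-1+\mu},\qquad \|V_k^n\|_p\sim\frac{C_p(|f(0)|\Gamma(r+1))^ne^{\mu}}{\Gamma((r+1)n+1)};$$ (iii) if $f_n(t)=e^{-g(n)nt}$ for $p=1$ (where $g$ is any function with $g(n)\to\infty$), $f_n(t)=e^{-((r+1)n-1+\mu)t/(p-1)}$ for $1<p<\infty$, and $f_n(t)=1$ for $p=\infty$, then $(f_n)$ is asymptotically extremal for $(V_k^n)$, i.e. $\|V_k^nf_n\|_p\sim\|V_k^n\|_p\|f_n\|_p$.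
   Context: For $k\in L^1(0,1)$, $V_k$ is the operator on $L^p(0,1)$ given by $(V_ku)(t)=\int_0^tk(t-s)u(s)\,ds$; $\|\cdot\|_p$ is the $L^p$ norm and the operator norm on $L^p(0,1)$. $(S_\lambda f)(t)=\int_0^1e^{\lambda(t-s)}f(s)\,ds$. $C_p=1/(p^{1/p}q^{1/q})$ if $1<p<\infty$ where $1/p+1/q=1$, and $C_p=1$ if $p\in\{1,\infty\}$. For operator sequences, $A_n\sim B_n$ means $\|A_n-B_n\|/\|A_n\|\to0$; for numbers, $a_n\sim b_n$ means $a_n/b_n\to1$. *)

(* Defs.v *)
From HB Require Import structures.
From mathcomp Require Import all_boot all_order all_algebra.
From mathcomp Require Import all_classical all_reals all_analysis.
Import Order.TTheory GRing.Theory Num.Theory numFieldNormedType.Exports.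
Local Open Scope classical_set_scope.
Local Open Scope ring_scope.

Section Defs.
Context {R : realType}.

Definition leb := (@lebesgue_measure R).

(* the interval (0,1) (closed version; endpoints are null sets) *)
Definition I01 : set R := `[0%R, 1%R].

Lemma mI01 : measurable I01.
Proof. exact: measurable_itv. Qed.

Definition mu01 := mrestr leb mI01.

Definition LpN (p : \bar R) (u : R -> R) : \bar R := Lnorm mu01 p (EFin \o u).

Definition Volt (k : R -> R) (u : R -> R) : R -> R :=
  fun t => \int[leb]_(s in `[0%R, t]) (k (t - s) * u s).

Definition Sop (l : R) (u : R -> R) : R -> R :=
  fun t => \int[leb]_(s in I01) (expR (l * (t - s)) * u s).

Definition op_sub (A B : (R -> R) -> (R -> R)) : (R -> R) -> (R -> R) :=
  fun u t => A u t - B u t.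

Definition op_scale (c : R) (A : (R -> R) -> (R -> R)) : (R -> R) -> (R -> R) :=
  fun u t => c * A u t.

(* operator norm on L^p(0,1): infimum of all admissible bounds (+oo if none) *)
Definition opnorm (p : \bar R) (A : (R -> R) -> (R -> R)) : \bar R :=
  ereal_inf [set c%:E | c in [set c : R | 0 <= c /\
     forall u : R -> R, measurable_fun I01 u -> (LpN p u < +oo)%E ->
       (LpN p (A u) <= c%:E * LpN p u)%E]].

Definition asym_op (p : \bar R) (A B : nat -> (R -> R) -> (R -> R)) : Prop :=
  (\forall n \near \oo, (0 < opnorm p (A n))%E /\ (opnorm p (A n) < +oo)%E /\
                        (opnorm p (op_sub (A n) (B n)) < +oo)%E) /\
  ((fun n => fine (opnorm p (op_sub (A n) (B n))) / fine (opnorm p (A n)))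
     @ \oo --> (0 : R)).

Definition asym_num (a b : nat -> R) : Prop :=
  (fun n => a n / b n) @ \oo --> (1 : R).

Definition Gamma (s : R) : R :=
  \int[leb]_(t in `]0%R, +oo[) (t `^ (s - 1) * expR (- t)).

Definition Cp (p : \bar R) : R :=
  match p with
  | x%:E => if x == 1 then 1
            else let q := x / (x - 1) in (x `^ (1 / x) * q `^ (1 / q))^-1
  | _ => 1
  end.

Definition asym_extremal (p : \bar R) (A : nat -> (R -> R) -> (R -> R))
  (fs : nat -> R -> R) : Prop :=
  asym_num (fun n => fine (LpN p (A n (fs n))))
           (fun n => fine (opnorm p (A n)) * fine (LpN p (fs n))).

End Defs.

(* Main.v *)
Require Import Defs.
From HB Require Import structures.
From mathcomp Require Import all_boot all_order all_algebra.
From mathcomp Require Import all_classical all_reals all_analysis.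
From mathcomp Require Import measurable_realfun ess_sup_inf.
From mathcomp Require Import ring lra.
Import Order.TTheory GRing.Theory Num.Theory numFieldNormedType.Exports.
Local Open Scope classical_set_scope.
Local Open Scope ring_scope.

(* Multiplying by [expR (- (l * t))] turns the powers of the Volterra operator into
   convolution powers on the whole line, of kernels integrable over the line.  The
   model kernel [t ^ (a - 1) exp (m0 t)], where [a = r + 1] and [m0 = f' 0 / f 0],
   has explicit powers, proportional to [t ^ (a n - 1) exp (m0 t)] by the Beta
   integral.  With [l] about [a n], kernel values at distance at least [th] from 0
   only contribute an exponentially small relative error, by Young's inequality;
   near 0 the kernel differs from the model by at most the factor [exp (eps t) - 1],
   so that the difference of the powers is dominated by the difference of two explicit
   powers.  Finally [t ^ m = exp (- m (1 - t)) + O(1 / m) exp (- m (1 - t) / 2)], so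
   the model power is close to a rank-one operator, whose norm and extremal functions
   are given by Hoelder's inequality. *)

Set Implicit Arguments.
Unset Strict Implicit.
Unset Printing Implicit Defensive.

(** On (0,1), undoing the multiplication by [expR (- (l * t))] costs [e^l], while the twisted model
    has mass about [F / l^a] with [F = |f 0| Gamma a]. The product [e^l (F / l^a)^n] is least at
    [l = a n], where Stirling bounds it by a constant times [F^n / Gamma (a n)]. The true norm is
    smaller by a factor of order [n]. Mass estimates thus lose a polynomial factor, which an
    exponentially small error absorbs but the kernel near 0 cannot afford; there the comparison has
    to be pointwise. It works because multiplication by an exponential commutes with convolution: if
    each factor lies within the relative error [e^(eps t) - 1] of the model, so does the n-th power,
    with the same [eps], since the arguments of the n factors add up to [t]. Differentiability of
    [f] at 0 is what gives a relative error of this form. The bounding kernels of that comparison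
    and of the replacement of [t^m] by an exponential have rank one, with Hoelder constants of the
    order [1 / n] that the true norm requires, so that every [p] is treated alike. *)

Section LebesgueInvariance.
Context {R : realType}.
Local Notation mu := (@lebesgue_measure R).
Local Open Scope ereal_scope.

Definition affine (a b : R) : measurableTypeR R -> measurableTypeR R :=
  fun x => (a * x + b)%R.

Let measurable_affine a b : measurable_fun setT (affine a b).
Proof. by apply: measurable_funD => //; exact: measurable_funM. Qed.

HB.instance Definition _ a b :=
  isMeasurableFun.Build _ _ _ _ (affine a b) (measurable_affine a b).

Let affine_preimage (a b : R) (x y : R) : (0 < a)%R ->
  affine a b @^-1` `]x, y] = `]((x - b) / a)%R, ((y - b) / a)%R]%classic.
Proof.
move=> a0; apply/seteqP; split => t /=; rewrite !in_itv /= /affine;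
  by rewrite ltr_pdivrMr// ler_pdivlMr// ltrBlDr lerBrDr mulrC.
Qed.

(** [a] times the image of [mu] under the map gives half-open intervals their length, and Lebesgue
    measure is determined by those values. *)
Lemma ge0_integral_affine (a b : R) (f : R -> \bar R) : (0 < a)%R ->
  measurable_fun setT f -> (forall x, 0 <= f x) ->
  \int[mu]_x f x = a%:E * \int[mu]_x f (a * x + b)%R.
Proof.
move=> a0 mf f0.
have a_nng : (0 <= a)%R by exact: ltW.
pose nu0 := mscale (NngNum a_nng) (pushforward mu (affine a b)).
pose nu := nu0 (measurable_affine a b).
have H A : measurable A -> mu A = nu A.
  move=> mA; apply: lebesgue_measure_unique => //= _ [[x y]] _ <-.
  rewrite /nu /nu0 /mscale /= /pushforward affine_preimage// !lebesgue_measure_itv/=.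
  rewrite !lte_fin ltr_pM2r ?invr_gt0// ltrD2r.
  case: ifPn => _; last by rewrite mule0.
  by rewrite -!EFinB -EFinM; congr (_%:E); field; rewrite gt_eqF.
transitivity (\int[nu]_x f x).
  by apply: eq_measure_integral => A mA _; exact: H.
rewrite ge0_integral_mscale//=; congr (_ * _).
by rewrite ge0_integral_pushforward.
Qed.

Lemma ge0_integral_shift (b : R) (f : R -> \bar R) :
  measurable_fun setT f -> (forall x, 0 <= f x) ->
  \int[mu]_x f (x + b)%R = \int[mu]_x f x.
Proof.
move=> mf f0; rewrite [RHS](@ge0_integral_affine 1 b)// mul1e.
by apply: eq_integral => x _; rewrite mul1r.
Qed.

Lemma ge0_integral_opp (f : R -> \bar R) :
  measurable_fun setT f -> (forall x, 0 <= f x) ->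
  \int[mu]_x f (- x)%R = \int[mu]_x f x.
Proof.
move=> mf f0.
transitivity (\int[pushforward mu (-%R : _ -> measurableTypeR R)]_x f x).
  by rewrite ge0_integral_pushforward.
by apply: eq_measure_integral => A mA _; exact: lebesgue_measureN.
Qed.

Lemma ge0_integral_reflect (b : R) (f : R -> \bar R) :
  measurable_fun setT f -> (forall x, 0 <= f x) ->
  \int[mu]_x f (b - x)%R = \int[mu]_x f x.
Proof.
move=> mf f0; rewrite -(@ge0_integral_opp (fun x => f (b - x)%R))//.
  rewrite -[RHS](ge0_integral_shift b)//.
  by apply: eq_integral => x _; rewrite opprK addrC.
by apply: (measurableT_comp mf); exact: measurable_funB.
Qed.

Lemma integral_shift (b : R) (f : R -> \bar R) : measurable_fun setT f ->
  \int[mu]_x f (x + b)%R = \int[mu]_x f x.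
Proof.
move=> mf; rewrite integralE [RHS]integralE.
have E1 := ge0_integral_shift b (measurable_funepos mf) (funepos_ge0 _).
have E2 := ge0_integral_shift b (measurable_funeneg mf) (funeneg_ge0 _).
rewrite -E1 -E2; congr (_ - _); apply: eq_integral => x _.
  by rewrite -[LHS]/((fun x0 => f (x0 + b)%R)^\+ x) !funeposE.
by rewrite -[LHS]/((fun x0 => f (x0 + b)%R)^\- x) !funenegE.
Qed.

End LebesgueInvariance.

(** * Real-valued integrals on the line *)

Section RIntegralFacts.
Context {R : realType}.
Local Notation mu := (@lebesgue_measure R).
Implicit Types (f g : R -> R) (D : set R).

(** Fubini yields sections known to be integrable only together with their constant factor, which
    may vanish; hence integrability is asked of the product and [c = 0] is split off. *)
Lemma Rint_scale (c : R) f :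
  mu.-integrable setT (EFin \o (fun x => c * f x)) ->
  \int[mu]_x (c * f x) = c * \int[mu]_x f x.
Proof.
have [->|c0] := eqVneq c 0.
  move=> _; rewrite mul0r /Rintegral.
  by under eq_integral do rewrite mul0r; rewrite integral0.
move=> icf; rewrite RintegralZl//.
have := integrableZl measurableT (c^-1) icf.
by apply: eq_integrable => // x _ /=; rewrite -EFinM mulKf.
Qed.

Lemma abs_Rintegral_le f : measurable_fun setT f ->
  (`|\int[mu]_x f x|%:E <= \int[mu]_x `|f x|%:E)%E.
Proof.
move=> mf; apply: (@le_trans _ _ `|\int[mu]_x (f x)%:E|%E).
  by rewrite /Rintegral; case: (\int[mu]_x (f x)%:E)%E => //=; rewrite normr0 leey.
exact/le_abse_integral/measurable_EFinP.
Qed.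

Lemma integrableP_EFin f : mu.-integrable setT (EFin \o f) <->
  measurable_fun setT f /\ (\int[mu]_x `|f x|%:E < +oo)%E.
Proof.
by split=> [/integrableP[/measurable_EFinP mf]|[mf fi]];
  [|apply/integrableP; split => //; exact/measurable_EFinP].
Qed.

Lemma EFin_fine_abs_integral f :
  (\int[mu]_x `|f x|%:E < +oo)%E ->
  (fine (\int[mu]_x `|f x|%:E))%:E = (\int[mu]_x `|f x|%:E)%E.
Proof. by move=> fi; rewrite fineK// ge0_fin_numE// integral_ge0. Qed.

End RIntegralFacts.

(** Where the integrand is not integrable the value is a default, so linearity and associativity
    below are stated almost everywhere. *)
Definition rconv {R : realType} (k u : R -> R) : R -> R :=
  fun t => \int[@lebesgue_measure R]_s (k (t - s) * u s).

(** * Reasoning almost everywhere for Lebesgue measure *)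

Section AlmostEverywhere.
Context {R : realType}.
Local Notation mu := (@lebesgue_measure R).

Lemma aeS (P Q : R -> Prop) : (forall x, P x -> Q x) ->
  {ae mu, forall x, P x} -> {ae mu, forall x, Q x}.
Proof. by apply: filterS; exact: (ae_filter_ringOfSetsType mu). Qed.

Lemma aeS2 (P Q S : R -> Prop) : (forall x, P x -> Q x -> S x) ->
  {ae mu, forall x, P x} -> {ae mu, forall x, Q x} -> {ae mu, forall x, S x}.
Proof. by apply: filterS2; exact: (ae_filter_ringOfSetsType mu). Qed.

Lemma aeT (P : R -> Prop) : (forall x, P x) -> {ae mu, forall x, P x}.
Proof. by move=> h; apply: (@filterS _ _ (ae_filter_ringOfSetsType mu) setT) => //; exact: filterT. Qed.

End AlmostEverywhere.

(** * Convolution of integrable functions on the line *)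

Section Convolution.
Context {R : realType}.
Local Notation mu := (@lebesgue_measure R).
Local Notation L1 f := (mu.-integrable setT (EFin \o f)).
Implicit Types (k l u v : R -> R).

Let econv k u t := (\int[mu]_s (`|k (t - s) * u s|)%:E)%E.

Lemma measurable_reflect k (t : R) :
  measurable_fun setT k -> measurable_fun setT (fun s : R => k (t - s)).
Proof. by move=> mk; apply: (measurableT_comp mk); exact: measurable_funB. Qed.

Lemma measurable_conv_integrand k u :
  measurable_fun setT k -> measurable_fun setT u ->
  measurable_fun setT (fun z : R * R => k (z.1 - z.2) * u z.2).
Proof.
move=> mk mu'; apply: measurable_funM.
  by apply: (measurableT_comp mk); exact: measurable_funB.
exact: measurableT_comp.
Qed.

Let measurable_slice k u (t : R) : measurable_fun setT k -> measurable_fun setT u ->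
  measurable_fun setT (fun s : R => k (t - s) * u s).
Proof. by move=> mk mu'; apply: measurable_funM => //; exact: measurable_reflect. Qed.

Let measurable_econv k u : measurable_fun setT k -> measurable_fun setT u ->
  measurable_fun setT (econv k u).
Proof.
move=> mk mu'.
apply: (@measurable_fun_fubini_tonelli_F _ _ _ _ _ mu (fun z : R * R => (`|k (z.1 - z.2) * u z.2|)%:E)) => //.
by apply/measurable_EFinP; apply: measurableT_comp => //; exact: measurable_conv_integrand.
Qed.

Lemma measurable_rconv k u : measurable_fun setT k -> measurable_fun setT u ->
  measurable_fun setT (rconv k u).
Proof.
move=> mk mu'; apply: (measurableT_comp (fine_measurable measurableT)).
have mF : measurable_fun setT (fun z : R * R => (k (z.1 - z.2) * u z.2)%:E).
  by apply/measurable_EFinP; exact: measurable_conv_integrand.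
under eq_fun do rewrite integralE.
apply: emeasurable_funB.
- have := @measurable_fun_fubini_tonelli_F _ _ _ _ _ mu _ (measurable_funepos mF) (funepos_ge0 _).
  rewrite [X in measurable_fun _ X -> _](_ : _ = fun x => (\int[mu]_y
    (fun y => (k (x - y) * u y)%:E)^\+ y)%E)//.
  by apply/funext => t; apply: eq_integral => s _; rewrite !funeposE.
- have := @measurable_fun_fubini_tonelli_F _ _ _ _ _ mu _ (measurable_funeneg mF) (funeneg_ge0 _).
  rewrite [X in measurable_fun _ X -> _](_ : _ = fun x => (\int[mu]_y
    (fun y => (k (x - y) * u y)%:E)^\- y)%E)//.
  by apply/funext => t; apply: eq_integral => s _; rewrite !funenegE.
Qed.

Lemma integral_econv k u : measurable_fun setT k -> measurable_fun setT u ->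
  (\int[mu]_t \int[mu]_s (`|k (t - s) * u s|)%:E
   = (\int[mu]_t `|k t|%:E) * \int[mu]_t `|u t|%:E)%E.
Proof.
move=> mk mu'.
have mak : measurable_fun setT (fun t => `|k t|%:E).
  by apply/measurable_EFinP; exact: measurableT_comp.
have mau : measurable_fun setT (fun t => `|u t|%:E).
  by apply/measurable_EFinP; exact: measurableT_comp.
rewrite (@fubini_tonelli _ _ _ _ _ mu mu (fun z : R * R => (`|k (z.1 - z.2) * u z.2|)%:E))//=; last first.
  by apply/measurable_EFinP; apply: measurableT_comp => //; exact: measurable_conv_integrand.
rewrite -ge0_integralZl//; last exact: integral_ge0.
apply: eq_integral => s _.
under eq_integral do rewrite normrM EFinM muleC.
rewrite ge0_integralZl//; last first.
  apply/measurable_EFinP; apply: measurableT_comp => //.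
  by apply: (measurableT_comp mk); exact: measurable_funB.
by rewrite muleC (ge0_integral_shift (- s) mak).
Qed.

Let econv_lty k u : L1 k -> L1 u -> {ae mu, forall t, (econv k u t < +oo)%E}.
Proof.
move=> /integrableP_EFin[mk ik] /integrableP_EFin[mu' iu].
have : mu.-integrable setT (econv k u).
  apply/integrableP; split; first exact: measurable_econv.
  under eq_integral do rewrite gee0_abs ?integral_ge0//.
  by rewrite integral_econv// lte_mul_pinfty// ?integral_ge0// ge0_fin_numE ?integral_ge0.
move/integrable_ae => /(_ measurableT); apply: aeS => t /(_ I).
by rewrite ge0_fin_numE// integral_ge0.
Qed.

Lemma ae_integrable_conv k u : L1 k -> L1 u ->
  {ae mu, forall t, L1 (fun s => k (t - s) * u s)}.
Proof.
move=> k1 u1; apply: aeS _ (econv_lty k1 u1) => t kut.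
move: k1 u1 => /integrableP_EFin[mk _] /integrableP_EFin[mu' _].
by apply/integrableP_EFin; split => //; exact: measurable_slice.
Qed.

Lemma integrable_rconv k u : L1 k -> L1 u -> L1 (rconv k u).
Proof.
move=> /integrableP_EFin[mk ik] /integrableP_EFin[mu' iu].
apply/integrableP_EFin; split; first exact: measurable_rconv.
apply: (@le_lt_trans _ _ (\int[mu]_t econv k u t)%E).
  apply: ge0_le_integral => //.
  - by apply/measurable_EFinP; apply: measurableT_comp => //; exact: measurable_rconv.
  - exact: measurable_econv.
  - by move=> t _; apply: abs_Rintegral_le; exact: measurable_slice.
by rewrite integral_econv// lte_mul_pinfty// ?integral_ge0// ge0_fin_numE ?integral_ge0.
Qed.

(** Equality at every point: each value is an integral, which does not see a change of [u] on a null
    set. *)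
Lemma eq_ae_rconv k u v : measurable_fun setT k ->
  measurable_fun setT u -> measurable_fun setT v ->
  {ae mu, forall t, u t = v t} -> rconv k u = rconv k v.
Proof.
move=> mk mu' mv uv; apply/funext => t; congr fine; apply: ae_eq_integral => //.
- by apply/measurable_EFinP; exact: measurable_slice.
- by apply/measurable_EFinP; exact: measurable_slice.
- by apply: aeS _ uv => s uv _; rewrite uv.
Qed.

Lemma rconvBr k u v : L1 k -> L1 u -> L1 v ->
  {ae mu, forall t, rconv k u t - rconv k v t = rconv k (u \- v) t}.
Proof.
move=> k1 u1 v1; apply: aeS2 _ (ae_integrable_conv k1 u1) (ae_integrable_conv k1 v1).
move=> t ku kv; rewrite /rconv -RintegralB//.
by apply: eq_Rintegral => s _; rewrite mulrBr.
Qed.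

Lemma rconvBl k l u : L1 k -> L1 l -> L1 u ->
  {ae mu, forall t, rconv k u t - rconv l u t = rconv (k \- l) u t}.
Proof.
move=> k1 l1 u1; apply: aeS2 _ (ae_integrable_conv k1 u1) (ae_integrable_conv l1 u1).
move=> t ku kv; rewrite /rconv -RintegralB//.
by apply: eq_Rintegral => s _; rewrite mulrBl.
Qed.

Lemma rconvA k l u : L1 k -> L1 l -> L1 u ->
  {ae mu, forall t, rconv k (rconv l u) t = rconv (rconv k l) u t}.
Proof.
move=> k1 l1 u1.
have [mk _] := (integrableP_EFin _).1 k1.
have [ml _] := (integrableP_EFin _).1 l1.
have [mu' _] := (integrableP_EFin _).1 u1.
(* A finite representative of the convolution of [|l|] and [|u|]. Fubini applies to the triple
   integrand at those [t] where [w] is integrable against [k (t - s)]. *)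
pose w s := fine (econv l u s).
have wE : {ae mu, forall s, (w s)%:E = econv l u s}.
  apply: aeS _ (econv_lty l1 u1) => s ls.
  by rewrite /w fineK// ge0_fin_numE// integral_ge0.
have mw : measurable_fun setT w.
  by apply: (measurableT_comp (fine_measurable measurableT)); exact: measurable_econv.
have w0 s : 0 <= w s by rewrite fine_ge0// integral_ge0.
have w1 : L1 w.
  apply/integrableP_EFin; split => //.
  have -> : (\int[mu]_s `|w s|%:E = \int[mu]_s econv l u s)%E.
    apply: ae_eq_integral => //.
    - by apply/measurable_EFinP; exact: measurableT_comp.
    - exact: measurable_econv.
    - by apply: aeS _ wE => s <- _; rewrite ger0_norm.
  move: (l1) (u1) => /integrableP_EFin[_ il] /integrableP_EFin[_ iu].
  by rewrite integral_econv// lte_mul_pinfty// ?integral_ge0// ge0_fin_numE ?integral_ge0.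
apply: aeS _ (ae_integrable_conv k1 w1) => t /integrableP_EFin[_ kw].
pose Phi (z : R * R) := (k (t - z.1) * (l (z.1 - z.2) * u z.2))%:E.
have mPhi : measurable_fun setT Phi.
  apply/measurable_EFinP; apply: measurable_funM; last exact: measurable_conv_integrand.
  by apply: (measurableT_comp mk); exact: measurable_funB.
have iPhi : (mu \x mu)%E.-integrable setT Phi.
  apply/integrable12ltyP => //; apply: le_lt_trans kw.
  rewrite le_eqVlt; apply/orP; left; apply/eqP.
  transitivity (\int[mu]_s (`|k (t - s)|%:E * econv l u s))%E.
    apply: eq_integral => s _ /=; under eq_integral do rewrite normrM EFinM.
    rewrite ge0_integralZl//.
    by apply/measurable_EFinP; apply: measurableT_comp => //; exact: measurable_slice.
  apply: ae_eq_integral => //.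
  - apply: emeasurable_funM; last exact: measurable_econv.
    by apply/measurable_EFinP; apply: measurableT_comp => //; exact: measurable_reflect.
  - by apply/measurable_EFinP; apply: measurableT_comp => //; exact: measurable_slice.
  - by apply: aeS _ wE => s <- _; rewrite -EFinM normrM (ger0_norm (w0 s)).
(* The factor that is constant in the inner variable can be pulled out for almost every [s] only,
   which is enough under the outer integral. *)
have lhs : (\int[mu]_s (k (t - s) * rconv l u s)%:E = \int[mu]_s \int[mu]_x Phi (s, x))%E.
  apply: ae_eq_integral => //.
  - by apply/measurable_EFinP; apply: measurable_slice => //; exact: measurable_rconv.
  - exact: (measurable_fubini_F iPhi).
  - apply: aeS _ (ae_integrable1 iPhi) => s Ps0 _ /=.
    have Ps : L1 (fun x => k (t - s) * (l (s - x) * u x)) := Ps0.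
    rewrite -(Rint_scale Ps) /Rintegral fineK//.
    exact: (integrable_fin_num measurableT Ps).
have rhs : (\int[mu]_x (rconv k l (t - x) * u x)%:E = \int[mu]_x \int[mu]_s Phi (s, x))%E.
  apply: ae_eq_integral => //.
  - by apply/measurable_EFinP; apply: measurable_slice => //; exact: measurable_rconv.
  - exact: (measurable_fubini_G iPhi).
  - apply: aeS _ (ae_integrable2 iPhi) => x ix0 _ /=.
    have ix : L1 (fun s => u x * (k (t - s) * l (s - x))).
      rewrite (_ : EFin \o _ = fun s => Phi (s, x)) //.
      by apply/funext => s; rewrite /Phi /= mulrC -mulrA.
    transitivity (\int[mu]_s (u x * (k (t - s) * l (s - x)))%:E)%E; last first.
      by apply: eq_integral => s _; rewrite /Phi/= mulrC -mulrA.
    rewrite -[RHS]fineK; last exact: (integrable_fin_num measurableT ix).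
    rewrite -/(Rintegral _ _ _) (Rint_scale ix) mulrC; congr (_ * _)%:E; congr fine.
    have mf : measurable_fun setT (fun s : R => (k (t - x - s) * l s)%:E).
      by apply/measurable_EFinP; exact: measurable_slice.
    rewrite -(integral_shift (- x) mf); apply: eq_integral => s _.
    by rewrite opprB addrA subrK.
rewrite /rconv -[LHS]/(fine _) -[RHS]/(fine _); congr fine.
by rewrite lhs rhs; exact: Fubini.
Qed.

End Convolution.

(** * Young's inequality and powers of convolution operators *)

Section LpConvolution.
Context {R : realType}.
Local Notation mu := (@lebesgue_measure R).
Local Notation L1 f := (mu.-integrable setT (EFin \o f)).
Local Notation N p f := (Lnorm mu p (EFin \o f)).
Implicit Types (f g k l u v : R -> R) (p : \bar R).

Lemma le_poweR (x y : \bar R) (r : R) :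
  0 <= r -> (0 <= x)%E -> (x <= y)%E -> (x `^ r <= y `^ r)%E.
Proof.
move=> r0 x0 xy; apply: gt0_ler_poweR => //; rewrite in_itv/= ?x0 leey//.
by rewrite (le_trans x0 xy).
Qed.

Lemma LnormE (p : R) f :
  (N p%:E f = (\int[mu]_x (`|f x| `^ p)%:E) `^ p^-1)%E.
Proof. by rewrite unlock. Qed.

Lemma LnormyE f : N +oo%E f = ess_sup mu (abse \o (EFin \o f)).
Proof.
rewrite unlock /Lnorm ifT//.
apply: (@lt_le_trans _ _ (mu `[0, 1]%classic)); last by apply: le_measure; rewrite ?inE.
by rewrite lebesgue_measure_itv/= lte_fin ltr01 oppr0 adde0 lte_fin.
Qed.

Lemma ae_le_Lnorm p f g : (1 <= p)%E ->
  measurable_fun setT f -> measurable_fun setT g ->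
  {ae mu, forall t, `|f t| <= `|g t|} -> (N p f <= N p g)%E.
Proof.
case: p => [p||]// p1 mf mg fg; rewrite unlock /Lnorm.
- have p0 : 0 < p by rewrite (lt_le_trans ltr01).
  apply: le_poweR; rewrite ?invr_ge0 ?(ltW p0)//.
    by apply: integral_ge0 => x _; exact: poweR_ge0.
  have mpow (h : R -> R) : measurable_fun setT h ->
      measurable_fun setT (fun x => (`|(EFin \o h) x| `^ p)%E).
    move=> mh; apply/measurable_EFinP.
    by apply: (measurableT_comp (measurable_powR _)); exact: measurableT_comp.
  apply: ae_ge0_le_integral => //; try exact: mpow;
    try by move=> x _; exact: poweR_ge0.
  apply: aeS _ fg => x fgx _ /=.
  by rewrite lee_fin ge0_ler_powR ?nnegrE// ltW.
- case: ifPn => // _; apply: le_ess_sup.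
  by apply: aeS _ fg => x fgx /=; rewrite lee_fin.
Qed.

Lemma eq_ae_Lnorm p f g : (1 <= p)%E ->
  measurable_fun setT f -> measurable_fun setT g ->
  {ae mu, forall t, f t = g t} -> N p f = N p g.
Proof.
move=> p1 mf mg fg; apply/eqP; rewrite eq_le.
by apply/andP; split; apply: ae_le_Lnorm => //; apply: aeS _ fg => x ->.
Qed.

(** Jensen's inequality for the measure [|k (t - s)| ds], obtained from Hoelder's by writing
    [|k| |u| = |k|^(1/q) (|k|^(1/p) |u|)]. *)
Lemma conv_jensen (p : R) k u (t : R) : 1 <= p -> L1 k -> measurable_fun setT u ->
  ((\int[mu]_s (`|k (t - s) * u s|)%:E) `^ p <=
   ((\int[mu]_s `|k s|) `^ (p - 1))%:E *
   \int[mu]_s (`|k (t - s) * (`|u s| `^ p)|)%:E)%E.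
Proof.
move=> + /integrableP_EFin[mk ik] mu'.
have mak : measurable_fun setT (fun s : R => `|k s|%:E).
  by apply/measurable_EFinP; exact: measurableT_comp.
rewrite le_eqVlt => /predU1P[<-|p1].
  rewrite subrr powRr0 mul1e poweRe1 ?integral_ge0// le_eqVlt; apply/orP; left.
  by apply/eqP/eq_integral => s _; rewrite powRr1// !normrM normr_id.
have p0 : 0 < p by rewrite (lt_trans ltr01).
pose q := p / (p - 1).
have q0 : 0 < q by rewrite divr_gt0// subr_gt0.
have pq : q^-1 + p^-1 = 1.
  by rewrite /q; field; rewrite gt_eqF//= subr_eq0 gt_eqF.
pose f s := `|k (t - s)| `^ q^-1.
pose g s := `|k (t - s)| `^ p^-1 * `|u s|.
have mkt : measurable_fun setT (fun s : R => `|k (t - s)|).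
  by apply: measurableT_comp => //; exact: measurable_reflect.
have mf : measurable_fun setT f by exact: (measurableT_comp (measurable_powR _)).
have mg : measurable_fun setT g.
  apply: measurable_funM; first exact: (measurableT_comp (measurable_powR _)).
  exact: measurableT_comp.
have := @hoelder _ _ _ mu f g q p mf mg q0 p0 pq.
have -> : N 1 (f \* g) = (\int[mu]_s (`|k (t - s) * u s|)%:E)%E.
  rewrite Lnorm1; apply: eq_integral => s _ /=; congr (_%:E).
  rewrite mulrA -powRD ?pq ?oner_eq0// powRr1// -normrM normr_id //.
move=> /(le_poweR (ltW p0)) => /(_ (integral_ge0 _ _)).
move=> /(_ (fun _ _ => normr_ge0 _)) /le_trans; apply.
rewrite poweRM ?Lnorm_ge0//.
have -> : (N p%:E g `^ p = \int[mu]_x (`|(EFin \o g) x| `^ p))%E.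
  by rewrite poweR_Lnorm// lt0r_neq0.
have -> : (N q%:E f `^ p = ((\int[mu]_s `|k s|) `^ (p - 1))%:E)%E.
  have -> : p = q * (p - 1).
    by rewrite /q; field; rewrite subr_eq0 gt_eqF.
  rewrite poweRrM poweR_Lnorm ?lt0r_neq0//.
  have -> : (\int[mu]_x `|(EFin \o f) x| `^ q = \int[mu]_x `|k x|%:E)%E.
    rewrite -(ge0_integral_reflect t mak)//.
    apply: eq_integral => s _ /=; rewrite (ger0_norm (powR_ge0 _ _)).
    by rewrite -powRrM mulVf ?lt0r_neq0// powRr1.
  rewrite -(EFin_fine_abs_integral ik) poweR_EFin.
  by congr (_ `^ _)%:E; rewrite /q; field; rewrite subr_eq0 gt_eqF.
rewrite le_eqVlt; apply/orP; left; apply/eqP; congr (_ * _)%E.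
apply: eq_integral => s _ /=; congr (_%:E).
rewrite (ger0_norm (mulr_ge0 (powR_ge0 _ _) _))// powRM ?powR_ge0//.
by rewrite -powRrM mulVf ?lt0r_neq0// powRr1// normrM (ger0_norm (powR_ge0 `|u s| p)).
Qed.

(** For finite [p], [conv_jensen] at each [t] and Tonelli in [t]: the powers [p - 1] and 1 of the
    mass of [k] combine to [p]. For [p = +oo] the essential supremum of [u] is pulled out of the
    integral. *)
Lemma young p k u : (1 <= p)%E -> L1 k -> measurable_fun setT u ->
  (N p (rconv k u) <= (\int[mu]_t `|k t|%:E) * N p u)%E.
Proof.
move=> p1 k1 mu'; have [mk ik] := (integrableP_EFin _).1 k1.
have mak : measurable_fun setT (fun s : R => `|k s|%:E).
  by apply/measurable_EFinP; exact: measurableT_comp.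
have mku (t : R) : measurable_fun setT (fun s : R => (`|k (t - s) * u s|)%:E).
  apply/measurable_EFinP; apply: measurableT_comp => //.
  by apply: measurable_funM => //; exact: measurable_reflect.
have cle (t : R) : (`|rconv k u t|%:E <= \int[mu]_s (`|k (t - s) * u s|)%:E)%E.
  by apply: abs_Rintegral_le; apply: measurable_funM => //; exact: measurable_reflect.
case: p p1 => [p||]// p1; last first.
  have := Lnorm_ge0 mu +oo (EFin \o u); rewrite !LnormyE => M0; apply/ess_supP/aeT => t /=; apply: le_trans (cle t) _.
  rewrite -(ge0_integral_reflect t mak)// muleC -ge0_integralZl//; last first.
    by apply/measurable_EFinP; apply: measurableT_comp => //; exact: measurable_reflect.
  apply: ae_ge0_le_integral => //.
  - exact: mku.
  - by move=> s _; rewrite mule_ge0.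
  - apply: measurable_funeM.
    by apply/measurable_EFinP; apply: measurableT_comp => //; exact: measurable_reflect.
  - apply: aeS _ (ess_sup_ge mu (abse \o (EFin \o u))) => s us _.
    by rewrite normrM EFinM muleC lee_wpmul2r.
have p0 : 0 < p by rewrite (lt_le_trans ltr01).
set K := \int[mu]_t `|k t|.
have KE : (\int[mu]_t `|k t|%:E = K%:E)%E by rewrite -(EFin_fine_abs_integral ik).
have K0 : 0 <= K by rewrite /K fine_ge0// integral_ge0.
have mup : measurable_fun setT (fun s : R => `|u s| `^ p).
  by apply: (measurableT_comp (measurable_powR _)); exact: measurableT_comp.
rewrite KE !LnormE.
apply: (@le_trans _ _ (((K `^ p)%:E * \int[mu]_t (`|u t| `^ p)%:E) `^ p^-1)%E).
  apply: le_poweR; rewrite ?invr_ge0 ?(ltW p0)//.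
    by apply: integral_ge0 => x _; rewrite lee_fin powR_ge0.
  have -> : K `^ p = K `^ (p - 1) * K.
    by rewrite -{3}(powRr1 K0) -powRD ?subrK// gt_eqF.
  apply: (@le_trans _ _ (\int[mu]_t ((K `^ (p - 1))%:E *
     \int[mu]_s (`|k (t - s) * (`|u s| `^ p)|)%:E))%E).
    apply: ge0_le_integral => //.
    - apply/measurable_EFinP; apply: (measurableT_comp (measurable_powR _)).
      by apply: measurableT_comp => //; exact: measurable_rconv.
    - apply: measurable_funeM.
      apply: (@measurable_fun_fubini_tonelli_F _ _ _ _ _ mu
        (fun z : R * R => (`|k (z.1 - z.2) * (`|u z.2| `^ p)|)%:E)) => //.
      apply/measurable_EFinP; apply: measurableT_comp => //.
      exact: (@measurable_conv_integrand _ k (fun s => `|u s| `^ p)).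
    - move=> t _; apply: le_trans (conv_jensen t p1 k1 mu').
      by rewrite -poweR_EFin; apply: le_poweR; [exact: ltW|rewrite lee_fin|exact: cle].
  rewrite ge0_integralZl ?lee_fin ?powR_ge0//; last 2 first.
  - apply: (@measurable_fun_fubini_tonelli_F _ _ _ _ _ mu
      (fun z : R * R => (`|k (z.1 - z.2) * (`|u z.2| `^ p)|)%:E)) => //.
    apply/measurable_EFinP; apply: measurableT_comp => //.
    exact: (@measurable_conv_integrand _ k (fun s => `|u s| `^ p)).
  - by move=> t _; exact: integral_ge0.
  rewrite integral_econv// KE EFinM -muleA.
  rewrite le_eqVlt; apply/orP; left; apply/eqP; do 2 congr (_ * _)%E.
  by apply: eq_integral => s _ /=; rewrite (ger0_norm (powR_ge0 _ _)).
rewrite poweRM ?lee_fin ?powR_ge0//; last first.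
  by apply: integral_ge0 => x _; rewrite lee_fin powR_ge0.
by rewrite poweR_EFin -powRrM mulfV ?lt0r_neq0// powRr1//.
Qed.

Lemma integrable_iter_rconv n k u : L1 k -> L1 u -> L1 (iter n (rconv k) u).
Proof. by move=> k1 u1; elim: n => //= n ih; exact: integrable_rconv. Qed.

Lemma L1_measurable k : L1 k -> measurable_fun setT k.
Proof. by move=> /integrableP_EFin[]. Qed.

(** By associativity a power of the operator is convolution with a power of the kernel, and in this
    form kernels can be compared pointwise. Order [n + 1] needs [n] iterations because the iteration
    starts from [k] itself. *)
Lemma iter_rconv n k u : L1 k -> L1 u ->
  {ae mu, forall t, iter n.+1 (rconv k) u t = rconv (iter n (rconv k) k) u t}.
Proof.
move=> k1 u1; elim: n => [|n ih]; first exact: aeT.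
have kn := integrable_iter_rconv n k1 k1.
rewrite iterS (eq_ae_rconv (L1_measurable k1) _ _ ih).
- exact: rconvA.
- by apply: L1_measurable; exact: integrable_iter_rconv.
- by apply: L1_measurable; exact: integrable_rconv.
Qed.

Lemma iter_rconv_le p n k u (A M : R) : (1 <= p)%E -> L1 k -> L1 u ->
  0 <= A -> (\int[mu]_t `|k t|%:E <= A%:E)%E -> (N p u <= M%:E)%E ->
  (N p (iter n (rconv k) u) <= (A ^+ n * M)%:E)%E.
Proof.
move=> p1 k1 u1 A0 kA uM; elim: n => [|n ih]; first by rewrite expr0 mul1r.
rewrite iterS; apply: (le_trans (young p1 k1 _)).
  by apply: L1_measurable; exact: integrable_iter_rconv.
rewrite exprS -mulrA EFinM.
by apply: lee_pmul; [exact: integral_ge0|exact: Lnorm_ge0|exact: kA|exact: ih].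
Qed.

(* Telescoping [K^n - L^n]; the constant is what commuting scalars of sizes
   [A + B] and [A] would give. *)
Lemma iter_rconv_diff p n k l u (A B M : R) : (1 <= p)%E ->
  L1 k -> L1 l -> L1 u -> 0 <= A -> 0 <= B ->
  (\int[mu]_t `|l t|%:E <= A%:E)%E -> (\int[mu]_t `|k t - l t|%:E <= B%:E)%E ->
  (N p u <= M%:E)%E ->
  (N p (iter n (rconv k) u \- iter n (rconv l) u)%R
     <= (((A + B) ^+ n - A ^+ n) * M)%:E)%E.
Proof.
move=> p1 k1 l1 u1 A0 B0 lA klB uM.
have kl1 : L1 (k \- l).
  by have := integrableB measurableT k1 l1; apply: eq_integrable.
have kAB : (\int[mu]_t `|k t|%:E <= (A + B)%:E)%E.
  apply: (@le_trans _ _ (\int[mu]_t (`|l t|%:E + `|k t - l t|%:E))%E).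
    apply: ge0_le_integral => //.
    - by apply/measurable_EFinP; apply: measurableT_comp => //; exact: L1_measurable.
    - apply/measurable_EFinP; apply: measurable_funD; apply: measurableT_comp => //;
      [exact: L1_measurable|exact: (L1_measurable kl1)].
    - move=> t _; rewrite -EFinD lee_fin.
      by rewrite -[X in `|X| <= _](subrK (l t)) addrC; exact: ler_normD.
  rewrite ge0_integralD//; first by rewrite EFinD leeD.
  - by apply/measurable_EFinP; apply: measurableT_comp => //; exact: L1_measurable.
  - by apply/measurable_EFinP; apply: measurableT_comp => //; exact: (L1_measurable kl1).
elim: n => [|n ih].
  rewrite !expr0 subrr mul0r (_ : _ \- _ = cst 0); last first.
    by apply/funext => t /=; rewrite subrr.
  by rewrite Lnorm0// gt_eqF// (lt_le_trans _ p1)// lte_fin.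
set X := iter n (rconv k) u; set Y := iter n (rconv l) u.
have X1 : L1 X by exact: integrable_iter_rconv.
have Y1 : L1 Y by exact: integrable_iter_rconv.
have XY1 : L1 (X \- Y).
  by have := integrableB measurableT X1 Y1; apply: eq_integrable.
have mXY := L1_measurable XY1.
have -> : N p (iter n.+1 (rconv k) u \- iter n.+1 (rconv l) u)%R =
    N p (rconv k (X \- Y) \+ rconv (k \- l) Y)%R.
  apply: eq_ae_Lnorm => //.
  - by apply: measurable_funB; apply: L1_measurable; exact: integrable_iter_rconv.
  - by apply: measurable_funD; apply: L1_measurable; exact: integrable_rconv.
  - apply: aeS2 _ (rconvBr k1 X1 Y1) (rconvBl k1 l1 Y1) => t /= <- <-.
    by rewrite addrA subrK.
apply: (le_trans (@eminkowski _ _ _ mu _ _ _ _ _ p1)).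
- by apply: L1_measurable; exact: integrable_rconv.
- by apply: L1_measurable; exact: integrable_rconv.
have -> : ((A + B) ^+ n.+1 - A ^+ n.+1) * M =
  (A + B) * (((A + B) ^+ n - A ^+ n) * M) + B * (A ^+ n * M) by rewrite !exprS; ring.
rewrite EFinD; apply: leeD.
- apply: (le_trans (young p1 k1 mXY)).
  rewrite EFinM.
  by apply: lee_pmul; [exact: integral_ge0|exact: Lnorm_ge0|exact: kAB|exact: ih].
- apply: (le_trans (young p1 kl1 (L1_measurable Y1))).
  rewrite EFinM; apply: lee_pmul; [exact: integral_ge0|exact: Lnorm_ge0|exact: klB|].
  exact: iter_rconv_le.
Qed.

End LpConvolution.

(** The unnormalised Gamma density of rate [l]; for [l = 0], the truncated power. The test [0 < t]
    confines the support, as [powR] does not vanish at negative reals. *)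
Definition gk {R : realType} (a l : R) : R -> R :=
  fun t => if 0 < t then t `^ (a - 1) * expR (- (l * t)) else 0.

(** * Gamma kernels, the Beta integral and Stirling's upper bound *)

Section GammaKernel.
Context {R : realType}.
Local Notation mu := (@lebesgue_measure R).
Local Notation L1 f := (mu.-integrable setT (EFin \o f)).
Implicit Types (a b l t x y : R).

Lemma gk_ge0 a l t : 0 <= gk a l t.
Proof. by rewrite /gk; case: ifP => // _; rewrite mulr_ge0 ?powR_ge0 ?expR_ge0. Qed.

Lemma gk_le0 a l t : t <= 0 -> gk a l t = 0.
Proof. by rewrite /gk ltNge => ->. Qed.

Lemma gk_gt0 a l t : 0 < t -> gk a l t = t `^ (a - 1) * expR (- (l * t)).
Proof. by rewrite /gk => ->. Qed.

Lemma measurable_gk a l : measurable_fun setT (gk a l).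
Proof.
apply: measurable_fun_ifT => //; first exact: measurable_fun_ltr.
  apply: measurable_funM; first exact: measurable_powR.
  by apply: (measurableT_comp (@measurable_expR R)); apply: measurable_funN; exact: measurable_funM.
Qed.

Let EFin_gk_meas a l : measurable_fun setT (fun t => (gk a l t)%:E).
Proof. by apply/measurable_EFinP; exact: measurable_gk. Qed.

Let slice_meas a b l t :
  measurable_fun setT (fun s : R => (gk a l (t - s) * gk b l s)%:E).
Proof.
apply/measurable_EFinP; apply: measurable_funM; last exact: measurable_gk.
by apply: measurable_reflect; exact: measurable_gk.
Qed.

Lemma integral_gk1 l : 0 < l -> (\int[mu]_t (gk 1 l t)%:E = (l^-1)%:E)%E.
Proof.
move=> l0.
have := integral_exponential_pdf l0.
have -> : (\int[mu]_x (exponential_pdf l x)%:E = \int[mu]_x (l%:E * (gk 1 l x)%:E))%E.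
  apply: ae_eq_integral => //.
  - by apply/measurable_EFinP; exact: measurable_exponential_pdf.
  - by apply: measurable_funeM; exact: EFin_gk_meas.
  - exists [set 0]; split => //; first exact: lebesgue_measure_set1.
    move=> t /= /not_implyP[_]; apply: contra_notP => /eqP t0.
    rewrite -EFinM; congr (_%:E); have [tp|] := ltP 0 t.
      by rewrite exponential_pdfE ?ltW// gk_gt0// subrr powRr0 mul1r mulNr.
    rewrite le_eqVlt (negbTE t0)/= => tn.
    by rewrite lt0_exponential_pdf// gk_le0 ?mulr0// ltW.
rewrite ge0_integralZl//; last 3 first.
- exact: EFin_gk_meas.
- by move=> t _; rewrite lee_fin gk_ge0.
- by rewrite lee_fin ltW.
move=> /(congr1 (fun x : \bar R => (l^-1)%:E * x)%E).
by rewrite muleA -EFinM mulVf ?gt_eqF// mul1e mule1.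
Qed.

(** The integrand may be unbounded at 0, so the fundamental theorem is applied on [[1/(n+1), 1]] and
    the intervals are exhausted monotonically. *)
Lemma integral_powR01 a : 0 < a ->
  (\int[mu]_(t in `]0%R, 1%R]) (t `^ (a - 1))%:E = (a^-1)%:E)%E.
Proof.
move=> a0.
pose F (n : nat) : set R := `[n.+1%:R^-1, 1%R]%classic.
have FU : \bigcup_n F n = `]0%R, 1%R]%classic.
  apply/seteqP; split => [t [n _]|t]; rewrite /F /= !in_itv /= => /andP[t0 t1].
    by rewrite t1 andbT (lt_le_trans _ t0)// invr_gt0.
  have [n _ nt] := @near_infty_natSinv_lt R (PosNum t0).
  by exists n => //=; rewrite in_itv/= t1 andbT ltW//; apply: nt => /=.
have Fint n : (\int[mu]_(t in F n) (t `^ (a - 1))%:E =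
    (a^-1 - a^-1 * (n.+1%:R^-1) `^ a)%:E)%E.
  have n0 : 0 < n.+1%:R^-1 :> R by rewrite invr_gt0.
  have [n1|n1] := eqVneq n 0%N.
    rewrite /F n1 invr1 set_itv1 integral_set1 powR1 mulr1 subrr//.
  have nlt1 : n.+1%:R^-1 < 1 :> R by rewrite invf_lt1// ltr1n ltnS lt0n.
  have D (x : R) : 0 < x -> is_derive x 1 (fun t => a^-1 * t `^ a) (x `^ (a - 1)).
    move=> x0; have xI : x \in `]0, +oo[%R by rewrite in_itv/= andbT.
    apply: DeriveDef; first exact/derivableM/derivable_powR.
    rewrite deriveMl; last exact: derivable_powR.
    have := @powR_derive1 _ a x xI; rewrite derive1E => ->.
    by rewrite mulrA mulVf ?mul1r// gt_eqF.
  have Dc (x : R) : 0 < x -> {for x, continuous (fun t => a^-1 * t `^ a)}.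
    move=> x0; apply: differentiable_continuous; apply/derivable1_diffP.
    by have [] := D x x0.
  rewrite (@continuous_FTC2 _ _ (fun t => a^-1 * t `^ a))//.
  - by rewrite powR1 mulr1 -EFinB.
  - apply: derivable_within_continuous => x; rewrite in_itv/= => /andP[x0 _].
    by apply: derivable_powR; rewrite in_itv/= andbT (lt_le_trans _ x0).
  - split.
    + move=> x; rewrite in_itv/= => /andP[x0 _].
      by have [] := D x (lt_trans n0 x0).
    + by apply: cvg_at_right_filter; exact: Dc.
    + by apply: cvg_at_left_filter; exact: Dc.
  - move=> x; rewrite in_itv/= => /andP[x0 _].
    by rewrite derive1E; have [_ ->] := D x (lt_trans n0 x0).
have F1 : (\int[mu]_(t in F n) (t `^ (a - 1))%:E)%E @[n --> \oo] --> (a^-1)%:E.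
  under eq_fun do rewrite Fint; apply: cvg_EFin; first exact: nearW.
  rewrite -[X in _ --> X]subr0 -[X in _ --> _ - X](mulr0 a^-1).
  apply: cvgB; first exact: cvg_cst.
  apply: cvgMr.
  have /cvg_at_rightP /(_ harmonic) := powR_cvg0 a0; apply; split => //.
  - by move=> n; exact: harmonic_gt0.
  - exact: cvg_harmonic.
rewrite -FU; apply: cvg_unique F1; first exact: ereal_hausdorff.
apply: ge0_nondecreasing_set_cvg_integral.
- move=> n m nm; apply/subsetPset => t; rewrite /F/= !in_itv/= => /andP[nt ->].
  by rewrite andbT (le_trans _ nt)// lef_pV2 ?posrE// ler_nat.
- by move=> n; exact: measurable_itv.
- by move=> n; apply/measurable_EFinP; apply: measurable_funTS; exact: measurable_powR.
- by move=> n x _; rewrite lee_fin powR_ge0.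
Qed.

Lemma powR_expR x y : expR x `^ y = expR (y * x).
Proof. by rewrite /powR gt_eqF ?expR_gt0// expRK. Qed.

(** [t^b e^(-t)] is largest at [t = b]: the inequality [x <= e^(x - 1)] for [x = t / b] is raised to
    the power [b]. *)
Lemma powR_le_expR b t : 0 < b -> 0 <= t -> t `^ b <= b `^ b * expR (t - b).
Proof.
move=> b0 t0; have tb : t / b <= expR (t / b - 1).
  by have := expR_ge1Dx (t / b - 1); rewrite addrC subrK.
have -> : t `^ b = b `^ b * (t / b) `^ b.
  by rewrite -powRM ?divr_ge0 ?(ltW b0)// mulrC divfK// gt_eqF.
rewrite ler_wpM2l ?powR_ge0//.
apply: (le_trans (ge0_ler_powR (ltW b0) _ _ tb)); rewrite ?nnegrE ?divr_ge0 ?expR_ge0 ?(ltW b0)//.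
rewrite powR_expR le_eqVlt; apply/orP; left; apply/eqP; congr expR.
by field; rewrite gt_eqF.
Qed.

Lemma integral_gk_lty a : 0 < a -> (\int[mu]_t (gk a 1 t)%:E < +oo)%E.
Proof.
(* Any positive exponent at least [a - 1] would do: beyond 1, [t^(a - 1) <= t^b], and [powR_le_expR]
   at [t / 2] bounds this by [C e^(t/2)], which leaves [e^(- t/2)] in the integrand. *)
move=> a0; pose b : R := `|a - 1| + 1.
have b0 : 0 < b by rewrite ltr_wpDl.
pose C := (2 * b) `^ b.
have key t : ((gk a 1 t)%:E <=
   ((fun t => (t `^ (a - 1))%:E) \_ `]0%R, 1%R]) t + (C * gk 1 2^-1 t)%:E)%E.
  have [tn|tp] := leP t 0.
    by rewrite !gk_le0// mulr0 patchE; case: ifPn => _; rewrite ?add0e -?EFinD lee_fin ?addr0 ?powR_ge0.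
  rewrite patchE; case: ifPn => [_|].
    rewrite -EFinD lee_fin ler_wpDr ?mulr_ge0 ?powR_ge0 ?gk_ge0//.
    rewrite gk_gt0// mul1r ler_piMr ?powR_ge0//.
    by rewrite -expR0 ler_expR oppr_le0 ltW.
  rewrite notin_setE/= in_itv/= tp/= => /negP; rewrite -ltNge => t1.
  rewrite add0e lee_fin !gk_gt0// subrr powRr0 !mul1r mulrC.
  have tab : t `^ (a - 1) <= C * expR (t / 2).
    have ab : a - 1 <= b by rewrite /b (le_trans (ler_norm _))// lerDl.
    apply: (le_trans (ler_powR (ltW t1) ab)).
    have := powR_le_expR b0 (divr_ge0 (ltW tp) (ler0n R 2)).
    have -> : t `^ b = 2 `^ b * (t / 2) `^ b.
      by rewrite -powRM ?divr_ge0 ?(ltW tp)// mulrC divfK.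
    move=> /(ler_wpM2l (powR_ge0 2 b)) /le_trans; apply.
    rewrite mulrA -powRM ?(ltW b0)// ler_wpM2l ?powR_ge0// ler_expR.
    by rewrite gerBl ltW.
  apply: (@le_trans _ _ (expR (- t) * (C * expR (t / 2)))).
    by rewrite ler_wpM2l ?expR_ge0.
  rewrite mulrCA -expRD; apply: ler_wpM2l; first exact: powR_ge0.
  by rewrite ler_expR; lra.
have mC : measurable_fun setT (fun t => (C * gk 1 2^-1 t)%:E).
  by apply/measurable_EFinP; apply: measurable_funM => //; exact: measurable_gk.
have mP : measurable_fun setT ((fun t : R => (t `^ (a - 1))%:E) \_ `]0%R, 1%R]).
  apply/(measurable_restrictT _ _).1; first exact: measurable_itv.
  by apply/measurable_EFinP; apply: measurable_funTS; exact: measurable_powR.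
have P0 t : (0 <= ((fun t : R => (t `^ (a - 1))%:E) \_ `]0%R, 1%R]) t)%E.
  by rewrite patchE; case: ifPn => // _; rewrite lee_fin powR_ge0.
apply: (@le_lt_trans _ _ (\int[mu]_t (((fun t => (t `^ (a - 1))%:E) \_ `]0%R, 1%R]) t +
   (C * gk 1 2^-1 t)%:E))%E).
  apply: ge0_le_integral => //.
  - by move=> t _; rewrite lee_fin gk_ge0.
  - exact: EFin_gk_meas.
  - exact: emeasurable_funD.
rewrite ge0_integralD//; last by move=> t _; rewrite lee_fin mulr_ge0 ?powR_ge0 ?gk_ge0.
rewrite -integral_mkcond integral_powR01//.
under eq_integral do rewrite EFinM.
rewrite ge0_integralZl ?lee_fin ?powR_ge0//;
  [|exact: EFin_gk_meas|by move=> t _; rewrite lee_fin gk_ge0].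
by rewrite integral_gk1 ?invr_gt0// -EFinM -EFinD ltry.
Qed.

Lemma GammaE a : Gamma a = \int[mu]_t gk a 1 t.
Proof.
rewrite /Gamma Rintegral_mkcond; apply: eq_Rintegral => t _.
rewrite patchE mem_setE in_itv/= andbT /gk; case: ifP => // _.
by rewrite mul1r.
Qed.

Lemma integral_gk1E a : 0 < a -> (\int[mu]_t (gk a 1 t)%:E = (Gamma a)%:E)%E.
Proof.
move=> a0; rewrite GammaE /Rintegral fineK// ge0_fin_numE ?integral_gk_lty//.
by apply: integral_ge0 => t _; rewrite lee_fin gk_ge0.
Qed.

Lemma Gamma_gt0 a : 0 < a -> 0 < Gamma a.
Proof.
move=> a0; rewrite -lte_fin -integral_gk1E//.
(* A lower bound for the integrand on [[1, 2]], where [0 <= ln t <= 1]. *)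
pose c := expR (- `|a - 1| - 2).
apply: (@lt_le_trans _ _ (\int[mu]_(t in `[1%R, 2%R]) c%:E)%E).
  rewrite integral_cst//= lebesgue_measure_itv/= lte_fin ltr1n /=.
  by rewrite -EFinB -EFinM lte_fin mulr_gt0 ?expR_gt0//; lra.
rewrite integral_mkcond; apply: ge0_le_integral => //.
- by move=> t _; rewrite patchE; case: ifPn => // _; rewrite lee_fin expR_ge0.
- by apply/(measurable_restrictT _ _).1.
- exact: EFin_gk_meas.
- move=> t _; rewrite patchE; case: ifPn => [|_]; last by rewrite lee_fin gk_ge0.
  rewrite mem_setE in_itv/= => /andP[t1 t2].
  have t0 : 0 < t by rewrite (lt_le_trans ltr01).
  rewrite lee_fin gk_gt0// /powR gt_eqF// -expRD ler_expR mul1r.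
  have l0 : 0 <= ln t by rewrite ln_ge0.
  have l1 : ln t <= 1.
    rewrite -[leRHS]expRK ler_ln ?posrE ?expR_gt0//.
    by have := expR_ge1Dx (1 : R); lra.
  have : - `|a - 1| <= (a - 1) * ln t.
    have := ler_norm (- (a - 1)); rewrite normrN => ?.
    have [a1|a1] := leP 0 (a - 1).
      by rewrite (le_trans _ (mulr_ge0 a1 l0))// oppr_le0.
    rewrite ltr0_norm// opprK -[leLHS]mulr1.
    by rewrite ler_nM2l.
  lra.
Qed.

Lemma integral_gk a l : 0 < a -> 0 < l ->
  (\int[mu]_t (gk a l t)%:E = (Gamma a / l `^ a)%:E)%E.
Proof.
move=> a0 l0; rewrite EFinM -integral_gk1E//.
rewrite (@ge0_integral_affine _ l 0 (fun t => (gk a 1 t)%:E))//; last first.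
  by move=> t; rewrite lee_fin gk_ge0.
have -> : (\int[mu]_x (gk a 1 (l * x + 0))%:E =
    \int[mu]_x ((l `^ (a - 1))%:E * (gk a l x)%:E))%E.
  apply: eq_integral => t _; rewrite -EFinM addr0; congr (_%:E).
  have [tn|tp] := leP t 0; first by rewrite !gk_le0 ?mulr0// pmulr_rle0.
  by rewrite !gk_gt0 ?mulr_gt0// powRM ?ltW// mul1r mulrA.
rewrite ge0_integralZl ?lee_fin ?powR_ge0//;
  [|exact: EFin_gk_meas|by move=> t _; rewrite lee_fin gk_ge0].
rewrite muleA -EFinM mulr_powRB1 ?ltW// muleAC -EFinM mulfV ?mul1e//.
by rewrite gt_eqF// powR_gt0.
Qed.

Lemma integrable_gk a l : 0 < a -> 0 < l -> L1 (gk a l).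
Proof.
move=> a0 l0; apply/integrableP_EFin; split; first exact: measurable_gk.
under eq_integral do rewrite ger0_norm ?gk_ge0//.
by rewrite integral_gk// ltry.
Qed.

(** Stirling's upper bound up to a factor of order [sqrt a]: raising [t / a <= e^(t/a - 1)] to the
    power [a - 1] bounds the integrand by a multiple of [e^(- t/a)], whose integral is [a]. *)
Lemma Gamma_le a : 1 <= a -> Gamma a <= a `^ a * expR (1 - a).
Proof.
move=> a1; have a0 : 0 < a by rewrite (lt_le_trans ltr01).
rewrite -lee_fin -integral_gk1E//.
have -> : a `^ a * expR (1 - a) = a `^ (a - 1) * expR (1 - a) * a.
  by rewrite mulrAC [X in X * _ = _](_ : _ = a `^ (a - 1) * a)// mulrC mulr_powRB1 ?ltW.
apply: (@le_trans _ _ (\int[mu]_t ((a `^ (a - 1) * expR (1 - a))%:E * (gk 1 a^-1 t)%:E))%E).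
  apply: ge0_le_integral => //.
  - by move=> t _; rewrite lee_fin gk_ge0.
  - exact: EFin_gk_meas.
  - by apply: measurable_funeM; exact: EFin_gk_meas.
  - move=> t _; rewrite -EFinM lee_fin.
    have [tn|tp] := leP t 0; first by rewrite !gk_le0 ?mulr0.
    rewrite !gk_gt0// subrr powRr0 !mul1r.
    have tb : t / a <= expR (t / a - 1).
      by have := expR_ge1Dx (t / a - 1); rewrite addrC subrK.
    have -> : t `^ (a - 1) = a `^ (a - 1) * (t / a) `^ (a - 1).
      by rewrite -powRM ?divr_ge0 ?ltW// mulrC divfK// gt_eqF.
    rewrite -!mulrA ler_wpM2l ?powR_ge0//.
    apply: (@le_trans _ _ (expR (t / a - 1) `^ (a - 1) * expR (- t))).
      rewrite ler_wpM2r ?expR_ge0// ge0_ler_powR ?nnegrE ?subr_ge0 ?divr_ge0 ?expR_ge0 ?(ltW tp) ?(ltW a0)//.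
    rewrite powR_expR -!expRD ler_expR le_eqVlt; apply/orP; left; apply/eqP.
    by field; rewrite gt_eqF.
rewrite ge0_integralZl ?lee_fin ?mulr_ge0 ?powR_ge0 ?expR_ge0//; last 2 first.
- exact: EFin_gk_meas.
- by move=> t _; rewrite lee_fin gk_ge0.
by rewrite integral_gk1 ?invr_gt0// invrK.
Qed.

(** Euler's Beta integral: the two truncated powers confine [s] to the unit interval. *)
Let J a b := (\int[mu]_s (gk a 0 (1 - s) * gk b 0 s)%:E)%E.

Let J_ge0 a b : (0 <= J a b)%E.
Proof. by apply: integral_ge0 => s _; rewrite lee_fin mulr_ge0 ?gk_ge0. Qed.

(** The exponentials combine to [e^(- l t)] independently of [s], and the substitution [s = t x]
    scales out the powers of [t]. *)
Let econv_gk a b l t : 0 < a -> 0 < b ->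
  (\int[mu]_s (gk a l (t - s) * gk b l s)%:E = (gk (a + b) l t)%:E * J a b)%E.
Proof.
move=> a0 b0; have [tn|tp] := leP t 0.
  rewrite (gk_le0 _ _ tn) mul0e integral0_eq// => s _.
  have [sn|sp] := leP s 0; first by rewrite (gk_le0 _ _ sn) mulr0.
  by rewrite gk_le0 ?mul0r//; lra.
rewrite (@ge0_integral_affine _ t 0)//; last first.
  by move=> s; rewrite lee_fin mulr_ge0 ?gk_ge0.
have -> : (\int[mu]_x (gk a l (t - (t * x + 0)) * gk b l (t * x + 0))%:E =
    \int[mu]_x ((t `^ (a + b - 2) * expR (- (l * t)))%:E * (gk a 0 (1 - x) * gk b 0 x)%:E))%E.
  apply: eq_integral => s _; rewrite -EFinM addr0; congr (_%:E).
  have -> : t - t * s = t * (1 - s) by ring.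
  have [sn|sp] := leP s 0; first by rewrite !(gk_le0 b) ?mulr0// pmulr_rle0.
  have [s1|s1] := leP (1 - s) 0; first by rewrite !(gk_le0 a) ?mul0r ?mulr0// pmulr_rle0.
  rewrite !gk_gt0 ?mulr_gt0// !powRM ?ltW// !mul0r oppr0 expR0 !mulr1.
  have -> : a + b - 2 = (a - 1) + (b - 1) by ring.
  rewrite (@powRD _ t (a - 1)); last by rewrite (gt_eqF tp) implybT.
  have -> : expR (- (l * t)) = expR (- (l * (t * (1 - s)))) * expR (- (l * (t * s))).
    by rewrite -expRD; congr expR; ring.
  by ring.
rewrite ge0_integralZl ?lee_fin ?mulr_ge0 ?powR_ge0 ?expR_ge0//;
  [|exact: slice_meas|by move=> s _; rewrite lee_fin mulr_ge0 ?gk_ge0].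
rewrite muleA -EFinM; congr (_%:E * _)%E; rewrite gk_gt0// mulrA; congr (_ * _).
rewrite -{1}(powRr1 (ltW tp)) -powRD; last by rewrite (gt_eqF tp) implybT.
by congr (_ `^ _); ring.
Qed.

(** The mass of the convolution of [gk a 1] and [gk b 1] is computed twice: as the product of the
    masses and, through [econv_gk], as [Gamma (a + b)] times the Beta integral. *)
Let J_Gamma a b : 0 < a -> 0 < b -> J a b = (Gamma a * Gamma b / Gamma (a + b))%:E.
Proof.
move=> a0 b0; have ab0 := addr_gt0 a0 b0.
have : ((Gamma a * Gamma b)%:E = (Gamma (a + b))%:E * J a b)%E.
  have E k : (\int[mu]_t `|gk k 1 t|%:E = \int[mu]_t (gk k 1 t)%:E)%E.
    by apply: eq_integral => t _; rewrite ger0_norm ?gk_ge0.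
  rewrite EFinM -!integral_gk1E// -(E a) -(E b).
  rewrite -integral_econv; [|exact: measurable_gk|exact: measurable_gk].
  rewrite -ge0_integralZr//;
    [|exact: EFin_gk_meas|by move=> t _; rewrite lee_fin gk_ge0].
  apply: eq_integral => t _; rewrite -econv_gk//.
  by apply: eq_integral => s _; rewrite ger0_norm// mulr_ge0 ?gk_ge0.
have G0 := Gamma_gt0 ab0.
(* An infinite Beta integral would make the finite product [Gamma a * Gamma b] infinite. *)
move: (J a b) => [x||].
- rewrite -EFinM => -[->]; congr (_%:E); rewrite mulrC mulKf// gt_eqF//.
- by rewrite gt0_muley// lte_fin.
- by rewrite gt0_muleNy// lte_fin.
Qed.

(** Valid at every [t], not only almost everywhere; this permits pointwise identities and
    comparisons for powers of these kernels. *)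
Lemma integrable_gk_conv a b l t : 0 < a -> 0 < b ->
  L1 (fun s => gk a l (t - s) * gk b l s).
Proof.
move=> a0 b0; apply/integrableP_EFin; split.
  by have /measurable_EFinP := slice_meas a b l t.
under eq_integral do rewrite ger0_norm ?mulr_ge0 ?gk_ge0//.
by rewrite econv_gk// J_Gamma// -EFinM ltry.
Qed.

Lemma rconv_gk a b l : 0 < a -> 0 < b ->
  rconv (gk a l) (gk b l) =
  fun t => Gamma a * Gamma b / Gamma (a + b) * gk (a + b) l t.
Proof.
move=> a0 b0; apply/funext => t.
by rewrite /rconv /Rintegral econv_gk// J_Gamma// -EFinM/= mulrC.
Qed.

Lemma Gamma1 : Gamma (1 : R) = 1.
Proof. by apply: EFin_inj; rewrite -integral_gk1E// integral_gk1// invr1. Qed.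

(** [B(1, a)] is [1/a] by direct integration and [Gamma a / Gamma (a + 1)] by [J_Gamma]. *)
Lemma GammaS a : 0 < a -> Gamma (a + 1) = a * Gamma a.
Proof.
move=> a0; have := J_Gamma ltr01 a0.
have -> : J 1 a = (a^-1)%:E.
  rewrite -integral_powR01// integral_mkcond; apply: ae_eq_integral => //.
  - exact: slice_meas.
  - apply/(measurable_restrictT _ _).1; first exact: measurable_itv.
    by apply/measurable_EFinP; apply: measurable_funTS; exact: measurable_powR.
  - exists [set 1]; split => //; first exact: lebesgue_measure_set1.
    move=> s /= /not_implyP[_]; apply: contra_notP => /eqP s1.
    rewrite patchE mem_setE in_itv/=; have [sp|sn] := ltP 0 s; last first.
      by rewrite (gk_le0 _ _ sn) mulr0.
    case: ifPn => /= [s1'|]; last first.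
      by rewrite -ltNge => s1'; rewrite gk_le0 ?mul0r//; lra.
    have s1'' : 0 < 1 - s by rewrite subr_gt0 lt_neqAle s1.
    by rewrite !gk_gt0// !mul0r oppr0 expR0 subrr powRr0 !mulr1 mul1r.
move=> -[]; rewrite Gamma1 mul1r addrC => h.
have G0 := Gamma_gt0 a0; have G1 := Gamma_gt0 (addr_gt0 a0 ltr01).
by rewrite -[Gamma a](divfK (lt0r_neq0 G1)) -h mulrA mulfV ?mul1r// gt_eqF.
Qed.

End GammaKernel.

(** * Explicit convolution powers and domination between powers of kernels *)

Section KernelIterates.
Context {R : realType}.
Local Notation mu := (@lebesgue_measure R).
Local Notation L1 f := (mu.-integrable setT (EFin \o f)).

Lemma measurable_iter_rconv n (k u : R -> R) : measurable_fun setT k ->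
  measurable_fun setT u -> measurable_fun setT (iter n (rconv k) u).
Proof. by move=> mk mu'; elim: n => //= n ih; exact: measurable_rconv. Qed.

Lemma iter_gk (c a l : R) n : 0 < a ->
  iter n (rconv (fun t => c * gk a l t)) (fun t => c * gk a l t) =
  fun t => (c * Gamma a) ^+ n.+1 / Gamma (a * n.+1%:R) * gk (a * n.+1%:R) l t.
Proof.
move=> a0; elim: n => [|n ih].
  by rewrite /= mulr1 expr1 mulfK// gt_eqF// Gamma_gt0.
have an0 : 0 < a * n.+1%:R by rewrite mulr_gt0.
rewrite iterS ih; apply/funext => t.
set C := (c * Gamma a) ^+ n.+1 / Gamma (a * n.+1%:R).
transitivity (c * C * rconv (gk a l) (gk (a * n.+1%:R) l) t).
  rewrite /rconv -RintegralZl//; last exact: integrable_gk_conv.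
  by apply: eq_Rintegral => s _; ring.
rewrite rconv_gk// (_ : a + a * n.+1%:R = a * n.+2%:R); last by rewrite -[n.+2%:R]natr1; ring.
rewrite [_ ^+ n.+2]exprS mulrA /C; congr (_ * _); set X := _ ^+ n.+1.
have G1 := Gamma_gt0 an0; have G2 := Gamma_gt0 (mulr_gt0 a0 (ltr0Sn R n.+1)).
clearbody X; move: (Gamma a) (Gamma (a * n.+1%:R)) (Gamma (a * n.+2%:R))
  (lt0r_neq0 G1) (lt0r_neq0 G2) => g g1 g2 h1 h2.
by field; rewrite h1 h2.
Qed.

(** The relation [|z| <= Z], [|x - z| <= X - Z] between a pair and a pair of majorants passes to
    products, by [x y - z w = (x - z) y + z (y - w)]. *)
Lemma diff_mul_le (x y z w X Y Z W : R) :
  `|z| <= Z -> `|w| <= W -> `|x - z| <= X - Z -> `|y - w| <= Y - W ->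
  `|x * y - z * w| <= X * Y - Z * W.
Proof.
move=> zZ wW xz yw.
have -> : x * y - z * w = (x - z) * y + z * (y - w) by ring.
have yY : `|y| <= Y.
  by rewrite -(subrK w y) (le_trans (ler_normD _ _))//; lra.
have -> : X * Y - Z * W = (X - Z) * Y + Z * (Y - W) by ring.
rewrite (le_trans (ler_normD _ _))// !normrM.
by apply: lerD; exact: ler_pM.
Qed.

(** By induction with [diff_mul_le] under the convolution integral, the pair [H], [K] stays
    majorised by the pair [A], [P]. Integrability at every point is inherited from the powers of
    [P], which dominate all the others. *)
Lemma iter_kernel_diff (K H P A : R -> R) n (t : R) :
  measurable_fun setT K -> measurable_fun setT H ->
  measurable_fun setT P -> measurable_fun setT A ->
  (forall x, `|H x| <= A x) -> (forall x, `|K x - H x| <= P x - A x) ->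
  (forall m x, L1 (fun s => P (x - s) * iter m (rconv P) P s)) ->
  `|iter n (rconv H) H t| <= iter n (rconv A) A t /\
  `|iter n (rconv K) K t - iter n (rconv H) H t|
     <= iter n (rconv P) P t - iter n (rconv A) A t.
Proof.
move=> mK mH mP mA HA KH iP; elim: n t => [|n ih] t; first by split => /=.
rewrite !iterS.
have mslice (k : R -> R) : measurable_fun setT k ->
    measurable_fun setT (fun s : R => k (t - s) * iter n (rconv k) k s).
  move=> mk; apply: measurable_funM; first exact: measurable_reflect.
  exact: measurable_iter_rconv.
have dom (k : R -> R) : measurable_fun setT k ->
    (forall s, `|k (t - s) * iter n (rconv k) k s| <= P (t - s) * iter n (rconv P) P s) ->
    L1 (fun s => k (t - s) * iter n (rconv k) k s).
  move=> mk kP; apply: le_integrable (iP n t) => //.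
    by apply/measurable_EFinP; exact: mslice.
  by move=> s _ /=; rewrite lee_fin (le_trans (kP s))// ler_norm.
have A0 s : 0 <= A s by rewrite (le_trans _ (HA s)).
have An0 s : 0 <= iter n (rconv A) A s by rewrite (le_trans _ (ih s).1).
have AP s : A s <= P s by rewrite -subr_ge0 (le_trans _ (KH s)).
have AnPn s : iter n (rconv A) A s <= iter n (rconv P) P s.
  by rewrite -subr_ge0 (le_trans _ (ih s).2).
have HHn s : `|H (t - s) * iter n (rconv H) H s| <= A (t - s) * iter n (rconv A) A s.
  by rewrite normrM ler_pM// (ih s).1.
have AAn s : A (t - s) * iter n (rconv A) A s <= P (t - s) * iter n (rconv P) P s.
  exact: ler_pM.
have iA : L1 (fun s => A (t - s) * iter n (rconv A) A s).
  by apply: dom => // s; rewrite ger0_norm ?mulr_ge0.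
have iH : L1 (fun s => H (t - s) * iter n (rconv H) H s).
  by apply: dom => // s; rewrite (le_trans (HHn s)).
have iK : L1 (fun s => K (t - s) * iter n (rconv K) K s).
  apply: dom => // s; rewrite normrM ler_pM//.
    rewrite -(subrK (H (t - s)) (K (t - s))) (le_trans (ler_normD _ _))//.
    by have := KH (t - s); have := HA (t - s); lra.
  rewrite -(subrK (iter n (rconv H) H s) (iter n (rconv K) K s)) (le_trans (ler_normD _ _))//.
  by have := ih s; case=> ? ?; lra.
split.
  apply: (le_trans (le_normr_Rintegral measurableT iH)).
  apply: le_Rintegral => //; first exact: integrable_norm.
rewrite /rconv -!RintegralB//.
have iKH : L1 (fun s => K (t - s) * iter n (rconv K) K s - H (t - s) * iter n (rconv H) H s).
  by have := integrableB measurableT iK iH; apply: eq_integrable.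
apply: (le_trans (le_normr_Rintegral measurableT iKH)).
apply: le_Rintegral => //.
- exact: integrable_norm.
- by have := integrableB measurableT (iP n t) iA; apply: eq_integrable.
- by move=> s _; have [? ?] := ih s; exact: diff_mul_le.
Qed.

End KernelIterates.

(** * Norms on (0,1), Hoelder's inequality and exponentials *)

Section LpUnitInterval.
Context {R : realType}.
Local Notation mu := (@lebesgue_measure R).
Local Notation N p f := (Lnorm mu p (EFin \o f)).
Implicit Types (f g u v : R -> R) (p : \bar R).

Import HBNNSimple.

Lemma I01P (t : R) : I01 t <-> 0 <= t <= 1.
Proof. by rewrite /I01 /= in_itv. Qed.

Lemma mu01_setC : @mu01 R (~` I01) = 0%E.
Proof. by change (mu (~` I01 `&` I01) = 0%E); rewrite setICl measure0. Qed.

Lemma mu01_gt0 : (0 < @mu01 R setT)%E.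
Proof.
change (0 < mu (setT `&` I01))%E; rewrite setTI /I01 lebesgue_measure_itv/= lte_fin ltr01.
by rewrite oppr0 adde0 lte_fin.
Qed.

(** Integrals are compared as suprema over simple functions, so that arbitrary functions are
    covered: cutting a simple function off outside [I01] leaves its [mu01]-integral unchanged. *)
Lemma ge0_le_integral_mu01 (F G : R -> \bar R) :
  (forall t, (0 <= F t)%E) -> (forall t, (0 <= G t)%E) ->
  (forall t, I01 t -> (F t <= G t)%E) ->
  (\int[@mu01 R]_t F t <= \int[@mu01 R]_t G t)%E.
Proof.
move=> F0 G0 FG; rewrite !ge0_integralTE//.
apply: ge_ereal_sup => _ [h hF <-].
apply: ereal_sup_ubound; exists (proj_nnsfun h (@mI01 R)) => /=.
  move=> t; rewrite mindicE; case: (boolP (t \in I01)) => tI.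
    by rewrite mulr1 (le_trans (hF t))// FG// -inE.
  by rewrite mulr0.
rewrite /sintegral; apply: eq_fsbigr => x _; congr (_ * _)%E.
rewrite /mu01 /mrestr; congr (_ _); apply/seteqP; split => t [] /= <- tI; split => //;
  by rewrite mindicE mem_set// mulr1.
Qed.

Lemma eq_LpN p f g : (1 <= p)%E -> (forall t, I01 t -> f t = g t) ->
  LpN p f = LpN p g.
Proof.
case: p => [p||]// _ fg; rewrite /LpN unlock /Lnorm.
- congr (_ `^ _)%E; apply/eqP; rewrite eq_le; apply/andP; split;
  apply: ge0_le_integral_mu01; try (by move=> t; exact: poweR_ge0);
  by move=> t tI /=; rewrite fg.
- case: ifPn => // _; apply: eq_ess_sup.
  exists (~` I01); split => [||t].
  + by apply: measurableC; exact: mI01.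
  + exact: mu01_setC.
  + by apply: contra_not => /= tI; rewrite fg.
Qed.

Lemma integral_mu01 (F : R -> \bar R) : measurable_fun setT F ->
  (forall t, (0 <= F t)%E) -> (forall t, ~ I01 t -> F t = 0%E) ->
  (\int[@mu01 R]_t F t = \int[mu]_t F t)%E.
Proof.
move=> mF F0 FI.
have FE : F = F \_ I01.
  apply/funext => t; rewrite patchE; case: ifPn => //; rewrite notin_setE; exact: FI.
transitivity (\int[@mu01 R]_(t in setT `\` ~` I01) F t)%E.
  apply: ge0_negligible_integral => //; last exact: mu01_setC.
  by apply: measurableC; exact: mI01.
rewrite setTD setCK FE -integral_mkcond -FE.
apply: eq_measure_integral => A mA AI.
by change (mu (A `&` I01) = mu A); rewrite setIidl.
Qed.

(** The passage from norms for the restricted measure [mu01] to norms on the line, where the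
    inequalities of Young, Hoelder and Minkowski are used. *)
Lemma LpNE p f : (1 <= p)%E -> measurable_fun setT (f \_ I01) ->
  LpN p f = N p (f \_ I01).
Proof.
move=> p1 mf; rewrite (@eq_LpN p f (f \_ I01))//; last first.
  by move=> t tI; rewrite patchE mem_set.
case: p p1 => [p||]// p1.
  have p0 : 0 < p by rewrite (lt_le_trans ltr01).
  rewrite /LpN unlock /Lnorm; congr (_ `^ _)%E; apply: integral_mu01.
  - apply/measurable_EFinP; apply: (measurableT_comp (measurable_powR _)).
    exact: measurableT_comp.
  - by move=> t; exact: poweR_ge0.
  - by move=> t tI /=; rewrite patchE memNset// normr0 powR0// gt_eqF.
rewrite LnormyE /LpN unlock /Lnorm ifT; last exact: mu01_gt0.
apply/eqP; rewrite eq_le; apply/andP; split; apply/ess_supP.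
- have [A [mA A0 HA]] := ess_sup_ge mu (abse \o (EFin \o f \_ I01)).
  exists A; split => //; change (mu (A `&` I01) = 0)%E.
  apply: (@subset_measure0 _ _ _ mu _ A) => //.
  by apply: measurableI => //; exact: mI01.
- have [A [mA A0 HA]] := ess_sup_ge (@mu01 R) (abse \o (EFin \o f \_ I01)).
  exists (A `&` I01); split => //; first by apply: measurableI => //; exact: mI01.
  move=> t /= ht; split; first exact: HA.
  apply: contrapT => tI; apply: ht; rewrite patchE memNset// normr0.
  apply: ess_sup_gee; first exact: mu01_gt0.
  by apply: nearW => x /=; rewrite lee_fin.
Qed.

Lemma LpN_ge0 p f : (0 <= LpN p f)%E.
Proof. exact: Lnorm_ge0. Qed.

Lemma measurable_restrict01 f : measurable_fun I01 f -> measurable_fun setT (f \_ I01).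
Proof. by move=> mf; apply/(measurable_restrictT _ _).1 => //; exact: mI01. Qed.

Lemma LpN_triangle p f g : (1 <= p)%E ->
  measurable_fun I01 f -> measurable_fun I01 g ->
  (LpN p (fun t => (f t + g t)%R) <= LpN p f + LpN p g)%E.
Proof.
move=> p1 mf mg; rewrite !LpNE//; try exact: measurable_restrict01; last first.
  by apply: measurable_restrict01; exact: measurable_funD.
apply: le_trans (@eminkowski _ _ _ mu _ _ _ _ _ p1); try exact: measurable_restrict01.
rewrite (_ : (fun t => f t + g t) \_ I01 = (f \_ I01 \+ g \_ I01)%R)//.
by apply/funext => t /=; rewrite !patchE; case: ifPn; rewrite ?addr0.
Qed.

Lemma ae_le_LpN p f g : (1 <= p)%E ->
  measurable_fun I01 f -> measurable_fun I01 g ->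
  {ae mu, forall t, I01 t -> `|f t| <= `|g t|} -> (LpN p f <= LpN p g)%E.
Proof.
move=> p1 mf mg fg; rewrite !LpNE//; try exact: measurable_restrict01.
apply: ae_le_Lnorm => //; try exact: measurable_restrict01.
apply: aeS _ fg => t fg; rewrite !patchE; case: ifPn => //.
by rewrite inE => /fg.
Qed.

Lemma LpNZ p c f : (1 <= p)%E -> measurable_fun I01 f ->
  (LpN p (fun t => (c * f t)%R) = `|c|%:E * LpN p f)%E.
Proof.
case: p => [p||]// p1 mf.
- have p0 : 0 < p by rewrite (lt_le_trans ltr01).
  rewrite !LpNE ?lee_fin//; try exact: measurable_restrict01; last first.
    by apply: measurable_restrict01; exact: measurable_funM.
  have mfI := measurable_restrict01 mf.
  have mpow : measurable_fun setT (fun x => (`|(f \_ I01) x| `^ p)%:E).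
    apply/measurable_EFinP; apply: (measurableT_comp (measurable_powR _)).
    exact: measurableT_comp.
  have -> : `|c|%:E = ((`|c| `^ p)%:E `^ p^-1)%E.
    by rewrite poweR_EFin -powRrM mulfV ?lt0r_neq0// powRr1.
  rewrite !LnormE -poweRM ?lee_fin ?powR_ge0//; last first.
    by apply: integral_ge0 => t _; rewrite lee_fin powR_ge0.
  rewrite -ge0_integralZl ?lee_fin ?powR_ge0//.
  congr (_ `^ _)%E; apply: eq_integral => t _; rewrite -EFinM -powRM//; congr (_ `^ _)%:E.
  by rewrite !patchE; case: ifPn => _; rewrite ?normrM// normr0 mulr0.
- rewrite /LpN unlock /Lnorm.
  rewrite mu01_gt0 -ess_supZl ?mu01_gt0//; congr (ess_sup _ _); apply/funext => t /=.
  by rewrite normrM EFinM.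
Qed.

(** The integral of [e^(- c t)] over (0,1). *)
Definition phi (c : R) : R := (1 - expR (- c)) / c.

Lemma phi_gt0 c : 0 < c -> 0 < phi c.
Proof. by move=> c0; rewrite divr_gt0// subr_gt0 expR_lt1 oppr_lt0. Qed.

Lemma measurable_expM (b : R) (D : set R) : measurable_fun D (fun t => expR (- (b * t))).
Proof.
apply: measurable_funTS; apply: (measurableT_comp (@measurable_expR R)).
by apply: measurable_funN; exact: measurable_funM.
Qed.

Lemma measurable_expB (b : R) (D : set R) :
  measurable_fun D (fun t => expR (- (b * (1 - t)))).
Proof.
apply: measurable_funTS; apply: (measurableT_comp (@measurable_expR R)).
by apply: measurable_funN; apply: measurable_funM => //; exact: measurable_funB.
Qed.

Lemma integral_exp01 (c : R) : 0 < c ->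
  (\int[mu]_(t in I01) (expR (- (c * t)))%:E = (phi c)%:E)%E.
Proof.
move=> c0; have := @exponential_prob_itv0c R c 1 ltr01.
rewrite /exponential_prob mulr1 -EFinB => h.
have : (\int[mu]_(t in I01) (c%:E * (expR (- (c * t)))%:E) = (1 - expR (- c))%:E)%E.
  rewrite -h; apply: eq_integral => t; rewrite inE => /I01P/andP[t0 _].
  by rewrite -EFinM exponential_pdfE// mulNr.
rewrite ge0_integralZl//; last 3 first.
- exact: mI01.
- by apply/measurable_EFinP; exact: measurable_expM.
- by rewrite lee_fin ltW.
move=> /(congr1 (fun x : \bar R => (c^-1)%:E * x)%E).
by rewrite muleA -EFinM mulVf ?gt_eqF// mul1e -EFinM mulrC.
Qed.

Lemma integral_expB01 (c : R) : 0 < c ->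
  (\int[mu]_(t in I01) (expR (- (c * (1 - t))))%:E = (phi c)%:E)%E.
Proof.
move=> c0; rewrite -integral_exp01// integral_mkcond [RHS]integral_mkcond.
rewrite -[RHS](@ge0_integral_reflect _ 1); last 2 first.
- apply/(measurable_restrictT _ _).1; first exact: mI01.
  by apply/measurable_EFinP; exact: measurable_expM.
- by move=> t; rewrite patchE; case: ifPn => // _; rewrite lee_fin expR_ge0.
apply: eq_integral => t _; rewrite !patchE.
suff -> : (1 - t \in I01) = (t \in I01) by [].
by apply/idP/idP; rewrite !inE => /I01P/andP[? ?]; apply/I01P/andP; split; lra.
Qed.

Lemma LpN_integral (x : R) (f : R -> R) (v : \bar R) : 1 <= x ->
  measurable_fun I01 f -> (\int[mu]_(t in I01) (`|f t| `^ x)%:E = v)%E ->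
  LpN x%:E f = (v `^ x^-1)%E.
Proof.
move=> x1 mf <-; rewrite LpNE//; last exact: measurable_restrict01.
rewrite LnormE; congr (_ `^ _)%E; rewrite [RHS]integral_mkcond.
apply: eq_integral => t _; rewrite !patchE; case: ifPn => // _.
by rewrite normr0 powR0// gt_eqF// (lt_le_trans ltr01).
Qed.

(** The norm of [e^(- b s)] in the dual exponent: [q = p / (p - 1)] in general, the supremum for
    [p = 1], the integral for [p = +oo]. *)
Definition Qn p (b : R) : R := match p with
  | x%:E => if x == 1 then 1 else let q := x / (x - 1) in phi (b * q) `^ q^-1
  | _ => phi b end.

(** The [L^p] norm of [e^(- b (1 - t))], as [LpN_expB] shows. *)
Definition Pn p (b : R) : R := match p with
  | x%:E => phi (b * x) `^ x^-1 | _ => 1 end.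

Lemma LpN_expM (x b : R) : 1 <= x -> 0 < b ->
  LpN x%:E (fun t => expR (- (b * t))) = (phi (b * x) `^ x^-1)%:E.
Proof.
move=> x1 b0; have bx : 0 < b * x by rewrite mulr_gt0// (lt_le_trans ltr01).
rewrite (LpN_integral x1 (@measurable_expM _ _) (v := (phi (b * x))%:E))//.
rewrite -integral_exp01//; apply: eq_integral => t _.
by rewrite ger0_norm ?expR_ge0// powR_expR; congr (expR _)%:E; ring.
Qed.

Lemma LpN_expB p (b : R) : (1 <= p)%E -> 0 < b ->
  LpN p (fun t => expR (- (b * (1 - t)))) = (Pn p b)%:E.
Proof.
case: p => [x||]// x1 b0.
  have bx : 0 < b * x by rewrite mulr_gt0// (lt_le_trans ltr01).
  rewrite (LpN_integral x1 (@measurable_expB _ _) (v := (phi (b * x))%:E))//.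
  rewrite -integral_expB01//; apply: eq_integral => t _.
  by rewrite ger0_norm ?expR_ge0// powR_expR; congr (expR _)%:E; ring.
rewrite LpNE//; last by apply: measurable_restrict01; exact: measurable_expB.
rewrite LnormyE; apply/eqP; rewrite eq_le; apply/andP; split.
  apply/ess_supP/aeT => t /=; rewrite patchE; case: ifPn => [|_].
    rewrite inE => /I01P/andP[_ t1].
    rewrite ger0_norm ?expR_ge0// -[leRHS]/(1%:E) lee_fin -[leRHS]expR0 ler_expR oppr_le0.
    by rewrite mulr_ge0 ?(ltW b0)// subr_ge0.
  by rewrite -[leRHS]/(1%:E) lee_fin -[X in `|X|]/(0 : R) normr0.
rewrite leNgt; apply/negP => lt1.
set M := ess_sup _ _ in lt1.
have M0 : (0 <= M)%E.
  have := Lnorm_ge0 mu +oo (EFin \o (fun t => expR (- (b * (1 - t)))) \_ I01).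
  by rewrite LnormyE.
have [m Mm] : exists m, M = m%:E.
  by case: M M0 lt1 => // m; exists m.
have [A [mA A0 HA]] := ess_sup_ge mu (abse \o (EFin \o (fun t => expR (- (b * (1 - t)))) \_ I01)).
rewrite -/M Mm /= in HA; rewrite Mm lte_fin in lt1; rewrite Mm lee_fin in M0.
have {}lt1 : m < 1 := lt1.
(* With [b s = (1 - m) / 2], the bound [e^(-x) >= 1 - x] keeps the exponential above the supposed
   essential supremum [m] close to 1, on a set of positive measure. *)
pose s := (1 - m) / 2 / b.
pose c := Num.max 0 (1 - s).
have s0 : 0 < s by rewrite !divr_gt0// subr_gt0.
have c1 : c < 1 by rewrite /c gt_max ltr01/=; lra.
have cA : `]c, 1] `<=` A.
  move=> t /= /[!in_itv] /= /andP[ct t1]; apply: HA => /=.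
  have t0 : 0 <= t by rewrite (le_trans _ (ltW ct))// /c le_max lexx.
  have ts : 1 - s < t by rewrite (le_lt_trans _ ct)// /c le_max lexx orbT.
  rewrite patchE mem_set; last by apply/I01P; rewrite t0.
  rewrite ger0_norm ?expR_ge0// lee_fin; apply/negP; rewrite -ltNge.
  have : 1 + - (b * (1 - t)) <= expR (- (b * (1 - t))) by exact: expR_ge1Dx.
  apply: lt_le_trans.
  have : b * (1 - t) < b * s by rewrite ltr_pM2l//; lra.
  have -> : b * s = (1 - m) / 2 by rewrite /s mulrC divfK ?gt_eqF.
  lra.
have : (mu `]c, 1%R]%classic <= mu A)%E by apply: le_measure; rewrite ?inE.
rewrite A0 lebesgue_measure_itv/= lte_fin c1 -EFinB lee_fin; lra.
Qed.

Lemma LpN_ae_bound u : measurable_fun I01 u ->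
  {ae mu, forall t, I01 t -> (`|u t|%:E <= LpN +oo u)%E}.
Proof.
move=> mu'; rewrite LpNE ?leey//; last exact: measurable_restrict01.
rewrite LnormyE; apply: aeS _ (ess_sup_ge mu (abse \o (EFin \o (u \_ I01)))) => t /=.
by move=> + tI; rewrite patchE mem_set.
Qed.

Lemma hoelder_exp p (b : R) u : (1 <= p)%E -> 0 < b -> measurable_fun I01 u ->
  (\int[mu]_(s in I01) (`|expR (- (b * s)) * u s|)%:E <= (Qn p b)%:E * LpN p u)%E.
Proof.
move=> p1 b0 mu'.
have meu : measurable_fun I01 (fun s => (`|expR (- (b * s)) * u s|)%:E).
  apply/measurable_EFinP; apply: measurableT_comp => //.
  by apply: measurable_funM => //; exact: measurable_expM.
have mau : measurable_fun I01 (fun s => `|u s|%:E).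
  by apply/measurable_EFinP; exact: measurableT_comp.
case: p p1 => [x||]// p1.
- rewrite /Qn; case: eqVneq => [->|x1].
    rewrite mul1e (@LpN_integral 1 u (\int[mu]_(s in I01) `|u s|%:E)%E)//; last first.
      by apply: eq_integral => s _; rewrite powRr1.
    rewrite invr1 poweRe1 ?integral_ge0//; apply: ge0_le_integral => //; first exact: mI01.
    move=> s /I01P/andP[s0 _]; rewrite lee_fin normrM ger0_norm ?expR_ge0//.
    by rewrite ler_piMl// -expR0 ler_expR oppr_le0 mulr_ge0 ?(ltW b0).
  have {}x1 : 1 < x by rewrite lt_neqAle eq_sym x1.
  have x0 : 0 < x by rewrite (lt_trans ltr01).
  set q := x / (x - 1).
  have q1 : 1 <= q by rewrite /q ler_pdivlMr ?subr_gt0//; lra.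
  have q0 : 0 < q by rewrite (lt_le_trans ltr01).
  have qx : q^-1 + x^-1 = 1.
    by rewrite /q; field; rewrite gt_eqF//= subr_eq0 gt_eqF.
  have mE := measurable_restrict01 (@measurable_expM b I01).
  have mU := measurable_restrict01 mu'.
  have := hoelder mu mE mU q0 x0 qx; rewrite Lnorm1 -!LpNE//.
  rewrite LpN_expM//; apply: le_trans; rewrite le_eqVlt; apply/orP; left.
  apply/eqP; rewrite [LHS]integral_mkcond; apply: eq_integral => s _ /=; rewrite !patchE; case: ifPn => // _.
  by rewrite mulr0 normr0.
- rewrite -integral_exp01// muleC -ge0_integralZl//; last 3 first.
  + exact: mI01.
  + by apply/measurable_EFinP; exact: measurable_expM.
  + exact: LpN_ge0.
  apply: ae_ge0_le_integral => //.
  + exact: mI01.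
  + by move=> s _; rewrite mule_ge0 ?LpN_ge0// lee_fin expR_ge0.
  + by apply: measurable_funeM; apply/measurable_EFinP; exact: measurable_expM.
  + apply: aeS _ (LpN_ae_bound mu') => s us sI.
    rewrite normrM (ger0_norm (expR_ge0 _)) EFinM muleC.
    by rewrite lee_wpmul2r ?lee_fin ?expR_ge0// us.
Qed.

Lemma Pn_ge0 p b : 0 <= Pn p b.
Proof. by case: p => [x||]//; exact: powR_ge0. Qed.

Lemma Qn_ge0 p b : 0 < b -> 0 <= Qn p b.
Proof.
by move=> b0; case: p => [x||]/=; [case: ifP => // _; exact: powR_ge0|exact/ltW/phi_gt0..].
Qed.

(* The bounding kernel [exp (- b (1 - t)) * exp (- b s)] has rank one, so Hoelder's
   inequality in [s] alone suffices. *)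
Lemma rank_one_bound p (b M : R) v u : (1 <= p)%E -> 0 < b -> 0 <= M ->
  measurable_fun I01 v -> measurable_fun I01 u -> (LpN p u < +oo)%E ->
  {ae mu, forall t, I01 t -> (`|v t|%:E <= M%:E *
    \int[mu]_(s in I01) (`|expR (- (b * (1 - t + s))) * u s|)%:E)%E} ->
  (LpN p v <= (M * (Pn p b * Qn p b))%:E * LpN p u)%E.
Proof.
move=> p1 b0 M0 mv mu' uoo vM.
have [n uE] : exists n, LpN p u = n%:E.
  by have := LpN_ge0 p u; case: (LpN p u) uoo => // n; exists n.
have n0 : 0 <= n by rewrite -lee_fin -uE LpN_ge0.
pose c := M * (Qn p b * n).
have c0 : 0 <= c by rewrite !mulr_ge0 ?Qn_ge0.
apply: (@le_trans _ _ (LpN p (fun t => c * expR (- (b * (1 - t)))))).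
  apply: ae_le_LpN => //; first by apply: measurable_funM => //; exact: measurable_expB.
  apply: aeS _ vM => t vt tI; rewrite normrM (ger0_norm c0) (ger0_norm (expR_ge0 _)).
  rewrite -lee_fin; apply: (le_trans (vt tI)); rewrite /c -mulrA EFinM lee_wpmul2l ?lee_fin//.
  have -> : (\int[mu]_(s in I01) (`|expR (- (b * (1 - t + s))) * u s|)%:E =
    (expR (- (b * (1 - t))))%:E * \int[mu]_(s in I01) (`|expR (- (b * s)) * u s|)%:E)%E.
    rewrite -ge0_integralZl ?lee_fin ?expR_ge0//; last 2 first.
    - exact: mI01.
    - apply/measurable_EFinP; apply: measurableT_comp => //.
      by apply: measurable_funM => //; exact: measurable_expM.
    apply: eq_integral => s _; rewrite -EFinM; congr (_%:E).
    have -> : expR (- (b * (1 - t + s))) = expR (- (b * (1 - t))) * expR (- (b * s)).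
      by rewrite -expRD; congr expR; ring.
    by rewrite -mulrA normrM (ger0_norm (expR_ge0 _)).
  rewrite [X in (_ <= X%:E)%E]mulrC EFinM lee_wpmul2l ?lee_fin ?expR_ge0//.
  by apply: (le_trans (hoelder_exp p1 b0 mu')); rewrite uE EFinM.
rewrite LpNZ//; last exact: measurable_expB.
rewrite LpN_expB// (ger0_norm c0) uE -!EFinM lee_fin /c le_eqVlt; apply/orP; left.
by apply/eqP; ring.
Qed.

Lemma Cp_gt0 p : (1 <= p)%E -> 0 < Cp p.
Proof.
case: p => [x||]// x1; rewrite /Cp; case: eqVneq => // xn1.
have {}x1 : 1 < x by rewrite lt_neqAle eq_sym xn1.
by rewrite invr_gt0 mulr_gt0// powR_gt0 ?divr_gt0 ?subr_gt0// (lt_trans ltr01).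
Qed.

(** For [1 < p < +oo] the product is [Cp (1 - e^(- b p))^(1/p) (1 - e^(- b q))^(1/q)]: the powers
    [b^(-1/p)] and [b^(-1/q)] cancel the factor [b], and [p^(-1/p) q^(-1/q)] is [Cp]. At both
    endpoints it is [1 - e^(- b)]. *)
Lemma PQ_bounds p (b : R) : (1 <= p)%E -> 0 < b ->
  (1 - expR (- b)) ^+ 2 * Cp p <= b * (Pn p b * Qn p b) <= Cp p.
Proof.
move=> p1 b0.
have e0 : 0 < 1 - expR (- b) by rewrite subr_gt0 expR_lt1 oppr_lt0.
have e1 : 1 - expR (- b) <= 1 by rewrite gerBl expR_ge0.
have bphi : b * phi b = 1 - expR (- b) by rewrite /phi mulrC divfK ?gt_eqF.
have E1 : (1 - expR (- b)) ^+ 2 <= 1 - expR (- b) by rewrite expr2 ler_piMl// ltW.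
case: p p1 => [x||]// p1; rewrite /Pn /Qn /Cp; last first.
  by rewrite mul1r bphi mulr1 E1.
case: eqVneq => [->|xn1].
  by rewrite !mulr1 invr1 powRr1 ?bphi ?E1// ltW// phi_gt0.
have x1 : 1 < x by rewrite lt_neqAle eq_sym xn1.
have x0 : 0 < x by rewrite (lt_trans ltr01).
set q := x / (x - 1).
have q1 : 1 <= q by rewrite /q ler_pdivlMr ?subr_gt0//; lra.
have q0 : 0 < q by rewrite (lt_le_trans ltr01).
have qx : x^-1 + q^-1 = 1.
  by rewrite addrC /q; field; rewrite gt_eqF//= subr_eq0 gt_eqF.
(* For [y >= 1], passing from [b] to [b y] and taking a root of a number in []0, 1]] both increase
   the value. *)
have key y : 1 <= y -> 1 - expR (- b) <= (1 - expR (- (b * y))) `^ y^-1 <= 1.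
  move=> y1; have y0 : 0 < y by rewrite (lt_le_trans ltr01).
  have by0 : expR (- (b * y)) <= expR (- b) by rewrite ler_expR lerN2 ler_peMr// ltW.
  have z1 : 1 - expR (- (b * y)) <= 1 by rewrite gerBl expR_ge0.
  have z0 : 0 < 1 - expR (- (b * y)) by lra.
  have yi : y^-1 <= 1 by rewrite invf_le1.
  apply/andP; split.
    apply: (le_trans _ (ger1_powR _ yi)); first by lra.
    by rewrite z0.
  apply: (@le_trans _ _ (1 `^ y^-1)); last by rewrite powR1.
  by rewrite ge0_ler_powR ?nnegrE ?invr_ge0 ?(ltW y0) ?(ltW z0).
have phiE y : 0 < y -> phi (b * y) `^ y^-1 =
    (1 - expR (- (b * y))) `^ y^-1 / (b `^ y^-1 * y `^ y^-1).
  move=> y0; have z0 : 0 < 1 - expR (- (b * y)).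
    by rewrite subr_gt0 expR_lt1 oppr_lt0 mulr_gt0.
  rewrite /phi powRM ?invr_ge0 ?mulr_ge0 ?(ltW z0) ?(ltW b0) ?(ltW y0)//; congr (_ * _).
  have by0 : 0 <= b * y by rewrite mulr_ge0 ?(ltW b0) ?(ltW y0).
  by rewrite -powRM ?(ltW b0) ?(ltW y0)// -(powR_inv1 by0) powRAC powR_inv1 ?powR_ge0.
rewrite !phiE// !div1r.
set X := (1 - expR (- (b * x))) `^ _; set Y := (1 - expR (- (b * q))) `^ _.
have -> : b * (X / (b `^ x^-1 * x `^ x^-1) * (Y / (b `^ q^-1 * q `^ q^-1))) =
    X * Y * (x `^ x^-1 * q `^ q^-1)^-1.
  have bE : b = b `^ x^-1 * b `^ q^-1.
    by rewrite -powRD ?qx ?powRr1 ?(ltW b0)// oner_eq0.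
  rewrite {1}bE; field; rewrite !gt_eqF ?powR_gt0//.
have C0 : 0 < (x `^ x^-1 * q `^ q^-1)^-1 by rewrite invr_gt0 mulr_gt0 ?powR_gt0.
have /andP[X0 X1] := key x (ltW x1); have /andP[Y0 Y1] := key q q1.
apply/andP; split.
  apply: ler_wpM2r; first exact: ltW.
  by rewrite expr2; apply: ler_pM; [exact: ltW|exact: ltW|exact: X0|exact: Y0].
rewrite -[leRHS]mul1r; apply: ler_wpM2r; first exact: ltW.
rewrite -[leRHS]mul1r; apply: ler_pM; [| |exact: X1|exact: Y1].
- by apply: (le_trans _ X0); exact: ltW.
- by apply: (le_trans _ Y0); exact: ltW.
Qed.

End LpUnitInterval.

(** * From the Volterra operator on (0,1) to convolution on the line *)

Section Bridge.
Context {R : realType}.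
Local Notation mu := (@lebesgue_measure R).
Local Notation L1 f := (mu.-integrable setT (EFin \o f)).
Implicit Types (k u K U f : R -> R).

(* The junk value [fine (+oo) = fine (-oo) = 0] makes this hold without integrability. *)
Lemma Rintegral_notint f : measurable_fun setT f -> ~ L1 f -> \int[mu]_x f x = 0.
Proof.
move=> mf; have mF : measurable_fun setT (EFin \o f) by exact/measurable_EFinP.
move=> nf; rewrite /Rintegral integralE.
have [fp|fp] := eqVneq (\int[mu]_x (EFin \o f)^\+ x)%E +oo%E.
  by rewrite fp; case: (\int[mu]_x _)%E.
have [fn|fn] := eqVneq (\int[mu]_x (EFin \o f)^\- x)%E +oo%E.
  by rewrite fn; case: (\int[mu]_x _)%E.
exfalso; apply: nf; apply/integrableP; split => //.
under eq_integral do rewrite -[`|_|%E]/((abse \o (EFin \o f)) _) fune_abse.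
rewrite ge0_integralD//; last 2 first.
- exact: measurable_funepos.
- exact: measurable_funeneg.
by rewrite lte_add_pinfty// ltey.
Qed.

(** For [c] nonzero and [f] not integrable both sides take the default 0, so factors can be moved
    through the integral at every point and for every input. *)
Lemma RintegralZ (c : R) f : measurable_fun setT f ->
  \int[mu]_x (c * f x) = c * \int[mu]_x f x.
Proof.
move=> mf; have [fi|fi] := pselect (L1 f); first by rewrite RintegralZl.
have [->|c0] := eqVneq c 0.
  by rewrite mul0r /Rintegral; under eq_integral do rewrite mul0r; rewrite integral0.
rewrite (Rintegral_notint mf fi) mulr0 Rintegral_notint//; first exact: measurable_funM.
move=> cf; apply: fi; have := integrableZl measurableT (c^-1) cf.
by apply: eq_integrable => // x _ /=; rewrite -EFinM mulKf.
Qed.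

Definition twist (l : R) u : R -> R := (fun s => expR (- (l * s)) * u s) \_ I01.

Lemma Volt_restrict k u t : I01 t -> Volt k u t = rconv (k \_ I01) (u \_ I01) t.
Proof.
move=> /I01P/andP[t0 t1]; rewrite /Volt Rintegral_mkcond; apply: eq_Rintegral => s _.
rewrite !patchE; case: ifPn.
  rewrite inE /= in_itv/= => /andP[s0 st].
  by rewrite !mem_set//; apply/I01P/andP; split; lra.
rewrite notin_setE /= in_itv/= => st.
case: ifPn => [|_]; last by rewrite mul0r.
case: ifPn => [|_]; last by rewrite mulr0.
rewrite !inE => /I01P/andP[s0 s1] /I01P/andP[ts0 ts1].
by exfalso; apply: st; apply/andP; split; lra.
Qed.

Section FixedKernel.
Variables (k K : R -> R) (l : R).
Hypotheses (mk : measurable_fun I01 k) (mK : measurable_fun setT K).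
Hypothesis K_neg : forall t, t < 0 -> K t = 0.
Hypothesis K_I01 : forall t, 0 < t <= 1 -> K t = expR (- (l * t)) * k t.

(** The three exponentials multiply to 1, and for [t] in [I01] the integral only sees [K] on
    [[0, 1]]. Beyond 1 the kernel is therefore free, and it can be continued by the explicit model;
    its value at 0 affects the single point [s = t]. *)
Lemma Volt_rconv u U t : measurable_fun I01 u -> measurable_fun setT U ->
  (forall s, s < 0 -> U s = 0) ->
  (forall s, I01 s -> U s = expR (- (l * s)) * u s) ->
  I01 t -> Volt k u t = expR (l * t) * rconv K U t.
Proof.
move=> mu' mU U_neg U_I01 tI; have /andP[t0 t1] := (I01P t).1 tI.
have mkI := measurable_restrict01 mk; have muI := measurable_restrict01 mu'.
have mKU : measurable_fun setT (fun s : R => K (t - s) * U s).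
  by apply: measurable_funM => //; exact: measurable_reflect.
rewrite Volt_restrict// /rconv -RintegralZ//; congr fine; apply: ae_eq_integral => //.
- apply/measurable_EFinP; apply: measurable_funM => //; exact: measurable_reflect.
- by apply/measurable_EFinP; exact: measurable_funM.
- exists [set t]; split => //; first exact: lebesgue_measure_set1.
  move=> s /= /not_implyP[_]; apply: contra_notP => /eqP st; congr (_%:E).
  have [s0|s0] := ltP s 0.
    rewrite (U_neg _ s0) !mulr0 [(u \_ _) _]patchE memNset ?mulr0//.
    by move=> /I01P/andP[]; lra.
  have [ts|ts] := ltP (t - s) 0.
    rewrite (K_neg ts) mul0r mulr0 [(k \_ _) _]patchE memNset ?mul0r//.
    by move=> /I01P/andP[]; lra.
  have ts0 : 0 < t - s by rewrite lt_neqAle ts andbT eq_sym subr_eq0 eq_sym st.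
  have sI : I01 s by apply/I01P/andP; split; lra.
  have tsI : I01 (t - s) by apply/I01P/andP; split; lra.
  rewrite !patchE !mem_set// (U_I01 _ sI) K_I01; last by apply/andP; split; lra.
  have -> : expR (l * t) * (expR (- (l * (t - s))) * k (t - s) * (expR (- (l * s)) * u s)) =
    (expR (l * t) * expR (- (l * (t - s))) * expR (- (l * s))) * (k (t - s) * u s) by ring.
  rewrite -!expRD [X in expR X](_ : _ = 0); last by ring.
  by rewrite expR0 mul1r.
Qed.

Lemma iter_rconv_neg n U t : (forall s, s < 0 -> U s = 0) -> t < 0 ->
  iter n (rconv K) U t = 0.
Proof.
move=> U_neg; elim: n t => [|n ih] t tn; first exact: U_neg.
rewrite iterS /rconv /Rintegral integral0_eq// => s _.
have [s0|s0] := ltP s 0; first by rewrite ih ?mulr0.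
by rewrite K_neg ?mul0r//; lra.
Qed.

Lemma iter_Volt n u : measurable_fun I01 u ->
  forall t, I01 t -> iter n (Volt k) u t = expR (l * t) * iter n (rconv K) (twist l u) t.
Proof.
move=> mu'.
have mtw : measurable_fun setT (twist l u).
  by apply: measurable_restrict01; apply: measurable_funM => //; exact: measurable_expM.
have tw_neg s : s < 0 -> twist l u s = 0.
  by move=> s0; rewrite /twist patchE memNset// => /I01P/andP[]; lra.
have mit m : measurable_fun setT (iter m (rconv K) (twist l u)).
  exact: measurable_iter_rconv.
elim: n => [|n ih] t tI.
  by rewrite /= /twist patchE mem_set// mulrA -expRD subrr expR0 mul1r.
rewrite !iterS; apply: Volt_rconv => //.
- apply: (@eq_measurable_fun _ _ _ _ I01 (fun t => expR (l * t) * iter n (rconv K) (twist l u) t)).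
    by move=> s; rewrite inE => sI; rewrite ih.
  apply: measurable_funM; last exact: measurable_funTS.
  apply: measurable_funTS; apply: (measurableT_comp (@measurable_expR R)).
  exact: measurable_funM.
- by move=> s; exact: iter_rconv_neg.
- by move=> s sI; rewrite ih// mulrA -expRD addNr expR0 mul1r.
Qed.

End FixedKernel.
End Bridge.

(** * Admissible bounds and operator norms *)

Section OperatorNorm.
Context {R : realType}.
Implicit Types (p : \bar R) (A B : (R -> R) -> (R -> R)) (u : R -> R).

(** Membership of [M] in the set whose infimum is [opnorm]; estimates for single bounds keep the
    infimum out of the way. *)
Definition op_bd p A (M : R) := 0 <= M /\ forall u, measurable_fun I01 u ->
  (LpN p u < +oo)%E -> (LpN p (A u) <= M%:E * LpN p u)%E.

Definition op_meas p A := forall u, measurable_fun I01 u ->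
  (LpN p u < +oo)%E -> measurable_fun I01 (A u).

Lemma opnorm_le p A M : op_bd p A M -> (opnorm p A <= M%:E)%E.
Proof. by move=> h; apply: ereal_inf_lbound; exists M. Qed.

Lemma opnorm_ge0 p A : (0 <= opnorm p A)%E.
Proof. by apply: le_ereal_inf_tmp => _ [M [M0 _] <-]; rewrite lee_fin. Qed.

Lemma opnorm_ge p A u (c n : R) : measurable_fun I01 u -> LpN p u = n%:E ->
  0 < n -> ((c * n)%:E <= LpN p (A u))%E -> (c%:E <= opnorm p A)%E.
Proof.
move=> mu' un n0 cA; apply: le_ereal_inf_tmp => _ [M [M0 MA] <-].
have := le_trans cA (MA u mu' _); rewrite un => /(_ (ltry _)).
by rewrite -EFinM !lee_fin ler_pM2r.
Qed.

Lemma op_bd_le p A M M' : M <= M' -> op_bd p A M -> op_bd p A M'.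
Proof.
move=> MM' [M0 h]; split; first exact: le_trans MM'.
by move=> u mu' uoo; apply: (le_trans (h u mu' uoo)); rewrite lee_wpmul2r ?LpN_ge0 ?lee_fin.
Qed.

Lemma op_bd_add p A B C M M' : (1 <= p)%E ->
  op_meas p (op_sub A B) -> op_meas p (op_sub B C) ->
  op_bd p (op_sub A B) M -> op_bd p (op_sub B C) M' ->
  op_bd p (op_sub A C) (M + M').
Proof.
move=> p1 mAB mBC [M0 hM] [M'0 hM']; split; first exact: addr_ge0.
move=> u mu' uoo.
rewrite (@eq_LpN _ p _ (fun t => op_sub A B u t + op_sub B C u t))//; last first.
  by move=> t _; rewrite /op_sub addrA subrK.
apply: (le_trans (LpN_triangle p1 (mAB u mu' uoo) (mBC u mu' uoo))).
by rewrite EFinD ge0_muleDl ?lee_fin//; apply: leeD; [exact: hM|exact: hM'].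
Qed.

End OperatorNorm.

(** * Comparison of the kernel with the model near 0 *)

Section Perturbation.
Context {R : realType}.
Local Notation mu := (@lebesgue_measure R).
Local Notation L1 f := (mu.-integrable setT (EFin \o f)).

(** Everything follows from [1 + x <= e^x] at [y] and [- y]: the latter gives [e^y (1 - y) <= 1],
    that is [e^y - 1 - y <= y (e^y - 1)]. *)
Lemma expR_taylor1 (y : R) : `|y| <= 2^-1 ->
  [/\ 2^-1 <= expR y, 0 <= expR y - 1 - y & expR y - 1 - y <= 2 * y ^+ 2].
Proof.
rewrite ler_norml => /andP[y1 y2].
have E1 := expR_ge1Dx y; have E2 := expR_ge1Dx (- y).
have E0 := expR_gt0 y.
have EN : expR y * expR (- y) = 1 by rewrite -expRD subrr expR0.
have E3 : expR y * (1 - y) <= 1.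
  by rewrite -[leRHS]EN ler_wpM2l ?expR_ge0.
split; first by lra.
  by lra.
have : expR y - 1 - y <= y * (expR y - 1) by lra.
move=> /le_trans; apply.
have E2' : expR y <= 2 by nra.
have [y0|y0] := leP 0 y; nra.
Qed.

(** Both [f x] and [f 0 e^(m0 x)] are [f 0 (1 + m0 x) + o(x)] for [m0 = d / f 0]. The error is
    written with [e^(eps x) - 1] instead of [eps x] so that, times a power of [x], it becomes a
    difference of two model kernels. *)
Lemma one_jet_near0 (f : R -> R) (d eps : R) : f 0 != 0 -> 0 < eps ->
  ((f x - f 0) / x) @[x --> 0^'+] --> d ->
  exists2 delta : R, 0 < delta < 1 & forall x, 0 < x < delta ->
    `|f x - f 0 * expR (d / f 0 * x)| <=
    `|f 0| * (expR (eps * x) - 1) * expR (d / f 0 * x).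
Proof.
move=> f0 eps0 fd; set m0 := d / f 0.
have af0 : 0 < `|f 0| by rewrite normr_gt0.
have eta0 : 0 < `|f 0| * eps / 4 by rewrite divr_gt0 ?mulr_gt0.
move/cvgrPdist_le : fd => /(_ _ eta0) [e /= e0 He].
(* Relative to [|f 0|]: [d1] ensures [|m0 x| <= 1/2], and [d2] that the second-order remainder of
   [e^(m0 x)] is at most [eps x / 4]. With [eps x / 4] from the difference quotient this makes
   [eps x / 2], which the factor [e^(m0 x) >= 1/2] on the right allows. *)
pose d1 := 2^-1 / (`|m0| + 1); pose d2 := eps / (8 * (m0 ^+ 2 + 1)).
have d10 : 0 < d1 by rewrite divr_gt0// ltr_wpDl.
have m20 : 0 <= m0 ^+ 2 by exact: sqr_ge0.
have d20 : 0 < d2 by rewrite divr_gt0// mulr_gt0// ltr_wpDl.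
exists (Num.min e (Num.min 2^-1 (Num.min d1 d2))).
  rewrite !lt_min e0 d10 d20 invr_gt0 ltr0n/= !gt_min.
  by rewrite (_ : 2^-1 < 1 :> R) ?orbT//; lra.
move=> x; rewrite !lt_min => /and5P[x0 xe _ xd1 xd2].
have Hx : `|d - (f x - f 0) / x| <= `|f 0| * eps / 4.
  by apply: He => //=; rewrite sub0r normrN gtr0_norm.
pose y := m0 * x.
have dy : d * x = f 0 * y by rewrite /y /m0 mulrA mulrCA mulfV// mulr1.
have ay : `|y| <= 2^-1.
  rewrite /y normrM (gtr0_norm x0).
  have : (`|m0| + 1) * x <= 2^-1.
    by rewrite mulrC -ler_pdivlMr ?ltr_wpDl// ltW.
  by have := ltW x0; lra.
have [T1 T2 T3] := expR_taylor1 ay.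
have Hx' : `|f x - f 0 - d * x| <= `|f 0| * eps / 4 * x.
  rewrite (_ : f x - f 0 - d * x = - ((d - (f x - f 0) / x) * x)); last first.
    by field; rewrite gt_eqF.
  by rewrite normrN normrM (gtr0_norm x0) ler_wpM2r// ltW.
have y2 : 2 * y ^+ 2 <= eps / 4 * x.
  have : 8 * (m0 ^+ 2 + 1) * x <= eps.
    by rewrite mulrC -ler_pdivlMr ?mulr_gt0 ?ltr_wpDl// ltW.
  move=> h; rewrite /y exprMn.
  have : 8 * m0 ^+ 2 * x <= eps by have := ltW x0; lra.
  move=> /(ler_wpM2r (ltW x0)); rewrite expr2; lra.
apply: (@le_trans _ _ (`|f 0| * eps / 4 * x + `|f 0| * (eps / 4 * x))).
  rewrite (_ : f x - f 0 * expR (m0 * x) =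
    (f x - f 0 - d * x) - f 0 * (expR y - 1 - y)); last by rewrite dy /y; ring.
  rewrite (le_trans (ler_normB _ _))// lerD// normrM ler_wpM2l// ger0_norm//.
  exact: le_trans y2.
have E1 := expR_ge1Dx (eps * x).
have ex0 : 0 < eps * x by rewrite mulr_gt0.
have : `|f 0| * (eps * x) * 2^-1 <= `|f 0| * (expR (eps * x) - 1) * expR (m0 * x).
  apply: ler_pM => //; first by rewrite mulr_ge0// ltW.
  by rewrite ler_wpM2l//; lra.
by lra.
Qed.

(** Undoing the twist turns the kernel value at [x = t - s] into [e^(l x) kap x]; bounding it by
    [M e^(- b (1 - x))] is what makes [rank_one_bound] applicable. *)
Lemma twisted_bound (l b M : R) (kap u : R -> R) (t : R) :
  measurable_fun setT kap -> measurable_fun I01 u -> 0 <= M ->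
  (forall x, x <= 0 -> kap x = 0) ->
  (forall x, 0 < x <= 1 -> expR (l * x) * `|kap x| <= M * expR (- (b * (1 - x)))) ->
  I01 t -> (`|expR (l * t) * rconv kap (twist l u) t|%:E <= M%:E *
    \int[mu]_(s in I01) (`|expR (- (b * (1 - t + s))) * u s|)%:E)%E.
Proof.
move=> mkap mu' M0 kap_neg kapM /I01P/andP[t0 t1].
have mtw : measurable_fun setT (twist l u).
  by apply: measurable_restrict01; apply: measurable_funM => //; exact: measurable_expM.
have mint : measurable_fun setT (fun s : R => kap (t - s) * twist l u s).
  by apply: measurable_funM => //; exact: measurable_reflect.
have mexp : measurable_fun I01 (fun s => (`|expR (- (b * (1 - t + s))) * u s|)%:E).
  apply/measurable_EFinP; apply: measurableT_comp => //; apply: measurable_funM => //.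
  apply: measurable_funTS; apply: (measurableT_comp (@measurable_expR R)).
  by apply: measurable_funN; apply: measurable_funM => //; exact: measurable_funD.
rewrite /rconv -RintegralZ//.
apply: (le_trans (abs_Rintegral_le _)); first exact: measurable_funM.
rewrite -ge0_integralZl ?lee_fin//; last exact: mI01.
rewrite [leRHS]integral_mkcond; apply: ge0_le_integral => //.
- by apply/measurable_EFinP; apply: measurableT_comp => //; exact: measurable_funM.
- apply/(measurable_restrictT _ _).1; first exact: mI01.
  exact: measurable_funeM.
- move=> s _; rewrite patchE /twist patchE; case: ifPn => [|_]; last first.
    by rewrite !mulr0 normr0.
  rewrite inE => /I01P/andP[s0 s1]; rewrite -EFinM lee_fin.
  have [ts|ts] := leP (t - s) 0.
    by rewrite kap_neg// mul0r mulr0 normr0 mulr_ge0.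
  have := kapM (t - s); rewrite ts /= => /(_ _) h.
  have {}h : expR (l * (t - s)) * `|kap (t - s)| <= M * expR (- (b * (1 - (t - s)))).
    by apply: h; lra.
  rewrite !normrM !(ger0_norm (expR_ge0 _)).
  have -> : expR (l * t) * (`|kap (t - s)| * (expR (- (l * s)) * `|u s|)) =
     (expR (l * t) * expR (- (l * s))) * `|kap (t - s)| * `|u s| by ring.
  rewrite -expRD (_ : l * t + - (l * s) = l * (t - s)); last by ring.
  rewrite (_ : 1 - t + s = 1 - (t - s)); last by ring.
  by rewrite mulrA ler_wpM2r.
Qed.

Lemma measurable_gkM (c a l : R) : measurable_fun setT (fun x => c * gk a l x).
Proof. by apply: measurable_funM => //; exact: measurable_gk. Qed.

Lemma integrable_gkM (c a l : R) : 0 < a -> 0 < l -> L1 (fun x => c * gk a l x).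
Proof.
move=> a0 l0; have := integrableZl measurableT c (integrable_gk a0 l0).
by apply: eq_integrable.
Qed.

Lemma powR_le_exp1 (m x : R) : 0 <= m -> 0 < x -> x `^ m <= expR (- (m * (1 - x))).
Proof.
move=> m0 x0; have := expR_ge1Dx (x - 1); rewrite addrC subrK => h.
have := ge0_ler_powR m0 (ltW x0 : x \in Num.nneg) _ h; rewrite nnegrE expR_ge0 => /(_ isT).
by rewrite powR_expR -mulrN opprB.
Qed.

Section FixedKernel.
Variables (a c m0 : R).
Hypothesis a_gt0 : 0 < a.
Let h (t : R) := c * t `^ (a - 1) * expR (m0 * t).

Let H l x := c * gk a (l - m0) x.

Let HE l x : 0 < x -> H l x = expR (- (l * x)) * h x.
Proof.
move=> x0; rewrite /H /h gk_gt0//.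
have -> : expR (- ((l - m0) * x)) = expR (- (l * x)) * expR (m0 * x).
  by rewrite -expRD; congr expR; ring.
by ring.
Qed.

Lemma measurable_h (D : set R) : measurable_fun D h.
Proof.
apply: measurable_funTS; apply: measurable_funM.
  by apply: measurable_funM => //; exact: measurable_powR.
by apply: (measurableT_comp (@measurable_expR R)); exact: measurable_funM.
Qed.

Lemma iter_Volt_h n l u : measurable_fun I01 u ->
  forall t, I01 t -> iter n (Volt h) u t =
    expR (l * t) * iter n (rconv (fun x => c * gk a (l - m0) x)) (twist l u) t.
Proof.
move=> mu'; apply: iter_Volt => //.
- exact: measurable_h.
- exact: measurable_gkM.
- by move=> t tn; rewrite gk_le0 ?mulr0// ltW.
- by move=> t /andP[t0 _]; exact: HE.
Qed.

Lemma integrable_h : mu.-integrable I01 (EFin \o h).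
Proof.
have i1 : mu.-integrable I01 (EFin \o (fun x => expR (`|m0| + 1) * `|c| * gk a 1 x)).
  apply: (@integrableS _ _ _ mu setT I01) => //; first exact: mI01.
  exact: integrable_gkM.
(* The origin is removed because [gk] vanishes there while [h] need not, as when [a = 1]. *)
have h0 : mu.-integrable (I01 `\` [set 0]) (EFin \o h).
  apply: (@le_integrable _ _ _ mu _ _ _ (EFin \o (fun x => expR (`|m0| + 1) * `|c| * gk a 1 x))).
  - by apply: measurableD => //; exact: mI01.
  - by apply/measurable_EFinP; exact: measurable_h.
  - move=> x [/I01P/andP[x0 x1] /= /eqP xn0].
    have {}x0 : 0 < x by rewrite lt_neqAle eq_sym xn0.
    rewrite lee_fin /h gk_gt0// !normrM !normr_id !(ger0_norm (expR_ge0 _)) (ger0_norm (powR_ge0 _ _)).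
    rewrite [leRHS](_ : _ = `|c| * x `^ (a - 1) * (expR (`|m0| + 1) * expR (- (1 * x)))); last by ring.
    rewrite ler_wpM2l ?mulr_ge0 ?powR_ge0// -expRD ler_expR.
    have : m0 * x <= `|m0|.
      rewrite (le_trans (ler_norm _))// normrM (gtr0_norm x0) ler_piMr//.
    lra.
  - apply: integrableS i1 => //; first exact: mI01.
    by apply: measurableD => //; exact: mI01.
apply/(@negligible_integrable _ _ _ mu _ [set 0]) => //.
- exact: mI01.
- by apply/measurable_EFinP; exact: measurable_h.
- exact: lebesgue_measure_set1.
Qed.

End FixedKernel.

End Perturbation.

(** * Difference of the powers of the kernel and of the model, for fixed n *)

Section StepEstimates.
Context {R : realType}.
Local Notation mu := (@lebesgue_measure R).
Local Notation L1 f := (mu.-integrable setT (EFin \o f)).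
Local Notation N p f := (Lnorm mu p (EFin \o f)).

Lemma expR_ge1 (x : R) : (1 <= expR x) = (0 <= x).
Proof. by rewrite -[leLHS]expR0 ler_expR. Qed.

(** Hoelder's inequality against [e^(- s)], which is at least [e^(-1)] on [[0, 1]], covers every [p]
    at once. *)
Lemma LpN_L1 p (u : R -> R) : (1 <= p)%E -> measurable_fun I01 u ->
  (LpN p u < +oo)%E -> L1 (u \_ I01).
Proof.
move=> p1 mu' uoo; have h := hoelder_exp p1 ltr01 mu'.
have i1 : mu.-integrable I01 (EFin \o (fun s => expR (- (1 * s)) * u s)).
  apply/integrableP; split.
    by apply/measurable_EFinP; apply: measurable_funM => //; exact: measurable_expM.
  apply: le_lt_trans h _; rewrite lte_mul_pinfty ?lee_fin ?Qn_ge0//.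
have i2 : mu.-integrable I01 (EFin \o u).
  apply: (@le_integrable _ _ _ mu _ _ _ (fun s => (expR 1)%:E * (expR (- (1 * s)) * u s)%:E)%E).
  - exact: mI01.
  - exact/measurable_EFinP.
  - move=> s /I01P/andP[s0 s1]; rewrite -EFinM lee_fin mulrA -expRD normrM.
    rewrite (ger0_norm (expR_ge0 _)) ler_peMl// expR_ge1; lra.
  - by apply: integrableZl i1; exact: mI01.
by rewrite -restrict_EFin; apply: (iffLR (integrable_mkcond _ _)) => //; exact: mI01.
Qed.

Lemma measurable_twist l (u : R -> R) : measurable_fun I01 u ->
  measurable_fun setT (twist l u).
Proof.
by move=> mu'; apply: measurable_restrict01; apply: measurable_funM => //; exact: measurable_expM.
Qed.

Lemma twist_L1 p l (u : R -> R) : (1 <= p)%E -> measurable_fun I01 u ->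
  (LpN p u < +oo)%E -> L1 (twist l u).
Proof.
move=> p1 mu' uoo; have h := LpN_L1 p1 mu' uoo.
apply: le_integrable (integrableZl measurableT (expR `|l|) h) => //.
  by apply/measurable_EFinP; exact: measurable_twist.
move=> s _ /=; rewrite /twist !patchE; case: ifPn => [|_]; last by rewrite normr0 lee_fin.
rewrite inE => /I01P/andP[s0 s1]; rewrite lee_fin !normrM ler_wpM2r//.
rewrite !(ger0_norm (expR_ge0 _)) ler_expR.
have := ler_norm (- l); rewrite normrN => h1; have h2 := normr_ge0 l.
have : `|l| * s <= `|l| by rewrite ler_piMr.
have : - l * s <= `|l| * s by rewrite ler_wpM2r.
by lra.
Qed.

Lemma N_twist_le p l (u : R -> R) : (1 <= p)%E -> 0 <= l -> measurable_fun I01 u ->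
  (N p (twist l u) <= LpN p u)%E.
Proof.
move=> p1 l0 mu'; rewrite LpNE//; last exact: measurable_restrict01.
apply: ae_le_Lnorm => //; first exact: measurable_twist.
  exact: measurable_restrict01.
apply: aeT => s; rewrite /twist !patchE; case: ifPn => [|_] //.
rewrite inE => /I01P/andP[s0 s1]; rewrite normrM ler_piMl// ger0_norm ?expR_ge0//.
by rewrite expR_le1 oppr_le0 mulr_ge0.
Qed.

Lemma LpN_le_N p (f : R -> R) : (1 <= p)%E -> measurable_fun setT f ->
  (LpN p f <= N p f)%E.
Proof.
move=> p1 mf; have mfI : measurable_fun setT (f \_ I01).
  by apply: measurable_restrict01; exact: measurable_funTS.
rewrite LpNE//; apply: ae_le_Lnorm => //; apply: aeT => s.
by rewrite patchE; case: ifPn => //; rewrite normr0.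
Qed.

(** With [x = 1 - y], [ln y = - x + O(x^2)] gives a relative error [O(m x^2)]; half of the
    exponential is spent on [(m x)^2 e^(- m x / 2) = O(1)], which leaves [1 / m]. Nonpositive [y] is
    included because the rank-one kernel lives on the whole square and the Volterra kernel on a
    triangle. *)
Lemma pow_exp_diff (m y : R) : 1 <= m -> y <= 1 ->
  `|(if 0 < y then y `^ m else 0) - expR (- (m * (1 - y)))| <=
  64 / m * expR (- (m / 2 * (1 - y))).
Proof.
move=> m1 y1; have m0 : 0 < m by rewrite (lt_le_trans ltr01).
pose x := 1 - y; have x0 : 0 <= x by rewrite /x; lra.
rewrite -/x.
have E0 := expR_gt0 (- (m * x)).
suff key : `|(if 0 < y then y `^ m else 0) - expR (- (m * x))| <=
    4 * m * x ^+ 2 * expR (- (m * x)).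
  apply: (le_trans key).
  pose w := m / 2 * x; have w0 : 0 <= w by rewrite /w mulr_ge0 ?divr_ge0// ltW.
  have -> : expR (- (m * x)) = expR (- w) * expR (- w).
    by rewrite -expRD; congr expR; rewrite /w; field.
  have w2 : w ^+ 2 <= 4 * expR w.
    have := expR_ge1Dx (w / 2) => h.
    have : (w / 2) ^+ 2 <= expR (w / 2) ^+ 2.
      by rewrite ler_pXn2r ?nnegrE ?expR_ge0 ?divr_ge0//; lra.
    rewrite -[X in _ <= X]/(expR (w / 2) * expR (w / 2)) -expRD (_ : w / 2 + w / 2 = w); last by field.
    by rewrite expr2; lra.
  have -> : 4 * m * x ^+ 2 = 16 / m * w ^+ 2 by rewrite /w; field; rewrite gt_eqF.
  rewrite -/w mulrA ler_wpM2r ?expR_ge0//.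
  have -> : 64 / m = 16 / m * 4 by field; rewrite gt_eqF.
  have EE : expR w * expR (- w) = 1 by rewrite -expRD subrr expR0.
  have := ler_wpM2r (expR_ge0 (- w)) w2.
  rewrite -[X in _ <= X]mulrA EE mulr1 => w4.
  have m16 : 0 <= 16 / m by rewrite divr_ge0 ?(ltW m0).
  by have := ler_wpM2l m16 w4; rewrite mulrA.
(* Away from [y = 1] the factor [4 m x^2] is at least 1, so the crude bound of the difference by
   [e^(- m x)] suffices. *)
have big : 2^-1 <= x -> expR (- (m * x)) <= 4 * m * x ^+ 2 * expR (- (m * x)).
  move=> x2; rewrite -[leLHS]mul1r ler_wpM2r ?expR_ge0//.
  have : 2^-1 * 2^-1 <= x * x by apply: ler_pM.
  move=> h; have : 1 <= 4 * (x * x) by lra.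
  by rewrite expr2 => h'; rewrite -[leLHS]mulr1 mulrAC ler_pM//; lra.
have x2E : 0 <= 4 * m * x ^+ 2 * expR (- (m * x)).
  by rewrite !mulr_ge0 ?sqr_ge0 ?expR_ge0// ltW.
case: ifPn => [yp|]; last first.
  rewrite -leNgt => yn; rewrite sub0r normrN (gtr0_norm E0) big//.
  by rewrite /x; lra.
have yle : y `^ m <= expR (- (m * x)) by exact: powR_le_exp1 (ltW m0) yp.
rewrite distrC ger0_norm ?subr_ge0//.
have [y2|y2] := leP y 2^-1.
  apply: (le_trans _ (big _)); last by rewrite /x; lra.
  by rewrite gerBl powR_ge0.
have lny : - ln y <= x / y.
  have := expR_ge1Dx (- ln y); rewrite expRN lnK ?posrE// => h.
  have -> : x / y = y^-1 - 1 by rewrite /x; field; rewrite gt_eqF.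
  by lra.
have -> : y `^ m = expR (- (m * x)) * expR (m * (x + ln y)).
  by rewrite -expRD /powR gt_eqF//; congr expR; ring.
rewrite -[X in X - _]mulr1 -mulrBr mulrC ler_wpM2r ?expR_ge0//.
have := expR_ge1Dx (m * (x + ln y)) => h.
apply: (@le_trans _ _ (m * (- x - ln y))); first by lra.
have -> : 4 * m * x ^+ 2 = m * (4 * x ^+ 2) by ring.
apply: ler_wpM2l; first exact: ltW.
have : x / y - x <= 4 * x ^+ 2.
  have -> : x / y - x = x ^+ 2 / y by rewrite /x; field; rewrite gt_eqF.
  rewrite mulrC ler_wpM2r ?sqr_ge0//.
  have : y^-1 <= 2 by rewrite -[leRHS]invrK lef_pV2 ?posrE ?invr_gt0// ltW.
  by lra.
by lra.
Qed.

Lemma measurable_iter_Volt_h (a c m0 : R) n u : measurable_fun I01 u ->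
  measurable_fun I01 (iter n (Volt (fun t => c * t `^ (a - 1) * expR (m0 * t))) u).
Proof.
move=> mu'; apply: (@eq_measurable_fun _ _ _ _ I01
    (fun t => expR (0 * t) * iter n (rconv (fun x => c * gk a (0 - m0) x)) (twist 0 u) t)).
  by move=> t; rewrite inE => tI; rewrite (iter_Volt_h a c m0 n 0 mu' tI).
apply: measurable_funTS; apply: measurable_funM.
  by apply: (measurableT_comp (@measurable_expR R)); exact: measurable_funM.
by apply: measurable_iter_rconv; [exact: measurable_gkM|exact: measurable_twist].
Qed.

Section Kernels.
Variables (a : R) (f : R -> R) (m0 eps th l : R).
Hypotheses (a_gt0 : 0 < a).
Let k t := t `^ (a - 1) * f t.
Let h t := f 0 * t `^ (a - 1) * expR (m0 * t).
Hypothesis ik : mu.-integrable I01 (EFin \o k).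
Hypotheses (eps_gt0 : 0 < eps) (th_gt0 : 0 < th) (th_lt1 : th < 1).
Hypothesis jet : forall x, 0 < x <= th ->
    `|f x - f 0 * expR (m0 * x)| <= `|f 0| * (expR (eps * x) - 1) * expR (m0 * x).
Hypotheses (l_ge0 : 0 <= l) (l_gt : 0 < l - m0 - eps).

Let mk : measurable_fun I01 k.
Proof. by have /measurable_int/measurable_EFinP := ik. Qed.

Let H x := f 0 * gk a (l - m0) x.
Let A x := `|f 0| * gk a (l - m0) x.
(** Lowering the rate by [eps] multiplies the model by [e^(eps x)], so [P - A] is exactly the error
    that [jet] allows. *)
Let P x := `|f 0| * gk a (l - m0 - eps) x.
(** The twisted true kernel up to [c], continued by the model. [Kc 1] represents [Volt k] on [I01],
    while [Kc th] stays within [P - A] of [H] on the whole line. *)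
Let Kc (c x : R) := if (0 < x) && (x <= c) then expR (- (l * x)) * (k \_ I01) x else H x.

Let measurable_Kc c : measurable_fun setT (Kc c).
Proof.
apply: measurable_fun_ifT.
- by apply: measurable_and; [exact: measurable_fun_ltr|exact: measurable_fun_ler].
- by apply: measurable_funM; [exact: measurable_expM|exact: measurable_restrict01].
- exact: measurable_gkM.
Qed.

Let HE x : 0 < x -> H x = expR (- (l * x)) * h x.
Proof.
move=> x0; rewrite /H /h gk_gt0//.
have -> : expR (- ((l - m0) * x)) = expR (- (l * x)) * expR (m0 * x).
  by rewrite -expRD; congr expR; ring.
by ring.
Qed.

Let PAE x : 0 < x -> P x - A x =
  expR (- (l * x)) * x `^ (a - 1) * (`|f 0| * (expR (eps * x) - 1) * expR (m0 * x)).
Proof.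
move=> x0; rewrite /P /A !gk_gt0//.
have -> : expR (- ((l - m0 - eps) * x)) = expR (- (l * x)) * expR (m0 * x) * expR (eps * x).
  by rewrite -!expRD; congr expR; ring.
have -> : expR (- ((l - m0) * x)) = expR (- (l * x)) * expR (m0 * x).
  by rewrite -expRD; congr expR; ring.
by ring.
Qed.

Let K1H x : `|Kc th x - H x| <= P x - A x.
Proof.
have [xn|x0] := leP x 0.
  rewrite /Kc ltNge xn /= subrr normr0 /P /A !gk_le0// !mulr0 subrr//.
rewrite PAE// /Kc x0 /=; case: ifPn => [xth|_].
  rewrite HE// -mulrBr normrM (ger0_norm (expR_ge0 _)) -mulrA ler_wpM2l ?expR_ge0//.
  have xI : I01 x by apply/I01P/andP; move: th_lt1 => ?; split; lra.
  rewrite patchE mem_set//.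
  rewrite /k /h (_ : _ - _ = x `^ (a - 1) * (f x - f 0 * expR (m0 * x))); last by ring.
  by rewrite normrM (ger0_norm (powR_ge0 _ _)) ler_wpM2l ?powR_ge0// jet// x0.
rewrite subrr normr0 !mulr_ge0 ?expR_ge0 ?powR_ge0// subr_ge0 expR_ge1.
by rewrite mulr_ge0 ?ltW.
Qed.

Let HA x : `|H x| <= A x.
Proof. by rewrite normrM (ger0_norm (gk_ge0 _ _ _)). Qed.

Let K1P x : `|Kc th x| <= P x.
Proof.
rewrite -(subrK (H x) (Kc th x)) (le_trans (ler_normD _ _))//.
by have := K1H x; have := HA x; lra.
Qed.

Let W := \int[mu]_(t in I01) `|k t - h t|.

Let ikh : mu.-integrable I01 (EFin \o (fun t => k t - h t)).
Proof.
have ih : mu.-integrable I01 (EFin \o h) by exact: integrable_h.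
have := @integrableB _ _ R mu I01 _ _ _ ik ih.
by apply; exact: mI01.
Qed.

(** The two kernels differ only on []th, 1]], where the twist is at most [e^(- l th)]. *)
Let KK1 : (\int[mu]_x `|Kc 1 x - Kc th x|%:E <= (expR (- (l * th)) * W)%:E)%E.
Proof.
have /integrableP[/measurable_EFinP mkh kh] := ikh.
have WE : (W%:E = \int[mu]_(t in I01) `|k t - h t|%:E)%E.
  by rewrite /W /Rintegral fineK// ge0_fin_numE// integral_ge0.
rewrite EFinM WE -ge0_integralZl ?lee_fin ?expR_ge0//; last 2 first.
- exact: mI01.
- by apply/measurable_EFinP; exact: measurableT_comp.
rewrite [leRHS]integral_mkcond; apply: ge0_le_integral => //.
- apply/measurable_EFinP; apply: measurableT_comp => //.
  by apply: measurable_funB; exact: measurable_Kc.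
- apply/(measurable_restrictT _ _).1; first exact: mI01.
  by apply: measurable_funeM; apply/measurable_EFinP; exact: measurableT_comp.
- move=> x _; have R0 : (0 <= ((fun x => (expR (- (l * th)))%:E * `|k x - h x|%:E)%E \_ I01) x)%E.
    by rewrite patchE; case: ifPn => // _; rewrite mule_ge0 ?lee_fin ?expR_ge0.
  rewrite /Kc; have [x0 /=|xn /=] := ltP 0 x; last by rewrite subrr normr0.
  have [xth|xth] := leP x th.
    by rewrite (le_trans xth (ltW th_lt1)) subrr normr0.
  have [x1|x1] := leP x 1; last by rewrite subrr normr0.
  have xI : I01 x by apply/I01P; rewrite (ltW x0) x1.
  rewrite HE// -mulrBr normrM (ger0_norm (expR_ge0 _)) !patchE !mem_set//.
  rewrite -EFinM lee_fin ler_wpM2r// ler_expR lerN2 ler_wpM2l// ltW//.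
Qed.

Let iP : L1 P. Proof. by apply: integrable_gkM. Qed.

Let l_gt' : 0 < l - m0. Proof. by have := l_gt; have := eps_gt0; lra. Qed.

Let iH : L1 H. Proof. by apply: integrable_gkM. Qed.

Let iK1 : L1 (Kc th).
Proof.
apply: le_integrable iP => //; first by apply/measurable_EFinP; exact: measurable_Kc.
by move=> x _ /=; rewrite lee_fin (le_trans (K1P x))// ler_norm.
Qed.

Let iK : L1 (Kc 1).
Proof.
have i1 : L1 (fun x => Kc 1 x - Kc th x).
  apply/integrableP_EFin; split; first by apply: measurable_funB; exact: measurable_Kc.
  by apply: (le_lt_trans KK1); exact: ltry.
have := integrableD measurableT i1 iK1; apply: eq_integrable => // x _ /=.
by rewrite -EFinD subrK.
Qed.

Let K1_int : (\int[mu]_x `|Kc th x|%:E <= (`|f 0| * Gamma a / (l - m0 - eps) `^ a)%:E)%E.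
Proof.
rewrite -mulrA EFinM -integral_gk// -ge0_integralZl ?lee_fin//; last 2 first.
- by apply/measurable_EFinP; exact: measurable_gk.
- by move=> x _; rewrite lee_fin gk_ge0.
apply: ge0_le_integral => //.
- by apply/measurable_EFinP; apply: measurableT_comp => //; exact: measurable_Kc.
- by apply: measurable_funeM; apply/measurable_EFinP; exact: measurable_gk.
- by move=> x _; rewrite -EFinM lee_fin; exact: K1P.
Qed.

Let W_ge0 : 0 <= W. Proof. exact: Rintegral_ge0. Qed.

Lemma iter_Volt_k n u : measurable_fun I01 u ->
  forall t, I01 t -> iter n (Volt k) u t = expR (l * t) * iter n (rconv (Kc 1)) (twist l u) t.
Proof.
move=> mu'; apply: iter_Volt => //.
- move=> t tn; rewrite /Kc (ltNge 0 t) (ltW tn) /= /H gk_le0 ?mulr0// ltW//.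
- by move=> t /andP[t0 t1]; rewrite /Kc t0 t1 /= patchE mem_set//; apply/I01P; rewrite (ltW t0).
Qed.

Lemma measurable_iter_Volt_k n u : measurable_fun I01 u ->
  measurable_fun I01 (iter n (Volt k) u).
Proof.
move=> mu'; apply: (@eq_measurable_fun _ _ _ _ I01
    (fun t => expR (l * t) * iter n (rconv (Kc 1)) (twist l u) t)).
  by move=> t; rewrite inE => tI; rewrite iter_Volt_k.
apply: measurable_funTS; apply: measurable_funM.
  by apply: (measurableT_comp (@measurable_expR R)); exact: measurable_funM.
by apply: measurable_iter_rconv => //; exact: measurable_twist.
Qed.

Let measurable_tw_iter n (K u : R -> R) : measurable_fun setT K -> measurable_fun I01 u ->
  measurable_fun setT (fun t => expR (l * t) * iter n (rconv K) (twist l u) t).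
Proof.
move=> mK mu'; apply: measurable_funM.
  by apply: (measurableT_comp (@measurable_expR R)); exact: measurable_funM.
by apply: measurable_iter_rconv => //; exact: measurable_twist.
Qed.

(** [iter_rconv_diff] with the mass of [P] as main size and [KK1] as perturbation; returning from
    twisted functions on [I01] costs [e^l]. *)
Lemma far_part p n : (1 <= p)%E ->
  op_bd p (op_sub (iter n (Volt k))
      (fun u t => expR (l * t) * iter n (rconv (Kc th)) (twist l u) t))
    (expR l * ((`|f 0| * Gamma a / (l - m0 - eps) `^ a + expR (- (l * th)) * W) ^+ n
       - (`|f 0| * Gamma a / (l - m0 - eps) `^ a) ^+ n)).
Proof.
move=> p1; set X := `|f 0| * _ / _; set Y := _ * W.
have X0 : 0 <= X by rewrite !mulr_ge0 ?invr_ge0 ?powR_ge0// ltW// Gamma_gt0.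
have Y0 : 0 <= Y by rewrite mulr_ge0 ?expR_ge0.
split.
  by rewrite mulr_ge0 ?expR_ge0// subr_ge0 lerXn2r ?nnegrE ?addr_ge0 ?lerDl.
move=> u mu' uoo.
have [M uE] : exists M, LpN p u = M%:E.
  by have := LpN_ge0 p u; case: (LpN p u) uoo => // M; exists M.
have tw1 := twist_L1 l p1 mu' uoo.
have tM : (N p (twist l u) <= M%:E)%E by rewrite -uE; exact: N_twist_le.
have D := iter_rconv_diff n p1 iK iK1 tw1 X0 Y0 K1_int KK1 tM.
set F := _ \- _ in D.
have mF : measurable_fun setT F.
  by apply: measurable_funB; apply: measurable_iter_rconv => //; exact: measurable_twist.
apply: (@le_trans _ _ (LpN p (fun t => expR l * F t))).
  apply: ae_le_LpN => //.
  - apply: measurable_funB; first exact: measurable_iter_Volt_k.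
    by apply: measurable_funTS; exact: measurable_tw_iter.
  - by apply: measurable_funTS; exact: measurable_funM.
  - apply: aeT => t tI; have /andP[t0 t1] := (I01P t).1 tI.
    rewrite /op_sub iter_Volt_k// -mulrBr !normrM ler_wpM2r//.
    by rewrite !ger0_norm ?expR_ge0// ler_expR ler_piMr.
rewrite LpNZ//; last exact: measurable_funTS.
rewrite ger0_norm ?expR_ge0// uE [(expR l * _)%:E]EFinM -muleA lee_wpmul2l ?lee_fin ?expR_ge0//.
rewrite -EFinM; apply: (le_trans (LpN_le_N p1 mF)).
exact: D.
Qed.

Lemma norm_gamma_coef n : `|(f 0 * Gamma a) ^+ n.+1 / Gamma (a * n.+1%:R)| =
  (`|f 0| * Gamma a) ^+ n.+1 / Gamma (a * n.+1%:R).
Proof.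
have G1 := Gamma_gt0 a_gt0; have G2 := Gamma_gt0 (mulr_gt0 a_gt0 (ltr0Sn R n)).
by rewrite normrM normrX normrM (gtr0_norm G1) normfV (gtr0_norm G2).
Qed.

(** The power of [P] is the power of [A] times [e^(eps x)], with a single [eps] for all [n + 1]
    factors. On []0, 1]] the kernels of the two powers thus differ by at most [e^eps - 1] times the
    power of [A], and [x^m <= e^(- m (1 - x))] gives a rank-one majorant. *)
Lemma near_part p n : (1 <= p)%E -> 0 < a * n.+1%:R - 1 ->
  op_bd p (op_sub (fun u t => expR (l * t) * iter n.+1 (rconv (Kc th)) (twist l u) t)
      (iter n.+1 (Volt h)))
    (`|(f 0 * Gamma a) ^+ n.+1 / Gamma (a * n.+1%:R)| * ((expR eps - 1) * expR `|m0|) *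
      (Pn p (a * n.+1%:R - 1) * Qn p (a * n.+1%:R - 1))).
Proof.
move=> p1; set m := a * n.+1%:R - 1 => mp.
set cn := `|_ / _|.
have e0 : 0 <= expR eps - 1 by rewrite subr_ge0 expR_ge1 ltW.
have M0 : 0 <= cn * ((expR eps - 1) * expR `|m0|).
  by rewrite !mulr_ge0 ?expR_ge0// normr_ge0.
split; first by rewrite mulr_ge0// mulr_ge0 ?Pn_ge0 ?Qn_ge0.
move=> u mu' uoo.
have tw1 := twist_L1 l p1 mu' uoo.
have mtw := measurable_twist l mu'.
have mH : measurable_fun setT H by exact: measurable_gkM.
pose kap := iter n (rconv (Kc th)) (Kc th) \- iter n (rconv H) H.
have mkap : measurable_fun setT kap.
  by apply: measurable_funB; apply: measurable_iter_rconv.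
have iPn j x : L1 (fun s => P (x - s) * iter j (rconv P) P s).
  rewrite /P iter_gk//; set C := _ / _.
  have := integrableZl measurableT (`|f 0| * C)
    (@integrable_gk_conv R a (a * j.+1%:R) (l - m0 - eps) x a_gt0 (mulr_gt0 a_gt0 (ltr0Sn R j))).
  by apply: eq_integrable => // s _ /=; rewrite -EFinM; congr (_%:E); ring.
have kapE x : `|kap x| <= cn * (gk (a * n.+1%:R) (l - m0 - eps) x - gk (a * n.+1%:R) (l - m0) x).
  have mA : measurable_fun setT A by exact: measurable_gkM.
  have mP : measurable_fun setT P by exact: measurable_gkM.
  have [_] := @iter_kernel_diff _ (Kc th) H P A n x (measurable_Kc th) mH mP mA HA K1H iPn.
  have EP : iter n (rconv P) P x = cn * gk (a * n.+1%:R) (l - m0 - eps) x.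
    by rewrite /cn norm_gamma_coef /P iter_gk.
  have EA : iter n (rconv A) A x = cn * gk (a * n.+1%:R) (l - m0) x.
    by rewrite /cn norm_gamma_coef /A iter_gk.
  by move=> b; apply: (le_trans b); rewrite mulrBr EP EA.
have mVh : measurable_fun I01 (iter n.+1 (Volt h) u) by exact: measurable_iter_Volt_h.
apply: (@rank_one_bound _ p m) => //.
  apply: measurable_funB => //.
  by apply: measurable_funTS; apply: measurable_tw_iter.
have i1 := integrable_iter_rconv n iK1 iK1; have i2 := integrable_iter_rconv n iH iH.
have E1 := aeS2 (fun t X Y => conj X Y) (iter_rconv n iK1 tw1) (iter_rconv n iH tw1).
apply: aeS2 _ E1 (rconvBl i1 i2 tw1) => t [X Y] Z tI.
rewrite /op_sub (iter_Volt_h a (f 0) m0 n.+1 l mu' tI) -/H -mulrBr X Y Z.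
apply: twisted_bound => //.
  move=> x xn; have := kapE x; rewrite !gk_le0// subrr mulr0 normr_le0 => /eqP //.
move=> x /andP[x0 x1]; apply: (le_trans (ler_wpM2l (expR_ge0 _) (kapE x))).
rewrite !gk_gt0// mulrCA -!mulrA ler_wpM2l ?normr_ge0//.
rewrite -/m -mulrBr mulrCA.
have -> : expR (- ((l - m0 - eps) * x)) - expR (- ((l - m0) * x)) =
   expR (- (l * x)) * (expR (m0 * x) * (expR (eps * x) - 1)).
  rewrite mulrBr mulr1 mulrBr -!expRD; congr (expR _ - expR _); ring.
rewrite [expR (l * x) * _]mulrA -expRD subrr expR0 mul1r.
have h1 := powR_le_exp1 (ltW mp) x0.
have h2 : expR (m0 * x) <= expR `|m0|.
  rewrite ler_expR (le_trans (ler_norm _))// normrM (gtr0_norm x0) ler_piMr//.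
have h3 : expR (eps * x) - 1 <= expR eps - 1.
  by rewrite lerB// ler_expR ler_piMr// ltW.
have h4 : 0 <= expR (eps * x) - 1 by rewrite subr_ge0 expR_ge1 mulr_ge0// ltW.
rewrite mulrC [X in X * _]mulrC [leRHS]mulrA; apply: ler_pM => //.
- by rewrite mulr_ge0 ?expR_ge0.
- exact: powR_ge0.
- by apply: ler_pM => //; exact: expR_ge0.
Qed.

Lemma step_bound p n : (1 <= p)%E -> 0 < a * n.+1%:R - 1 ->
  op_bd p (op_sub (iter n.+1 (Volt k)) (iter n.+1 (Volt h)))
    (expR l * ((`|f 0| * Gamma a / (l - m0 - eps) `^ a + expR (- (l * th)) * W) ^+ n.+1
       - (`|f 0| * Gamma a / (l - m0 - eps) `^ a) ^+ n.+1) +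
    `|(f 0 * Gamma a) ^+ n.+1 / Gamma (a * n.+1%:R)| * ((expR eps - 1) * expR `|m0|) *
      (Pn p (a * n.+1%:R - 1) * Qn p (a * n.+1%:R - 1))).
Proof.
move=> p1 mp; apply: op_bd_add p1 _ _ (far_part n.+1 p1) (near_part p1 mp) => u mu' uoo.
  apply: measurable_funB; first exact: measurable_iter_Volt_k.
  by apply: measurable_funTS; exact: measurable_tw_iter.
apply: measurable_funB; last exact: measurable_iter_Volt_h.
by apply: measurable_funTS; exact: measurable_tw_iter.
Qed.

End Kernels.
End StepEstimates.

(** * Comparison of the model power with a rank-one operator *)

Section RankOne.
Context {R : realType}.
Local Notation mu := (@lebesgue_measure R).
Local Notation L1 f := (mu.-integrable setT (EFin \o f)).

Lemma SopE l (u : R -> R) t : measurable_fun I01 u ->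
  Sop l u t = expR (l * t) * \int[mu]_s twist l u s.
Proof.
move=> mu'; rewrite /Sop Rintegral_mkcond -RintegralZ; last exact: measurable_twist.
apply: eq_Rintegral => s _; rewrite /twist !patchE; case: ifPn => _; last by rewrite mulr0.
by rewrite mulrA -expRD; congr (expR _ * _); ring.
Qed.

Lemma measurable_Sop l (u : R -> R) (D : set R) : measurable_fun I01 u ->
  measurable_fun D (Sop l u).
Proof.
move=> mu'; have -> : Sop l u = fun t => expR (l * t) * \int[mu]_s twist l u s.
  by apply/funext => t; exact: SopE.
apply: measurable_funTS; apply: measurable_funM => //.
by apply: (measurableT_comp (@measurable_expR R)); exact: measurable_funM.
Qed.

(** The kernel of the power is [cn x^m e^(m0 x)] for [x = t - s > 0] and 0 otherwise, that of the
    scaled [Sop] is [cn e^(- m (1 - x)) e^(m0 x)]; [pow_exp_diff] compares them, and its halved rate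
    is the [m / 2] of the bound. *)
Lemma rank_one_part (a c m0 : R) p n : 0 < a -> (1 <= p)%E -> 1 <= a * n.+1%:R - 1 ->
  op_bd p (op_sub (iter n.+1 (Volt (fun t => c * t `^ (a - 1) * expR (m0 * t))))
      (op_scale ((c * Gamma a) ^+ n.+1 / Gamma (a * n.+1%:R) * expR (- (a * n.+1%:R - 1)))
         (Sop (a * n.+1%:R - 1 + m0))))
    (`|(c * Gamma a) ^+ n.+1 / Gamma (a * n.+1%:R)| *
       (expR `|m0| * (64 / (a * n.+1%:R - 1))) *
      (Pn p ((a * n.+1%:R - 1) / 2) * Qn p ((a * n.+1%:R - 1) / 2))).
Proof.
move=> a_gt0 p1; set m := a * n.+1%:R - 1 => m1; set cn := _ ^+ _ / _.
set h := fun t : R => _.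
have mp : 0 < m by rewrite (lt_le_trans ltr01).
have b0 : 0 < m / 2 by rewrite divr_gt0.
have M0 : 0 <= `|cn| * (expR `|m0| * (64 / m)).
  by rewrite !mulr_ge0 ?expR_ge0 ?invr_ge0 ?(ltW mp).
split; first by apply: mulr_ge0 => //; rewrite mulr_ge0 ?Pn_ge0 ?Qn_ge0.
(* Any nonnegative [l > m0] serves: it makes the twisted kernel integrable and cancels from the
   final kernel. *)
move=> u mu' uoo; pose l := `|m0| + 1.
have l0 : 0 <= l by rewrite addr_ge0.
have lm : 0 < l - m0 by rewrite /l; have := ler_norm m0; lra.
pose H x := c * gk a (l - m0) x.
have iH : L1 H by exact: integrable_gkM.
have tw1 := twist_L1 l p1 mu' uoo.
have tw2 := twist_L1 (m + m0) p1 mu' uoo.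
have mtw := measurable_twist l mu'.
have mVh : measurable_fun I01 (iter n.+1 (Volt h) u) by exact: measurable_iter_Volt_h.
apply: (@rank_one_bound _ p (m / 2)) => //.
  apply: measurable_funB => //.
  by apply: measurable_funM => //; exact: measurable_Sop.
have i1 := integrable_iter_rconv n iH iH.
apply: aeS2 _ (iter_rconv n iH tw1) (ae_integrable_conv i1 tw1) => t X Y tI.
have /andP[t0 t1] := (I01P t).1 tI.
rewrite /op_sub /op_scale (iter_Volt_h a c m0 n.+1 l mu' tI) -/H X SopE//.
have EH : iter n (rconv H) H = fun x => cn * gk (a * n.+1%:R) (l - m0) x.
  by rewrite /H iter_gk.
rewrite {}EH in Y *; clearbody cn.
pose F s := expR (l * t) * (cn * gk (a * n.+1%:R) (l - m0) (t - s) * twist l u s).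
pose G s := cn * expR (- m) * expR ((m + m0) * t) * twist (m + m0) u s.
have iF : L1 F.
  by have := integrableZl measurableT (expR (l * t)) Y; apply: eq_integrable.
have iG : L1 G.
  have := integrableZl measurableT (cn * expR (- m) * expR ((m + m0) * t)) tw2.
  by apply: eq_integrable.
have mF : measurable_fun setT F by have /measurable_int/measurable_EFinP := iF.
have mG : measurable_fun setT G by have /measurable_int/measurable_EFinP := iG.
have mY : measurable_fun setT (fun s : R => cn * gk (a * n.+1%:R) (l - m0) (t - s) * twist l u s).
  by have /measurable_int/measurable_EFinP := Y.
have mW : measurable_fun setT (twist (m + m0) u) by exact: measurable_twist.
rewrite /rconv -RintegralZ// mulrA -RintegralZ// -RintegralB//.
apply: (@le_trans _ _ (\int[mu]_s (`|F s - G s|)%:E)%E).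
  by apply: abs_Rintegral_le; exact: measurable_funB.
have mE : measurable_fun I01 (fun s : R => (`|expR (- (m / 2 * (1 - t + s))) * u s|)%:E).
  apply/measurable_EFinP; apply: measurableT_comp => //; apply: measurable_funM => //.
  apply: measurable_funTS; apply: (measurableT_comp (@measurable_expR R)).
  by apply: measurable_funN; apply: measurable_funM => //; exact: measurable_funD.
rewrite -ge0_integralZl//; last first.
- exact: mI01.
rewrite [leRHS]integral_mkcond; apply: ge0_le_integral => //.
- by apply/measurable_EFinP; apply: measurableT_comp => //; exact: measurable_funB.
- apply/(measurable_restrictT _ _).1; first exact: mI01.
  by apply: measurable_funeM.
- move=> s _; rewrite /F /G /twist !patchE; case: ifPn => [|_]; last first.
    by rewrite !mulr0 subrr normr0.
  rewrite inE => /I01P/andP[s0 s1].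
  rewrite -EFinM lee_fin.
  have y1 : t - s <= 1 by lra.
  have -> : expR (l * t) * (cn * gk (a * n.+1%:R) (l - m0) (t - s) * (expR (- (l * s)) * u s)) -
     cn * expR (- m) * expR ((m + m0) * t) * (expR (- ((m + m0) * s)) * u s) =
     cn * (expR (m0 * (t - s)) *
       ((if 0 < t - s then (t - s) `^ m else 0) - expR (- (m * (1 - (t - s)))))) * u s.
    have -> : cn * expR (- m) * expR ((m + m0) * t) * (expR (- ((m + m0) * s)) * u s) =
       cn * (expR (m0 * (t - s)) * expR (- (m * (1 - (t - s))))) * u s.
      rewrite -expRD.
      have -> : m0 * (t - s) + - (m * (1 - (t - s))) = - m + (m + m0) * t + - ((m + m0) * s) by ring.
      by rewrite !expRD; ring.
    have -> : expR (m0 * (t - s)) = expR (l * t) * expR (- (l * s)) * expR (- ((l - m0) * (t - s))).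
      by rewrite -!expRD; congr expR; ring.
    by rewrite /gk -/m; case: ifP => _; ring.
  rewrite [leRHS](_ : _ = `|cn| * (expR `|m0| *
      (64 / m * expR (- (m / 2 * (1 - t + s))) * `|u s|))); last first.
    by rewrite normrM (ger0_norm (expR_ge0 _)); ring.
  rewrite !normrM -[leLHS]mulrA -[X in _ * X]mulrA; apply: ler_wpM2l => //.
  apply: ler_pM => //.
  + rewrite ger0_norm ?expR_ge0// ler_expR (le_trans (ler_norm _))// normrM ler_piMr//.
    by rewrite ler_norml; apply/andP; split; lra.
  + have := ler_wpM2r (normr_ge0 (u s)) (pow_exp_diff m1 y1).
    by rewrite (_ : 1 - (t - s) = 1 - t + s)//; ring.
Qed.
End RankOne.

(** * Size of the constants as n grows *)

Section Quantitative.
Context {R : realType}.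

(** The bound given by Hoelder's inequality for the norm of the operator with kernel
    [e^(- b (1 - t)) e^(- b s)]. *)
Definition PQ p (b : R) := Pn p b * Qn p b.

Lemma PQ_ge0 p (b : R) : 0 < b -> 0 <= PQ p b.
Proof. by move=> b0; rewrite mulr_ge0 ?Pn_ge0 ?Qn_ge0. Qed.

Lemma PQ_le p (b : R) : (1 <= p)%E -> 0 < b -> PQ p b <= Cp p / b.
Proof.
move=> p1 b0; rewrite ler_pdivlMr// mulrC.
by have /andP[] := PQ_bounds p1 b0.
Qed.

(** The 8 is 4 times 2: [m + c >= 1] gives [(1 - e^(- (m + c)))^2 >= 1/4], and [m + c <= 2 m]. *)
Lemma PQ_ge p (m c : R) : (1 <= p)%E -> 2 * `|c| + 2 <= m ->
  Cp p / (8 * m) <= PQ p (m + c).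
Proof.
move=> p1 mc; have C0 := Cp_gt0 p1.
have := ler_norm c; have := ler_norm (- c); rewrite normrN => c1 c2.
have m0 : 0 < m by have := normr_ge0 c; lra.
have b1 : 1 <= m + c by lra.
have b0 : 0 < m + c by lra.
have /andP[+ _] := PQ_bounds p1 b0.
rewrite -/(PQ p (m + c)) [leRHS]mulrC -ler_pdivrMr// => h; apply: le_trans h.
have E2 : expR (- (m + c)) <= 2^-1.
  rewrite expRN lef_pV2 ?posrE ?expR_gt0//.
  by have := expR_ge1Dx (m + c); lra.
have E4 : 4^-1 <= (1 - expR (- (m + c))) ^+ 2.
  have : 2^-1 * 2^-1 <= (1 - expR (- (m + c))) * (1 - expR (- (m + c))).
    by apply: ler_pM => //; lra.
  by rewrite expr2; lra.
rewrite ler_pdivrMr ?mulr_gt0//.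
have e8 : 4^-1 * Cp p * (8 * m) = Cp p * (2 * m) by field.
rewrite mulrAC ler_pdivlMr//.
apply: (@le_trans _ _ (4^-1 * Cp p * (8 * m))); last first.
  apply: ler_wpM2r; first by rewrite mulr_ge0 ?(ltW m0).
  by apply: ler_wpM2r => //; exact: ltW.
by rewrite e8 ler_wpM2l ?(ltW C0)//; lra.
Qed.

Lemma expRB1_le (x : R) : 0 <= x <= 2^-1 -> expR x - 1 <= 2 * x.
Proof.
move=> /andP[x0 x2]; have [|_ _] := @expR_taylor1 _ x; first by rewrite ger0_norm.
have : x * x <= x * 2^-1 by rewrite ler_wpM2l.
by rewrite expr2; lra.
Qed.

(** [(1 + x)^n <= e^(n x)] for [x = B / A], and [e^z - 1 <= 2 z] for small [z]. *)
Lemma pow_add_sub_le (A B : R) n : 0 < A -> 0 <= B -> n%:R * (B / A) <= 2^-1 ->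
  (A + B) ^+ n - A ^+ n <= A ^+ n * (2 * (n%:R * (B / A))).
Proof.
move=> A0 B0 h; have x0 : 0 <= B / A by rewrite divr_ge0// ltW.
have -> : A + B = A * (1 + B / A) by field; rewrite gt_eqF.
rewrite exprMn -[X in _ - X]mulr1 -mulrBr; apply: ler_wpM2l; first by rewrite exprn_ge0// ltW.
apply: (@le_trans _ _ (expR (n%:R * (B / A)) - 1)).
  by rewrite lerB// expRM_natl lerXn2r ?nnegrE ?expR_ge0 ?expR_ge1Dx// addr_ge0.
by apply: expRB1_le; rewrite h mulr_ge0.
Qed.

(* [e ^ l] is compensated by Stirling's inequality for [Gamma (a * n)], while the
   relative perturbation [B / A] decays exponentially in [n]. *)
Lemma far_small (a F W th m1 : R) : 0 < a -> 0 < F -> 0 <= W -> 0 < th ->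
  exists2 K : R, 0 < K & forall n, K <= a * n%:R ->
    expR (a * n%:R + m1) *
      ((F / (a * n%:R) `^ a + expR (- ((a * n%:R + m1) * th)) * W) ^+ n -
       (F / (a * n%:R) `^ a) ^+ n) <= K * (F ^+ n / Gamma (a * n%:R)) / (a * n%:R) ^+ 2.
Proof.
move=> a0 F0 W0 th0.
(* The exponent collects [y^a] from the division by [A], one [y] from [n = y / a], and [y^2] for the
   gain: the norm to beat is of order [1 / y] relative to [F^n / Gamma y]. *)
pose b := a + 3; have b0 : 0 < b by rewrite /b; lra.
pose C := W * expR (- (m1 * th)) / (a * F) * (b `^ b * expR (- b) / th `^ b).
have D0 : 0 <= W * expR (- (m1 * th)) / (a * F).
  by rewrite !mulr_ge0 ?expR_ge0// invr_ge0 mulr_ge0 ?(ltW a0) ?(ltW F0).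
have C0 : 0 <= C.
  by rewrite mulr_ge0// !mulr_ge0 ?expR_ge0 ?powR_ge0// invr_ge0 powR_ge0.
(* [K <= y] gives [y >= 1] and [C / y^2 <= 1/2], as [pow_add_sub_le] requires; the first summand is
   the final constant. *)
pose K := expR (1 + m1) * 2 * C + 2 * C + 1.
have K0 : 0 < K.
  have : 0 <= expR (1 + m1) * 2 * C by rewrite mulr_ge0// mulr_ge0 ?expR_ge0.
  by rewrite /K; lra.
exists K => // n Ky; set y := a * n%:R in Ky *.
have eC : 0 <= expR (1 + m1) * 2 * C by rewrite mulr_ge0// mulr_ge0 ?expR_ge0.
have y1 : 1 <= y by rewrite (le_trans _ Ky)// /K; lra.
have y0 : 0 < y by lra.
have yC : 2 * C <= y by rewrite (le_trans _ Ky)// /K; lra.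
have nE : n%:R = y / a by rewrite /y mulrAC mulfV ?mul1r// gt_eqF.
have ya0 : 0 < y `^ a by rewrite powR_gt0.
set A := F / y `^ a; set B := _ * W.
have A0 : 0 < A by rewrite divr_gt0.
have B0 : 0 <= B by rewrite mulr_ge0 ?expR_ge0.
have key : n%:R * (B / A) <= C / y ^+ 2.
  have pw : y `^ b * expR (- (y * th)) <= b `^ b * expR (- b) / th `^ b.
    rewrite ler_pdivlMr ?powR_gt0//.
    have := powR_le_expR b0 (mulr_ge0 (ltW y0) (ltW th0)).
    rewrite powRM ?(ltW y0) ?(ltW th0)// expRD => h.
    have := ler_wpM2r (expR_ge0 (- (y * th))) h.
    rewrite -!mulrA [X in _ <= _ * X]mulrCA -expRD subrr expR0 mulr1.
    by rewrite [y `^ b * (th `^ b * _)]mulrCA [X in _ -> _ * X <= _]mulrC mulrCA [th `^ b * _]mulrC.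
  have -> : n%:R * (B / A) = W * expR (- (m1 * th)) / (a * F) *
     (y `^ b * expR (- (y * th))) / y ^+ 2.
    have -> : y `^ b = y `^ a * y ^+ 3.
      by rewrite /b powRD ?(gt_eqF y0) ?implybT// powR_mulrn ?(ltW y0).
    rewrite nE /A /B.
    have -> : expR (- ((y + m1) * th)) = expR (- (y * th)) * expR (- (m1 * th)).
      by rewrite -expRD; congr expR; ring.
    by field; rewrite !gt_eqF.
  rewrite /C; apply: ler_wpM2r; first by rewrite invr_ge0 exprn_ge0// ltW.
  exact: ler_wpM2l.
have yy : y <= y ^+ 2 by rewrite expr2 ler_peMl// ltW.
have y20 : 0 < y ^+ 2 by rewrite exprn_gt0.
have small : n%:R * (B / A) <= 2^-1.
  by apply: (le_trans key); rewrite ler_pdivrMr//; lra.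
have An : A ^+ n = F ^+ n / y `^ y.
  by rewrite expr_div_n -[(y `^ a) ^+ n]powR_mulrn ?powR_ge0// -powRrM.
have G0 := Gamma_gt0 y0.
have Fn0 : 0 < F ^+ n by rewrite exprn_gt0.
have st : expR (y + m1) * A ^+ n <= expR (1 + m1) * (F ^+ n / Gamma y).
  rewrite An mulrCA [leRHS]mulrCA; apply: ler_wpM2l; first exact: ltW.
  rewrite ler_pdivlMr// mulrAC ler_pdivrMr ?powR_gt0//.
  have -> : y + m1 = (1 + m1) - (1 - y) by ring.
  rewrite expRD -mulrA; apply: ler_wpM2l; first exact: expR_ge0.
  have := ler_wpM2l (expR_ge0 (- (1 - y))) (Gamma_le y1).
  by rewrite [leRHS]mulrCA -expRD addNr expR0 mulr1.
apply: (le_trans (ler_wpM2l (expR_ge0 _) (pow_add_sub_le A0 B0 small))).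
rewrite [leLHS]mulrA; apply: (@le_trans _ _ (expR (1 + m1) * (F ^+ n / Gamma y) * (2 * (C / y ^+ 2)))).
  apply: ler_pM => //.
  - by rewrite mulr_ge0 ?expR_ge0 ?exprn_ge0 ?ltW.
  - by rewrite !mulr_ge0// ?invr_ge0 ltW.
  - by rewrite ler_wpM2l.
have -> : expR (1 + m1) * (F ^+ n / Gamma y) * (2 * (C / y ^+ 2)) =
   (expR (1 + m1) * 2 * C) * (F ^+ n / Gamma y) / y ^+ 2 by ring.
apply: ler_wpM2r; first by rewrite invr_ge0 ltW.
apply: ler_wpM2r; first by rewrite divr_ge0 ?ltW.
by rewrite /K; lra.
Qed.
End Quantitative.

(** * Norms and extremal functions through an approximating sequence *)

Section OperatorAsymptotics.
Context {R : realType}.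
Variable p : \bar R.
Hypothesis p1 : (1 <= p)%E.

Lemma LpN_subC (f g : R -> R) : measurable_fun I01 f -> measurable_fun I01 g ->
  LpN p (fun t => f t - g t) = LpN p (fun t => g t - f t).
Proof.
move=> mf mg; rewrite (@eq_LpN _ p _ (fun t => -1 * (g t - f t)))//; last by move=> t _; ring.
by rewrite LpNZ//; [rewrite normrN1 mul1e|exact: measurable_funB].
Qed.

Lemma LpN_le_sub (f g : R -> R) : measurable_fun I01 f -> measurable_fun I01 g ->
  (LpN p g <= LpN p f + LpN p (fun t => g t - f t)%R)%E.
Proof.
move=> mf mg; rewrite (@eq_LpN _ p g (fun t => f t + (g t - f t)))//; last by move=> t _; ring.
by apply: LpN_triangle => //; exact: measurable_funB.
Qed.

Variables (A B : nat -> (R -> R) -> (R -> R)) (N : nat -> R).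
Hypotheses (mA : forall n, op_meas p (A n)) (mB : forall n, op_meas p (B n)).
Hypothesis AB : forall eta, 0 < eta ->
  \forall n \near \oo, op_bd p (op_sub (A n) (B n)) (eta * N n).
Hypothesis BN : \forall n \near \oo, 0 < N n /\ op_bd p (B n) (N n).

Lemma op_bd_near eta : 0 < eta -> \forall n \near \oo, op_bd p (A n) ((1 + eta) * N n).
Proof.
move=> e0; near=> n.
have [N0 [_ h1]] : 0 < N n /\ op_bd p (B n) (N n) by near: n; exact: BN.
have [_ h2] : op_bd p (op_sub (A n) (B n)) (eta * N n) by near: n; exact: AB.
split; first by rewrite mulr_ge0 ?(ltW N0)//; lra.
move=> u mu' uoo.
apply: (le_trans (LpN_le_sub (mB n mu' uoo) (mA n mu' uoo))).
rewrite mulrDl mul1r EFinD ge0_muleDl ?lee_fin ?mulr_ge0 ?(ltW N0) ?(ltW e0)//.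
by apply: leeD; [exact: h1|exact: h2].
Unshelve. all: by end_near. Qed.

(** Functions, of norms [v n], at which the approximants [B n] nearly reach the bound [N n]. Their
    existence turns this upper bound into the asymptotic value of the norm, for [A n] as well. *)
Definition extremal_test (fs : nat -> R -> R) (v : nat -> R) :=
  (forall eta, 0 < eta -> \forall n \near \oo,
    [/\ measurable_fun I01 (fs n), LpN p (fs n) = (v n)%:E, 0 < v n &
     (((1 - eta) * N n * v n)%:E <= LpN p (B n (fs n)))%E]).

Lemma extremal_test_A fs v eta : extremal_test fs v -> 0 < eta ->
  \forall n \near \oo,
    [/\ 0 < N n, measurable_fun I01 (fs n), LpN p (fs n) = (v n)%:E, 0 < v n &
     (((1 - eta) * N n * v n)%:E <= LpN p (A n (fs n)) <= ((1 + eta) * N n * v n)%:E)%E].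
Proof.
move=> T e0; have e2 : 0 < eta / 2 by rewrite divr_gt0.
near=> n.
have [N0 _] : 0 < N n /\ op_bd p (B n) (N n) by near: n; exact: BN.
have [_ h2] : op_bd p (op_sub (A n) (B n)) (eta / 2 * N n) by near: n; exact: AB.
have [_ h3] : op_bd p (A n) ((1 + eta) * N n) by near: n; exact: op_bd_near.
have [mf fv v0 Bf] : [/\ measurable_fun I01 (fs n), LpN p (fs n) = (v n)%:E, 0 < v n &
     (((1 - eta / 2) * N n * v n)%:E <= LpN p (B n (fs n)))%E] by near: n; exact: T.
have foo : (LpN p (fs n) < +oo)%E by rewrite fv ltry.
split => //; apply/andP; split; last first.
  by rewrite EFinM -fv; exact: h3.
have mAf := mA n mf foo; have mBf := mB n mf foo.
have L1 := LpN_le_sub mAf mBf; have L2 := h2 _ mf foo.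
rewrite LpN_subC// in L1; rewrite fv -EFinM /op_sub in L2.
have L3 := le_trans (le_trans Bf L1) (leeD (lexx (LpN p (A n (fs n)))) L2).
have -> : (1 - eta) * N n * v n = (1 - eta / 2) * N n * v n - eta / 2 * N n * v n by field.
by rewrite EFinB leeBlDr.
Unshelve. all: by end_near. Qed.

Lemma opnorm_asym fs v eta : extremal_test fs v -> 0 < eta -> \forall n \near \oo,
  exists x, [/\ opnorm p (A n) = x%:E, 0 < N n & (1 - eta) * N n <= x <= (1 + eta) * N n].
Proof.
move=> T e0; near=> n.
have [N0 mf fv v0 /andP[L U]] : [/\ 0 < N n, measurable_fun I01 (fs n), LpN p (fs n) = (v n)%:E, 0 < v n &
     (((1 - eta) * N n * v n)%:E <= LpN p (A n (fs n)) <= ((1 + eta) * N n * v n)%:E)%E].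
  by near: n; exact: extremal_test_A.
have h : op_bd p (A n) ((1 + eta) * N n) by near: n; exact: op_bd_near.
have u := opnorm_le h; have l := opnorm_ge mf fv v0 L; have o := opnorm_ge0 p (A n).
case E : (opnorm p (A n)) => [x||]; rewrite E in u l o => //.
by exists x; split => //; rewrite -!lee_fin l.
Unshelve. all: by end_near. Qed.

Lemma opnorm_cvg fs v : extremal_test fs v ->
  (fine (opnorm p (A n)) / N n) @[n --> \oo] --> (1 : R).
Proof.
move=> T; apply/cvgrPdist_le => eta e0; near=> n.
have [x [-> N0 /andP[l u]]] : exists x, [/\ opnorm p (A n) = x%:E, 0 < N n &
   (1 - eta) * N n <= x <= (1 + eta) * N n] by near: n; exact: (opnorm_asym T).
rewrite /= distrC ler_norml -ler_pdivlMr// in l *; rewrite -ler_pdivrMr// in u.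
by apply/andP; split; lra.
Unshelve. all: by end_near. Qed.

Lemma extremal_cvg fs v : extremal_test fs v -> asym_extremal p A fs.
Proof.
move=> T; have T1 := opnorm_cvg T.
have T2 : (fine (LpN p (A n (fs n))) / (N n * v n)) @[n --> \oo] --> (1 : R).
  apply/cvgrPdist_le => eta e0; near=> n.
  have [N0 mf fv v0] : [/\ 0 < N n, measurable_fun I01 (fs n), LpN p (fs n) = (v n)%:E, 0 < v n &
     (((1 - eta) * N n * v n)%:E <= LpN p (A n (fs n)) <= ((1 + eta) * N n * v n)%:E)%E].
    by near: n; exact: (extremal_test_A T).
  have := LpN_ge0 p (A n (fs n)).
  case: (LpN p (A n (fs n))) => [x||]//= _; rewrite ?leey ?leNye ?andbF//.
  have Nv : 0 < N n * v n by rewrite mulr_gt0.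
  rewrite !lee_fin -!mulrA -(ler_pdivlMr _ _ Nv) -(ler_pdivrMr _ _ Nv) => /andP[l u].
  by rewrite distrC ler_norml; apply/andP; split; lra.
rewrite /asym_extremal /asym_num.
have T3 : (fine (LpN p (A n (fs n))) / (N n * v n) * (fine (opnorm p (A n)) / N n)^-1)
    @[n --> \oo] --> (1 * 1^-1 : R).
  by apply: cvgM => //; apply: cvgV => //; exact: oner_neq0.
rewrite invr1 mulr1 in T3; apply: cvg_trans T3; apply: near_eq_cvg; near=> n.
have [N0 mf fv v0 _] : [/\ 0 < N n, measurable_fun I01 (fs n), LpN p (fs n) = (v n)%:E, 0 < v n &
     (((1 - 1) * N n * v n)%:E <= LpN p (A n (fs n)) <= ((1 + 1) * N n * v n)%:E)%E].
  by near: n; exact: (extremal_test_A T).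
have [x [xE _ /andP[l u]]] : exists x, [/\ opnorm p (A n) = x%:E, 0 < N n &
   (1 - 2^-1) * N n <= x <= (1 + 2^-1) * N n] by near: n; exact: (opnorm_asym T).
have x0 : 0 < x by apply: lt_le_trans l; rewrite mulr_gt0//; lra.
by rewrite /= fv xE /=; field; rewrite !gt_eqF.
Unshelve. all: by end_near. Qed.

Lemma asym_op_near fs v C : extremal_test fs v ->
  (forall eta, 0 < eta -> \forall n \near \oo, op_bd p (op_sub (A n) (C n)) (eta * N n)) ->
  asym_op p A C.
Proof.
move=> T AC; split.
  near=> n.
  have [x [-> N0 /andP[l u]]] : exists x, [/\ opnorm p (A n) = x%:E, 0 < N n &
     (1 - 2^-1) * N n <= x <= (1 + 2^-1) * N n] by near: n; exact: (opnorm_asym T).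
  have h : op_bd p (op_sub (A n) (C n)) (1 * N n) by near: n; exact: AC.
  have x0 : 0 < x by apply: lt_le_trans l; rewrite mulr_gt0//; lra.
  by split; [rewrite lte_fin|split; [exact: ltry|apply: (le_lt_trans (opnorm_le h)); exact: ltry]].
(* Half of [eta], because the denominator is bounded below by [N n / 2]. *)
apply/cvgrPdist_le => eta e0; have e2 : 0 < eta / 2 by rewrite divr_gt0.
near=> n.
have [x [-> N0 /andP[l u]]] : exists x, [/\ opnorm p (A n) = x%:E, 0 < N n &
   (1 - 2^-1) * N n <= x <= (1 + 2^-1) * N n] by near: n; exact: (opnorm_asym T).
have h : op_bd p (op_sub (A n) (C n)) (eta / 2 * N n) by near: n; exact: AC.
have x0 : 0 < x by apply: lt_le_trans l; rewrite mulr_gt0//; lra.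
have := opnorm_le h; have := opnorm_ge0 p (op_sub (A n) (C n)).
case: (opnorm p (op_sub (A n) (C n))) => [y||]//=; rewrite !lee_fin => y0 yN.
rewrite sub0r normrN ger0_norm ?divr_ge0 ?(ltW x0)// ler_pdivrMr//.
have := ler_wpM2l (ltW e0) l; lra.
Unshelve. all: by end_near. Qed.

End OperatorAsymptotics.

(** * Asymptotics for the kernel of the theorem *)

Section MainEstimates.
Context {R : realType}.
Local Notation mu := (@lebesgue_measure R).

(** The image of any [u] is a multiple of [e^(- l (1 - t))], so its norm is [Pn] times a scalar. *)
Lemma LpN_scale_Sop p (c l : R) u : (1 <= p)%E -> 0 < l -> measurable_fun I01 u ->
  LpN p (op_scale c (Sop l) u) =
    (`|c| * expR l * Pn p l * `|\int[mu]_s twist l u s|)%:E.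
Proof.
move=> p1 l0 mu'; set I := \int[mu]_s _.
rewrite (@eq_LpN _ p _ (fun t => c * expR l * I * expR (- (l * (1 - t)))))//; last first.
  move=> t _; rewrite /op_scale SopE// -/I.
  have -> : expR (l * t) = expR l * expR (- (l * (1 - t))).
    by rewrite -expRD; congr expR; ring.
  by ring.
rewrite LpNZ ?LpN_expB//; last exact: measurable_expB.
by rewrite -EFinM !normrM (ger0_norm (expR_ge0 l)); congr (_%:E); ring.
Qed.

Lemma op_bd_scale_Sop p (c l : R) : (1 <= p)%E -> 0 < l ->
  op_bd p (op_scale c (Sop l)) (`|c| * expR l * PQ p l).
Proof.
move=> p1 l0; split; first by rewrite mulr_ge0 ?PQ_ge0// mulr_ge0 ?expR_ge0.
move=> u mu' uoo; have [M uE] : exists M, LpN p u = M%:E.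
  by have := LpN_ge0 p u; case: (LpN p u) uoo => // M; exists M.
rewrite LpN_scale_Sop// uE -EFinM lee_fin.
have -> : `|c| * expR l * PQ p l * M = `|c| * expR l * Pn p l * (Qn p l * M).
  by rewrite /PQ; ring.
apply: ler_wpM2l; first by rewrite !mulr_ge0 ?expR_ge0 ?Pn_ge0.
rewrite -lee_fin EFinM -uE; apply: le_trans (hoelder_exp p1 l0 mu').
apply: (le_trans (abs_Rintegral_le (measurable_twist l mu'))).
rewrite [leRHS]integral_mkcond le_eqVlt; apply/orP; left; apply/eqP.
apply: eq_integral => s _; rewrite /twist !patchE; case: ifPn => // _.
by rewrite normr0.
Qed.

Lemma near_affine (a Y : R) : 0 < a -> \forall n \near \oo, Y <= a * n%:R.
Proof.
move=> a0; near=> n; rewrite mulrC -ler_pdivrMr//.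
by near: n; exact: nbhs_infty_ger.
Unshelve. all: by end_near. Qed.

Lemma near_affineS (a Y : R) : 0 < a -> \forall n \near \oo, Y <= a * n.+1%:R.
Proof.
move=> a0; near=> n; apply: (@le_trans _ _ (a * n%:R)); last by rewrite ler_pM2l// ler_nat.
by near: n; exact: near_affine.
Unshelve. all: by end_near. Qed.

Lemma Rintegral_twist_exp (l b : R) u : 0 < l + b ->
  (forall s, u s = expR (- (b * s))) -> \int[mu]_s twist l u s = phi (l + b).
Proof.
move=> lb uE; rewrite /Rintegral.
have -> : (\int[mu]_s (twist l u s)%:E = (phi (l + b))%:E)%E; last by [].
rewrite -integral_exp01// [RHS]integral_mkcond.
apply: eq_integral => s _; rewrite /twist !patchE; case: ifPn => // _.
by rewrite uE -expRD; congr (expR _)%:E; ring.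
Qed.

Lemma LpNy_cst1 : LpN +oo (fun=> 1 : R) = 1%:E.
Proof.
have m1 : measurable_fun I01 (fun=> 1 : R) by [].
apply/eqP; rewrite eq_le; apply/andP; split.
  rewrite LpNE ?leey//; last exact: measurable_restrict01.
  rewrite LnormyE; apply/ess_supP/aeT => t /=; rewrite patchE; case: ifPn => _.
    by rewrite -[leRHS]/(1%:E) lee_fin normr1.
  by rewrite -[leRHS]/(1%:E) lee_fin -[X in `|X|]/(0 : R) normr0.
rewrite -(@LpN_expB _ +oo 1)// ?leey//; apply: ae_le_LpN => //; first by rewrite leey.
  exact: measurable_expB.
apply: aeT => t /I01P/andP[t0 t1]; rewrite normr1 ger0_norm ?expR_ge0// expR_le1.
by rewrite mul1r; lra.
Qed.

Variables (a : R) (f : R -> R) (d : R) (p : \bar R).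
Hypotheses (a0 : 0 < a) (p1 : (1 <= p)%E) (f0 : f 0 != 0).
Let k t := t `^ (a - 1) * f t.
Let m0 := d / f 0.
Let h t := f 0 * t `^ (a - 1) * expR (m0 * t).
Hypothesis ik : mu.-integrable I01 (EFin \o k).
Hypothesis fd : ((f x - f 0) / x) @[x --> 0^'+] --> d.

Let lam (n : nat) := a * n%:R - 1 + m0.
Let cn (n : nat) := (f 0 * Gamma a) ^+ n / Gamma (a * n%:R).
Let A (n : nat) := iter n (Volt k).
Let H (n : nat) := iter n (Volt h).
Let B (n : nat) := op_scale (cn n * expR (- (a * n%:R - 1))) (Sop (lam n)).
(** The bound of [op_bd_scale_Sop] for [B n], simplified by [e^(- (a n - 1)) e^(lam n) = e^m0]. *)
Let N (n : nat) := `|cn n| * expR m0 * PQ p (lam n).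

Lemma op_meas_A n : op_meas p (A n).
Proof. by move=> u mu' _; exact: (measurable_iter_Volt_k 0 0 ik). Qed.

Lemma op_meas_H n : op_meas p (H n).
Proof. by move=> u mu' _; exact: measurable_iter_Volt_h. Qed.

Lemma op_meas_B n : op_meas p (B n).
Proof. by move=> u mu' _; apply: measurable_funM => //; exact: measurable_Sop. Qed.

Let F0 : 0 < `|f 0| * Gamma a.
Proof. by rewrite mulr_gt0 ?normr_gt0// Gamma_gt0. Qed.

Let cn_gt0 n : 0 < `|cn n.+1|.
Proof.
by rewrite norm_gamma_coef// divr_gt0 ?exprn_gt0// Gamma_gt0// mulr_gt0.
Qed.

Let C0 := Cp_gt0 p1.

Lemma op_bd_AH eta : 0 < eta ->
  \forall n \near \oo, op_bd p (op_sub (A n) (H n)) (eta * N n).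
Proof.
move=> e0.
(* The 32 is 2 from [e^eps - 1 <= 2 eps], times 8 from [PQ p (y - 1) <= 8 Q], times 2 because this
   part may use only half of [eta]. *)
pose eps := Num.min 2^-1 (eta * expR m0 / (32 * expR `|m0|)).
have eps0 : 0 < eps.
  by rewrite lt_min invr_gt0 ltr0n /= divr_gt0 ?mulr_gt0 ?expR_gt0.
have eps2 : eps <= 2^-1 by rewrite ge_min lexx.
have epsE : 32 * eps * expR `|m0| <= eta * expR m0.
  rewrite -mulrA mulrCA -ler_pdivlMr ?mulr_gt0 ?expR_gt0//.
  by rewrite ge_min lexx orbT.
have [delta /andP[d0 d1] jet] := one_jet_near0 f0 eps0 fd.
pose th := delta / 2; have th0 : 0 < th by rewrite divr_gt0.
have th1 : th < 1 by rewrite /th; lra.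
have jet' x : 0 < x <= th ->
    `|f x - f 0 * expR (m0 * x)| <= `|f 0| * (expR (eps * x) - 1) * expR (m0 * x).
  by move=> /andP[x0 xth]; apply: jet; rewrite x0 (le_lt_trans xth)// /th; lra.
pose W := \int[mu]_(t in I01) `|k t - h t|.
have W0 : 0 <= W by exact: Rintegral_ge0.
have [K K0 HK] := far_small (m0 + eps) a0 F0 W0 th0.
(* The index is shifted because the kernel estimates concern powers of order [n + 1]. *)
apply: near_inftyS; near=> n.
have y1 : 2 * `|m0| + 3 <= a * n.+1%:R by near: n; exact: near_affineS.
have y2 : K <= a * n.+1%:R by near: n; exact: near_affineS.
(* The 16 is the 8 of [PQ_ge] times the 2 of [eta / 2]. *)
have y3 : 16 * K / (eta * expR m0 * Cp p) <= a * n.+1%:R by near: n; exact: near_affineS.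
have := normr_ge0 m0; have := ler_norm m0; have := ler_norm (- m0).
rewrite normrN => n1 n2 n3.
set y := a * n.+1%:R in y1 y2 y3.
(* With [l = y + m0 + eps] the rate of [P] is exactly [y], the value that minimises [e^l] times the
   power of the mass of [P]. *)
have l0 : 0 <= y + (m0 + eps) by lra.
have lE : y + (m0 + eps) - m0 - eps = y by ring.
have l1 : 0 < y + (m0 + eps) - m0 - eps by rewrite lE; lra.
have mp : 0 < a * n.+1%:R - 1 by rewrite -/y; lra.
have := step_bound a0 ik eps0 th1 jet' l0 l1 p1 mp.
rewrite lE -/y -/h -/W => sb; apply: op_bd_le sb.
have := HK _ y2; rewrite -/y -norm_gamma_coef// -/y => far.
rewrite /N /cn -/y /lam -/y.
have := cn_gt0 n; rewrite /cn -/y; set c := `|_ / _| in far * => c0.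
rewrite -/(PQ p (y - 1)).
have ym : 0 < y - 1 by lra.
have Q1 : PQ p (y - 1) <= Cp p / (y - 1) by exact: PQ_le.
have Q2 : Cp p / (8 * (y - 1)) <= PQ p (y - 1 + m0) by apply: PQ_ge => //; lra.
set Q := PQ p (y - 1 + m0) in Q2 *.
have Q0 : 0 < Q by apply: lt_le_trans Q2; rewrite divr_gt0// mulr_gt0.
have Q3 : PQ p (y - 1) <= 8 * Q.
  apply: (le_trans Q1); rewrite -ler_pdivrMl// (le_trans _ Q2)// le_eqVlt; apply/orP; left.
  by apply/eqP; field; rewrite gt_eqF.
have E0 := expR_gt0 m0; have E1 := expR_gt0 `|m0|.
have near_le : c * ((expR eps - 1) * expR `|m0|) * PQ p (y - 1) <=
    c * (eta / 2 * expR m0) * Q.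
  have ee : (expR eps - 1) * expR `|m0| <= 2 * eps * expR `|m0|.
    by apply: ler_wpM2r (ltW E1) _ _ _; apply: expRB1_le; rewrite (ltW eps0).
  apply: (@le_trans _ _ (c * (2 * eps * expR `|m0|) * (8 * Q))).
    apply: ler_pM => //.
    - by rewrite !mulr_ge0 ?(ltW c0) ?(ltW E1)// subr_ge0 expR_ge1 ltW.
    - exact: PQ_ge0.
    - by apply: ler_wpM2l ee; exact: ltW.
  have -> : c * (2 * eps * expR `|m0|) * (8 * Q) = c * (2^-1 * (32 * eps * expR `|m0|)) * Q by field.
  apply: ler_wpM2r; first exact: ltW.
  by apply: ler_wpM2l; [exact: ltW|lra].
have far_le : K * c / y ^+ 2 <= c * (eta / 2 * expR m0) * Q.
  have yp : 0 < y by lra.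
  have -> : K * c / y ^+ 2 = c * (K / y ^+ 2) by ring.
  rewrite -mulrA; apply: ler_wpM2l; first exact: ltW.
  have q8 : Cp p / (8 * y) <= Q.
    apply: le_trans Q2; apply: ler_wpM2l; first exact: ltW.
    by rewrite lef_pV2 ?posrE ?mulr_gt0//; lra.
  apply: (@le_trans _ _ (eta / 2 * expR m0 * (Cp p / (8 * y)))); last first.
    by apply: ler_wpM2l q8; rewrite mulr_ge0 ?divr_ge0 ?(ltW e0) ?(ltW E0).
  have -> : eta / 2 * expR m0 * (Cp p / (8 * y)) = eta * expR m0 * Cp p * y / 16 / y ^+ 2.
    by field; rewrite gt_eqF.
  apply: ler_wpM2r; first by rewrite invr_ge0 exprn_ge0// ltW.
  rewrite ler_pdivrMr ?mulr_gt0// in y3.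
  by rewrite ler_pdivlMr//; lra.
have -> : eta * (c * expR m0 * Q) = c * (eta / 2 * expR m0) * Q + c * (eta / 2 * expR m0) * Q by field.
by apply: lerD => //; exact: le_trans far_le.
Unshelve. all: by end_near. Qed.

Lemma op_bd_HB eta : 0 < eta ->
  \forall n \near \oo, op_bd p (op_sub (H n) (B n)) (eta * N n).
Proof.
move=> e0; have E0 := expR_gt0 m0; have E1 := expR_gt0 `|m0|.
apply: near_inftyS; near=> n.
have y1 : 2 * `|m0| + 3 <= a * n.+1%:R by near: n; exact: near_affineS.
(* 1024 is the 64 of [pow_exp_diff] times 16, the ratio allowed below between [PQ] at half the rate
   and [Q]. *)
have y2 : 1024 * expR `|m0| / (eta * expR m0) + 1 <= a * n.+1%:R by near: n; exact: near_affineS.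
have := normr_ge0 m0; set y := a * n.+1%:R in y1 y2 * => n3.
have mp : 1 <= a * n.+1%:R - 1 by rewrite -/y; lra.
have := rank_one_part (f 0) m0 a0 p1 mp; rewrite -/y => rb.
apply: op_bd_le rb.
rewrite /N /cn -/y /lam -/y -/(PQ p ((y - 1) / 2)).
have := cn_gt0 n; rewrite /cn -/y; set c := `|_ / _| => c0.
have ym : 0 < y - 1 by lra.
have Q1 : PQ p ((y - 1) / 2) <= Cp p / ((y - 1) / 2) by apply: PQ_le => //; lra.
have Q2 : Cp p / (8 * (y - 1)) <= PQ p (y - 1 + m0) by apply: PQ_ge => //; lra.
set Q := PQ p (y - 1 + m0) in Q2 *.
have Q0 : 0 < Q by apply: lt_le_trans Q2; rewrite divr_gt0// mulr_gt0.
have Q3 : PQ p ((y - 1) / 2) <= 16 * Q.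
  apply: (le_trans Q1); rewrite -ler_pdivrMl// (le_trans _ Q2)// le_eqVlt; apply/orP; left.
  by apply/eqP; field; rewrite gt_eqF.
apply: (@le_trans _ _ (c * (expR `|m0| * (64 / (y - 1))) * (16 * Q))).
  by apply: ler_wpM2l => //; rewrite !mulr_ge0 ?invr_ge0 ?(ltW c0) ?(ltW E1) ?(ltW ym).
have -> : c * (expR `|m0| * (64 / (y - 1))) * (16 * Q) =
   c * Q * (1024 * expR `|m0| / (y - 1)) by field; rewrite gt_eqF.
have -> : eta * (c * expR m0 * Q) = c * Q * (eta * expR m0) by ring.
apply: ler_wpM2l; first by rewrite mulr_ge0 ?ltW.
rewrite ler_pdivrMr// [leRHS]mulrC -ler_pdivrMr ?mulr_gt0//; lra.
Unshelve. all: by end_near. Qed.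

Lemma op_bd_AB eta : 0 < eta ->
  \forall n \near \oo, op_bd p (op_sub (A n) (B n)) (eta * N n).
Proof.
move=> e0; have e2 : 0 < eta / 2 by rewrite divr_gt0.
near=> n.
have -> : eta * N n = eta / 2 * N n + eta / 2 * N n by field.
have AH : op_bd p (op_sub (A n) (H n)) (eta / 2 * N n) by near: n; exact: op_bd_AH.
have HB : op_bd p (op_sub (H n) (B n)) (eta / 2 * N n) by near: n; exact: op_bd_HB.
apply: op_bd_add p1 _ _ AH HB => u mu' uoo; apply: measurable_funB.
- exact: op_meas_A.
- exact: op_meas_H.
- exact: op_meas_H.
- exact: op_meas_B.
Unshelve. all: by end_near. Qed.

Lemma lam_near Y : \forall n \near \oo, Y <= lam n.
Proof.
near=> n; have : Y + 1 - m0 <= a * n%:R by near: n; exact: near_affine.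
by rewrite /lam; lra.
Unshelve. all: by end_near. Qed.

Lemma op_bd_B : \forall n \near \oo, 0 < N n /\ op_bd p (B n) (N n).
Proof.
apply: near_inftyS; near=> n.
have y1 : 2 * `|m0| + 3 <= a * n.+1%:R by near: n; exact: near_affineS.
have := ler_norm (- m0); rewrite normrN => n2.
have := normr_ge0 m0 => n3; have l0 : 0 < lam n.+1 by rewrite /lam; lra.
have c0 := cn_gt0 n.
have Q2 : Cp p / (8 * (a * n.+1%:R - 1)) <= PQ p (lam n.+1) by apply: PQ_ge => //; lra.
have Q0 : 0 < PQ p (lam n.+1).
  by apply: lt_le_trans Q2; rewrite divr_gt0// mulr_gt0//; lra.
split; first by rewrite /N mulr_gt0// mulr_gt0 ?expR_gt0// cn_gt0.
have := op_bd_scale_Sop (cn n.+1 * expR (- (a * n.+1%:R - 1))) p1 l0.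
rewrite (_ : `|_ * expR _| * expR (lam n.+1) * _ = N n.+1)//.
rewrite normrM (ger0_norm (expR_ge0 _)) -[X in X * _ = _]mulrA -expRD /N.
by congr (_ * expR _ * _); rewrite /lam; ring.
Unshelve. all: by end_near. Qed.

(** [B n] has rank one, so the norm of its value at [fs n] depends on a single integral: the test
    amounts to near equality in Hoelder's inequality for that integral. *)
Lemma extremal_test_B (fs : nat -> R -> R) (v : nat -> R) :
  (forall eta, 0 < eta -> \forall n \near \oo,
    [/\ measurable_fun I01 (fs n), LpN p (fs n) = (v n)%:E, 0 < v n &
       (1 - eta) * (Qn p (lam n) * v n) <= \int[mu]_s twist (lam n) (fs n) s]) ->
  extremal_test p B N fs v.
Proof.
move=> T eta e0; near=> n.
have [mf fv v0 I] : [/\ measurable_fun I01 (fs n), LpN p (fs n) = (v n)%:E, 0 < v n &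
       (1 - eta) * (Qn p (lam n) * v n) <= \int[mu]_s twist (lam n) (fs n) s].
  by near: n; exact: T.
have l0 : 0 < lam n by apply: (@lt_le_trans _ _ 1) => //; near: n; exact: lam_near.
split => //; rewrite LpN_scale_Sop// lee_fin normrM (ger0_norm (expR_ge0 _)).
have -> : `|cn n| * expR (- (a * n%:R - 1)) * expR (lam n) = `|cn n| * expR m0.
  by rewrite -mulrA -expRD; congr (_ * expR _); rewrite /lam; ring.
have -> : (1 - eta) * N n * v n =
   `|cn n| * expR m0 * Pn p (lam n) * ((1 - eta) * (Qn p (lam n) * v n)) by rewrite /N /PQ; ring.
apply: ler_wpM2l; first by rewrite !mulr_ge0 ?expR_ge0 ?Pn_ge0.
exact: le_trans I (ler_norm _).
Unshelve. all: by end_near. Qed.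

(** For [p = 1] the dual norm of [e^(- lam s)] is its value at 0, which no nonzero integrable
    function attains: the mass must concentrate near 0 on a scale shorter than [1 / lam n]. It does,
    as [lam n <= (a + |m0|) n] is negligible against [g n * n]. *)
Lemma test_L1 (g : nat -> R) : p = 1%E -> g n @[n --> \oo] --> +oo ->
  extremal_test p B N (fun n t => expR (- (g n * n%:R * t))) (fun n => phi (g n * n%:R)).
Proof.
move=> pE /cvgryPge g_oo; apply: extremal_test_B => eta e0; near=> n.
have g1 : 1 <= g n by near: n; exact: g_oo.
have g2 : (a + `|m0|) / eta <= g n by near: n; exact: g_oo.
have n1 : 1 <= n%:R :> R by near: n; exact: nbhs_infty_ger.
have l1 : 1 <= lam n by near: n; exact: lam_near.
have b0 : 0 < g n * n%:R by rewrite mulr_gt0//; lra.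
set b := g n * n%:R in b0 *.
have lb : 0 < lam n + b by lra.
split.
- exact: measurable_expM.
- by rewrite pE LpN_expM// mulr1 invr1 powRr1// ltW// phi_gt0.
- exact: phi_gt0.
rewrite (@Rintegral_twist_exp _ b)// pE /= eqxx mul1r /phi.
have lamb : lam n <= eta * b.
  rewrite ler_pdivrMr// in g2.
  have h1 : (a + `|m0|) * n%:R <= g n * eta * n%:R by apply: ler_wpM2r => //; lra.
  have h2 : `|m0| <= `|m0| * n%:R by rewrite ler_peMr.
  have := ler_norm m0; rewrite /lam /b; lra.
apply: (@le_trans _ _ ((1 - expR (- b)) / (lam n + b))); last first.
  apply: ler_wpM2r; first by rewrite invr_ge0 ltW.
  by rewrite lerB// ler_expR; lra.
rewrite mulrCA; apply: ler_wpM2l; first by rewrite subr_ge0 expR_le1; lra.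
rewrite ler_pdivrMr// mulrC ler_pdivlMr//.
have : 0 <= eta * lam n by rewrite mulr_ge0 ?(ltW e0)//; lra.
by lra.
Unshelve. all: by end_near. Qed.

(** The equality case of Hoelder's inequality, [e^(- lam s)] to the power [q - 1 = 1 / (p - 1)];
    [eta] is mere slack. *)
Lemma test_Lp x : p = x%:E -> 1 < x ->
  extremal_test p B N (fun n t => expR (- (lam n * t) / (x - 1)))
    (fun n => phi (lam n / (x - 1) * x) `^ x^-1).
Proof.
move=> pE x1; have xB : 0 < x - 1 by lra.
have fE n : (fun t => expR (- (lam n * t) / (x - 1))) = fun t => expR (- (lam n / (x - 1) * t)).
  by apply/funext => t; congr expR; ring.
apply: extremal_test_B => eta e0; near=> n.
have l1 : 1 <= lam n by near: n; exact: lam_near.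
have l0 : 0 < lam n by lra.
have b0 : 0 < lam n / (x - 1) by rewrite divr_gt0.
have bx : 0 < lam n / (x - 1) * x by rewrite mulr_gt0//; lra.
rewrite fE; split.
- exact: measurable_expM.
- by rewrite pE LpN_expM// ltW.
- by apply: powR_gt0; exact: phi_gt0.
rewrite (@Rintegral_twist_exp _ (lam n / (x - 1)))//; last by rewrite addr_gt0.
rewrite pE /= gt_eqF//.
have -> : lam n + lam n / (x - 1) = lam n * (x / (x - 1)) by field; rewrite gt_eqF.
have -> : lam n / (x - 1) * x = lam n * (x / (x - 1)) by ring.
have ph : 0 < phi (lam n * (x / (x - 1))) by rewrite phi_gt0// mulr_gt0// divr_gt0//; lra.
rewrite -powRD; last by rewrite (gt_eqF ph) implybT.
have -> : (x / (x - 1))^-1 + x^-1 = 1 by field; rewrite !gt_eqF//; lra.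
rewrite powRr1 ?(ltW ph)// ler_piMl ?(ltW ph)//; lra.
Unshelve. all: by end_near. Qed.

Lemma test_Ly : p = +oo%E -> extremal_test p B N (fun n t => 1) (fun=> 1).
Proof.
move=> pE; apply: extremal_test_B => eta e0; near=> n.
have l1 : 1 <= lam n by near: n; exact: lam_near.
split => //; first by rewrite pE LpNy_cst1.
rewrite (@Rintegral_twist_exp _ 0) ?addr0//; last 2 first.
- by lra.
- by move=> s; rewrite mul0r oppr0 expR0.
have ph : 0 < phi (lam n) by rewrite phi_gt0//; lra.
by rewrite pE /= mulr1 ler_piMl ?(ltW ph)//; lra.
Unshelve. all: by end_near. Qed.

(** The statements on operators and norms require just one test sequence; for [p = 1] the choice is
    [g n = n]. *)
Lemma exists_test : exists fs v, extremal_test p B N fs v.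
Proof.
have [x1|pE|] : [\/ exists2 x, p = x%:E & 1 < x, p = 1%E | p = +oo%E].
- case: p p1 => [x||]// x1; last by constructor 3.
  rewrite lee_fin le_eqVlt in x1; case/orP: x1 => [/eqP <-|x1]; first by constructor 2.
  by constructor 1; exists x.
- by have [x pE xgt1] := x1; eexists; eexists; exact: test_Lp pE xgt1.
- by eexists; eexists; apply: (test_L1 pE); exact: cvgr_idn.
- by move=> pE; eexists; eexists; exact: test_Ly.
Qed.

(** With [y = a n], [Gamma (y + 1) = y Gamma y] turns the quotient into [(lam PQ / Cp) (y / lam)].
    [PQ_bounds] squeezes the first factor, and [y / lam] tends to 1 because [y - lam = 1 - m0]. *)
Lemma norm_size_cvg :
  (N n / (Cp p * (`|f 0| * Gamma a) ^+ n * expR m0 / Gamma (a * n%:R + 1))) @[n --> \oo]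
    --> (1 : R).
Proof.
have z0 : ((lam n)^-1 : R) @[n --> \oo] --> (0 : R).
  apply/cvgr0Pnorm_le => e e0; near=> n.
  have le : e^-1 <= lam n by near: n; exact: lam_near.
  have l0 : 0 < lam n by rewrite (lt_le_trans _ le)// invr_gt0.
  by rewrite ger0_norm ?invr_ge0 ?(ltW l0)// -[leRHS]invrK lef_pV2 ?posrE ?invr_gt0.
have h1 : (1 + (1 - m0) * (lam n)^-1) @[n --> \oo] --> (1 + (1 - m0) * 0 : R).
  by apply: cvgD; [exact: cvg_cst|apply: cvgM => //; exact: cvg_cst].
rewrite mulr0 addr0 in h1.
(* The lower bound of the squeeze uses [e^(- lam) <= 1 / lam] in place of the exponential. *)
have h2 : ((1 - (lam n)^-1) ^+ 2 * (1 + (1 - m0) * (lam n)^-1)) @[n --> \oo] --> (1 : R).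
  have h3 : (1 - (lam n)^-1) @[n --> \oo] --> (1 - 0 : R).
    by apply: cvgB => //; exact: cvg_cst.
  rewrite subr0 in h3.
  have h4 : ((1 - (lam n)^-1) * (1 - (lam n)^-1) * (1 + (1 - m0) * (lam n)^-1)) @[n --> \oo]
     --> (1 * 1 * 1 : R) by apply: cvgM => //; exact: cvgM.
  by rewrite !mulr1 in h4.
apply: squeeze_cvgr h2 h1; apply: near_inftyS; near=> n.
have y1 : 2 * `|m0| + 3 <= a * n.+1%:R by near: n; exact: near_affineS.
have := ler_norm (- m0); rewrite normrN => n2; have n3 := normr_ge0 m0.
have l1 : 1 <= lam n.+1 by rewrite /lam; lra.
have l0 : 0 < lam n.+1 by lra.
have y0 : 0 < a * n.+1%:R by lra.
have G0 := Gamma_gt0 y0; have E0 := expR_gt0 m0.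
have Fn : 0 < (`|f 0| * Gamma a) ^+ n.+1 by rewrite exprn_gt0.
have -> : N n.+1 / (Cp p * (`|f 0| * Gamma a) ^+ n.+1 * expR m0 / Gamma (a * n.+1%:R + 1)) =
    lam n.+1 * PQ p (lam n.+1) / Cp p * (1 + (1 - m0) * (lam n.+1)^-1).
  have -> : 1 + (1 - m0) * (lam n.+1)^-1 = a * n.+1%:R / lam n.+1.
    have -> : a * n.+1%:R = lam n.+1 + (1 - m0) by rewrite /lam; ring.
    by field; rewrite gt_eqF.
  rewrite GammaS// /N norm_gamma_coef//.
  by field; rewrite !gt_eqF.
have /andP[b1 b2] := PQ_bounds p1 l0; rewrite -/(PQ p (lam n.+1)) in b1 b2.
have r0 : 0 <= 1 + (1 - m0) * (lam n.+1)^-1.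
  have -> : 1 + (1 - m0) * (lam n.+1)^-1 = a * n.+1%:R / lam n.+1.
    have -> : a * n.+1%:R = lam n.+1 + (1 - m0) by rewrite /lam; ring.
    by field; rewrite gt_eqF.
  by rewrite divr_ge0 ?ltW.
apply/andP; split; last first.
  rewrite -[leRHS]mul1r; apply: ler_wpM2r => //.
  by rewrite ler_pdivrMr// mul1r.
apply: ler_wpM2r => //; rewrite ler_pdivlMr//; apply: le_trans b1.
apply: ler_wpM2r; first exact: ltW.
have z1 : (lam n.+1)^-1 <= 1 by rewrite invf_le1.
rewrite ler_sqr ?nnegrE ?subr_ge0// ?expR_le1; last by lra.
rewrite lerB// expRN lef_pV2 ?posrE ?expR_gt0//.
by have := expR_ge1Dx (lam n.+1); lra.
Unshelve. all: by end_near. Qed.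

Lemma asym_op_AH : asym_op p A H.
Proof.
have [fs [v T]] := exists_test.
exact: (asym_op_near p1 op_meas_A op_meas_B op_bd_AB op_bd_B T op_bd_AH).
Qed.

Lemma asym_op_AB : asym_op p A B.
Proof.
have [fs [v T]] := exists_test.
exact: (asym_op_near p1 op_meas_A op_meas_B op_bd_AB op_bd_B T op_bd_AB).
Qed.

Lemma asym_extremal_A fs v : extremal_test p B N fs v -> asym_extremal p A fs.
Proof. exact: (extremal_cvg p1 op_meas_A op_meas_B op_bd_AB op_bd_B). Qed.

Lemma asym_num_opnorm : asym_num (fun n => fine (opnorm p (A n)))
  (fun n => Cp p * (`|f 0| * Gamma a) ^+ n * expR m0 / Gamma (a * n%:R + 1)).
Proof.
have [fs [v T]] := exists_test.
have h1 := opnorm_cvg p1 op_meas_A op_meas_B op_bd_AB op_bd_B T.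
set D := fun n : nat => _ / _.
have h2 : (fine (opnorm p (A n)) / N n * (N n / D n)) @[n --> \oo] --> (1 * 1 : R).
  by apply: cvgM => //; exact: norm_size_cvg.
rewrite mulr1 in h2; apply: cvg_trans h2; apply: near_eq_cvg; near=> n.
have [N0 _] : 0 < N n /\ op_bd p (B n) (N n) by near: n; exact: op_bd_B.
by rewrite /= mulrA divfK// gt_eqF.
Unshelve. all: by end_near. Qed.

End MainEstimates.

Theorem theorem4p3 (R : realType) (r : R) (f : R -> R) (d : R) :
  -1 < r ->
  (@leb R).-integrable I01 (EFin \o (fun t => t `^ r * f t)) ->
  f 0 != 0 ->
  ((f x - f 0) / x) @[x --> 0^'+] --> d ->
  let k := fun t => t `^ r * f t in
  let mu := d / f 0 in
  let h := fun t => f 0 * t `^ r * expR (mu * t) in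
  forall p : \bar R, (1 <= p)%E ->
    (* (i) *)
    asym_op p (fun n => iter n (Volt k)) (fun n => iter n (Volt h)) /\
    (* (ii) *)
    asym_op p (fun n => iter n (Volt k))
      (fun n => op_scale
         (f 0 ^+ n * Gamma (r + 1) ^+ n * expR (- ((r + 1) * n%:R - 1))
            / Gamma ((r + 1) * n%:R))
         (Sop ((r + 1) * n%:R - 1 + mu))) /\
    asym_num (fun n => fine (opnorm p (iter n (Volt k))))
      (fun n => Cp p * (`|f 0| * Gamma (r + 1)) ^+ n * expR mu
                  / Gamma ((r + 1) * n%:R + 1)) /\
    (* (iii) *)
    (p = 1%E -> forall g : nat -> R, g n @[n --> \oo] --> +oo ->
       asym_extremal p (fun n => iter n (Volt k))
         (fun n t => expR (- (g n * n%:R * t)))) /\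
    (forall x : R, p = x%:E -> 1 < x ->
       asym_extremal p (fun n => iter n (Volt k))
         (fun n t => expR (- (((r + 1) * n%:R - 1 + mu) * t) / (x - 1)))) /\
    (p = +oo%E ->
       asym_extremal p (fun n => iter n (Volt k)) (fun n t => 1)).
Proof.
move=> r1 ik f0 fd k mu h p p1.
have a0 : 0 < r + 1 by lra.
(* The estimates are phrased with [a = r + 1], the argument of [Gamma]. *)
have kE : k = fun t => t `^ (r + 1 - 1) * f t by rewrite addrK.
have hE : h = fun t => f 0 * t `^ (r + 1 - 1) * expR (mu * t) by rewrite addrK.
have ik' : (@lebesgue_measure R).-integrable I01 (EFin \o (fun t => t `^ (r + 1 - 1) * f t)).
  by rewrite addrK.
rewrite kE hE; split; first exact: asym_op_AH fd.
split.
  have := asym_op_AB a0 p1 f0 ik' fd.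
  rewrite (_ : (fun n => op_scale _ _) = (fun n : nat => op_scale
      (f 0 ^+ n * Gamma (r + 1) ^+ n * expR (- ((r + 1) * n%:R - 1)) / Gamma ((r + 1) * n%:R))
      (Sop ((r + 1) * n%:R - 1 + mu))))//.
  by apply/funext => n; rewrite exprMn; congr op_scale; ring.
split; first exact: asym_num_opnorm fd.
split=> [pE g g_oo|].
  apply: (asym_extremal_A a0 p1 f0 ik' fd); exact: (test_L1 f d a0 p1 pE g_oo).
split=> [x pE x1|pE].
  apply: (asym_extremal_A a0 p1 f0 ik' fd); exact: (test_Lp f d a0 p1 pE x1).
apply: (asym_extremal_A a0 p1 f0 ik' fd); exact: (test_Ly f d a0 p1 pE).
Qed.
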